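(* The following two equalities hold: $$\text{(i)}\quad \sum_{k=1}^{\infty}\frac{4^k H_{2k}^{(2)}}{k^2\binom{2k}{k}} = -8G^2+11\zeta(4)+2\operatorname{Li}_4\!\left(\tfrac12\right)+\ln^2(2)\,\zeta(2)+\tfrac{1}{12}\ln^4(2);$$ $$\text{(ii)}\quad \sum_{k=1}^{\infty}\frac{4^k H_{2k}^2}{k^2\binom{2k}{k}} = 8G^2+\tfrac{103}{2}\zeta(4)-22\operatorname{Li}_4\!\left(\tfrac12\right)+7\ln^2(2)\,\zeta(2)-\tfrac{11}{12}\ln^4(2).$$
   Context: For positive integers $k,m$, $H_k^{(m)}=\sum_{n=1}^k n^{-m}$ is the generalized harmonic number and $H_k=H_k^{(1)}$. $\binom{2k}{k}$ is the central binomial coefficient, $\zeta$ is the Riemann zeta function, $\operatorname{Li}_4(z)=\sum_{k\ge1} z^k/k^4$ is the polylogarithm of order $4$, and $G=\sum_{k\ge1}(-1)^{k+1}/(2k-1)^2$ is Catalan's constant. *)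

(* Defs.v *)
From Stdlib Require Import Reals.
From Coquelicot Require Import Coquelicot.
Open Scope R_scope.

Fixpoint harm (m k : nat) : R :=
  match k with
  | O => 0
  | S k' => harm m k' + / (INR (S k')) ^ m
  end.

Definition zeta (s : nat) : R := Series (fun n => / (INR (S n)) ^ s).

Definition Li4 (z : R) : R := Series (fun n => z ^ (S n) / (INR (S n)) ^ 4).

Definition catalan : R := Series (fun n => (-1) ^ n / (INR (2 * n + 1)) ^ 2).

(* Main.v *)
(* Write t_k = 4^k / (k^2 C(2k,k)). The connector k! / ((x+1)...(x+k)) telescopes both in k and in x;
   at x = -1/2 it equals k^2 t_k. Telescoping it, together with its first two Taylor coefficients in x,
   expresses sum t_k (H_{2k}^2 + H_{2k}^(2)) through the multiple t-values
     t(2,2), t(3,1), t(2,1,1)   (nested sums over odd numbers).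
   - t(2,1,1) reduces to t(3,1): with h the digamma-type function h(x) = sum_i (1/i - 1/(i+x)),
     the sums of (h(x) + h(-x))/x^2 and h(x) h(-x)/x^2 over all half-integers x vanish,
     and h takes the values 2 O_n - 2 ln 2 there, O_n being the odd harmonic numbers.
   - t(3,1) reduces, by partial fractions and parity, to sum (-1)^n H_n/(n+1)^3, which is evaluated
     by Landen and reflection formulas for polylogarithms at 1/2.
   - In sum t_k O_k^(2), expand t_k and t_k O_k^(2) along the ballot numbers
     (the Fourier coefficients of sin^(2k-1)). Summing over k first turns the ballot numbers into tails
     of the alternating harmonic series, and the resulting Euler sums over 4n+1 and 4n+3
     give t(2)^2 - G^2. *)
Require Import Defs.
From Stdlib Require Import Reals.
From Stdlib Require Import Lra Lia Psatz.
From Coquelicot Require Import Coquelicot.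
Open Scope R_scope.

(** * Series and double series *)

(** The quantity H_{2k}^2 + H_{2k}^(2) is twice the complete homogeneous function h_2 of 1, 1/2,
    ..., 1/(2k). This is why the two weights are first treated together: the second Taylor
    coefficient of the connector yields the odd part only as O_k^2 + O_k^(2), never O_k^(2) alone.
    Separating the two sums is the obstacle; the ballot numbers overcome it, and they are the only
    source of Catalan's constant. Sum (ii) is then obtained by subtracting (i). The one relation
    between zeta values that is used, zeta(2)^2 = 5/2 zeta(4), comes from evaluating the sum of H_l
    / (l+1)^3 in two ways. Double sums are exchanged either by nonnegativity or by domination.
    Divergent pieces such as the sum of 1/x are never isolated: they occur in a row and in a column
    of the same array and cancel. *)

Fixpoint rsum (f : nat -> R) (n : nat) : R :=
  match n with O => 0 | S k => rsum f k + f k end.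

Lemma rsum_S f n : rsum f (S n) = rsum f n + f n.
Proof. reflexivity. Qed.

Lemma rsum_sum_n f n : rsum f (S n) = sum_n f n.
Proof.
induction n as [|n IH]; simpl.
- rewrite sum_O. lra.
- rewrite sum_Sn, <- IH. simpl. reflexivity.
Qed.

(** [rsum f n] stops before index n while [sum_n f n] includes it; the two sequences differ by a
    shift, which preserves the limit. *)
Lemma is_series_rsum f l : is_series f l <-> is_lim_seq (rsum f) l.
Proof.
rewrite is_lim_seq_incr_1. split; intros H.
- apply is_lim_seq_ext with (sum_n f); [intros; symmetry; apply rsum_sum_n | exact H].
- change (is_lim_seq (sum_n f) l).
  apply is_lim_seq_ext with (fun n => rsum f (S n)); [intros; apply rsum_sum_n | exact H].
Qed.

Lemma rsum_ext f g n : (forall i, (i < n)%nat -> f i = g i) -> rsum f n = rsum g n.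
Proof. induction n; simpl; intros H; auto. rewrite IHn, H; auto. Qed.

Lemma rsum_plus f g n : rsum (fun i => f i + g i) n = rsum f n + rsum g n.
Proof. induction n; simpl; [|rewrite IHn]; lra. Qed.

Lemma rsum_minus f g n : rsum (fun i => f i - g i) n = rsum f n - rsum g n.
Proof. induction n; simpl; [|rewrite IHn]; lra. Qed.

Lemma rsum_scal c f n : rsum (fun i => c * f i) n = c * rsum f n.
Proof. induction n; simpl; [|rewrite IHn]; lra. Qed.

Lemma rsum_le f g n : (forall i, (i < n)%nat -> f i <= g i) -> rsum f n <= rsum g n.
Proof.
induction n; simpl; intros H; [lra|].
apply Rplus_le_compat; auto.
Qed.

Lemma rsum_pos f n : (forall i, (i < n)%nat -> 0 <= f i) -> 0 <= rsum f n.
Proof.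
induction n; simpl; intros H; [lra|].
apply Rplus_le_le_0_compat; auto.
Qed.

Lemma rsum_mono f n m : (forall i, 0 <= f i) -> (n <= m)%nat -> rsum f n <= rsum f m.
Proof. intros H; induction 1; simpl; [lra|]. specialize (H m); lra. Qed.

Lemma rsum_const c n : rsum (fun _ => c) n = INR n * c.
Proof. induction n; [simpl; lra|]. rewrite S_INR; simpl; rewrite IHn; lra. Qed.

Lemma rsum_tele f n : rsum (fun i => f i - f (S i)) n = f O - f n.
Proof. induction n; simpl; [|rewrite IHn]; lra. Qed.

Lemma rsum_exch f n m :
  rsum (fun i => rsum (f i) m) n = rsum (fun j => rsum (fun i => f i j) n) m.
Proof.
induction n; simpl.
- induction m; simpl; [|rewrite <- IHm]; lra.
- rewrite IHn, <- rsum_plus. apply rsum_ext; reflexivity.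
Qed.

Lemma rsum_shift f n : rsum f (S n) = f O + rsum (fun i => f (S i)) n.
Proof. induction n; simpl in *; [|rewrite IHn]; lra. Qed.

Lemma rsum_rev f n : rsum (fun i => f (n - S i)%nat) n = rsum f n.
Proof.
induction n; [reflexivity|].
rewrite rsum_shift. replace (S n - 1)%nat with n by lia. simpl rsum at 2.
rewrite (rsum_ext _ (fun i => f (n - S i)%nat)).
- rewrite IHn. simpl. lra.
- intros i Hi. f_equal; lia.
Qed.

Lemma rsum_le_series f l n : (forall i, 0 <= f i) -> is_series f l -> rsum f n <= l.
Proof.
intros H Hs. apply is_series_rsum in Hs.
apply (is_lim_seq_incr_compare _ _ Hs). intros k; simpl. specialize (H k); lra.
Qed.

Lemma is_series_tele (E a : nat -> R) (l : R) :
  (forall n, E n - E (S n) = a n) -> is_lim_seq E l -> is_series a (E O - l).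
Proof.
intros H HE. apply is_series_rsum.
apply is_lim_seq_ext with (fun n => E O - E n).
- intros n. rewrite <- rsum_tele. apply rsum_ext; auto.
- apply is_lim_seq_minus'; [apply is_lim_seq_const|exact HE].
Qed.

Lemma is_series_eq (f g : nat -> R) (l l' : R) :
  is_series f l -> (forall n, f n = g n) -> l = l' -> is_series g l'.
Proof. intros H He <-. eapply is_series_ext; eauto. Qed.

Lemma is_series_lin (a b : R) (f g : nat -> R) (l m : R) :
  is_series f l -> is_series g m -> is_series (fun n => a * f n + b * g n) (a * l + b * m).
Proof.
intros Hf Hg. apply (is_series_plus (fun n => a * f n) (fun n => b * g n)).
- apply (is_series_scal a f l Hf).
- apply (is_series_scal b g m Hg).
Qed.

Lemma is_series_scalR (a : R) (f : nat -> R) (l : R) :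
  is_series f l -> is_series (fun n => a * f n) (a * l).
Proof. intros Hf. apply (is_series_scal a f l Hf). Qed.

Lemma ex_series_dom (a b : nat -> R) :
  (forall n, Rabs (a n) <= b n) -> ex_series b -> ex_series a.
Proof. intros H Hb. exact (@ex_series_le R_AbsRing R_CompleteNormedModule a b H Hb). Qed.

Lemma ex_series_squeeze (a b : nat -> R) :
  (forall n, 0 <= a n <= b n) -> ex_series b -> ex_series a.
Proof.
intros H. apply ex_series_dom. intros n. rewrite Rabs_pos_eq; apply H.
Qed.

Lemma series_ge0 (a : nat -> R) l : (forall n, 0 <= a n) -> is_series a l -> 0 <= l.
Proof. intros H Hs. apply (rsum_le_series a l O H Hs). Qed.

Lemma is_series_shift (a : nat -> R) (l : R) (k : nat) :
  is_series a l -> is_series (fun n => a (k + n)%nat) (l - rsum a k).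
Proof.
intros H. apply is_series_rsum in H. apply is_series_rsum.
apply is_lim_seq_ext with (fun n => rsum a (k + n) - rsum a k).
- intros n. induction n.
  + rewrite Nat.add_0_r; simpl; lra.
  + rewrite Nat.add_succ_r; simpl. rewrite <- IHn; lra.
- apply is_lim_seq_minus'; [|apply is_lim_seq_const].
  apply is_lim_seq_ext with (fun n => rsum a (n + k)); [intros; f_equal; lia|].
  apply -> is_lim_seq_incr_n. exact H.
Qed.

Lemma is_series_unshift (a : nat -> R) (l : R) (k : nat) :
  is_series (fun n => a (k + n)%nat) l -> is_series a (l + rsum a k).
Proof.
intros H. apply is_series_rsum in H. apply is_series_rsum.
apply (is_lim_seq_incr_n (rsum a) k).
apply is_lim_seq_ext with (fun n => rsum (fun n => a (k + n)%nat) n + rsum a k).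
- intros n. induction n.
  + simpl; lra.
  + simpl. replace (k + n)%nat with (n + k)%nat by lia. rewrite <- IHn.
    replace (k + n)%nat with (n + k)%nat by lia. lra.
- apply (is_lim_seq_plus' _ _ l (rsum a k)); [exact H|apply is_lim_seq_const].
Qed.

Lemma rsum_filterlim {U} (F : (U -> Prop) -> Prop) {FF : Filter F}
  (f : nat -> U -> R) (l : nat -> R) n :
  (forall i, filterlim (f i) F (locally (l i))) ->
  filterlim (fun u => rsum (fun i => f i u) n) F (locally (rsum l n)).
Proof.
intros H. induction n; simpl.
- apply filterlim_const.
- eapply filterlim_comp_2; [exact IHn | exact (H n) | apply (filterlim_plus (rsum l n) (l n))].
Qed.

(** Dominated convergence for series: beyond N the tails are bounded by the tail of b uniformly in
    u, and the finite heads converge term by term. Each of the three errors takes a third of eps. *)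
Lemma tannery {U} (F : (U -> Prop) -> Prop) {FF : ProperFilter F}
  (f : nat -> U -> R) (l b : nat -> R) :
  ex_series b -> F (fun u => forall n, Rabs (f n u) <= b n) ->
  (forall n, filterlim (f n) F (locally (l n))) ->
  ex_series l /\ filterlim (fun u => Series (fun n => f n u)) F (locally (Series l)).
Proof.
intros Hb Hd Hl.
assert (Hlb : forall n, Rabs (l n) <= b n).
{ intros n. 
  apply (filterlim_le (F := F) (fun u => Rabs (f n u)) (fun _ => b n) (Rabs (l n)) (b n)).
  - revert Hd. apply filter_imp. auto.
  - apply (filterlim_comp _ _ _ (f n) Rabs F (locally (l n)) _ (Hl n)).
    apply (filterlim_Rabs (l n)).
  - apply filterlim_const. }
assert (Ex : forall c : nat -> R, (forall n, Rabs (c n) <= b n) -> ex_series c).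
{ intros c Hc. apply (ex_series_dom c b); auto. }
assert (Tail : forall c : nat -> R, (forall n, Rabs (c n) <= b n) ->
   forall N, Rabs (Series c - rsum c N) <= Series b - rsum b N).
{ intros c Hc N.
  pose proof (is_series_shift c _ N (Series_correct _ (Ex c Hc))) as H1.
  pose proof (is_series_shift b _ N (Series_correct _ Hb)) as H2.
  rewrite <- (is_series_unique _ _ H1), <- (is_series_unique _ _ H2).
  eapply Rle_trans.
  - apply Series_Rabs. apply (ex_series_dom _ (fun n => b (N + n)%nat)).
    + intros n. rewrite Rabs_Rabsolu. auto.
    + eexists; exact H2.
  - apply Series_le; [|eexists; exact H2].
    intros n; split; [apply Rabs_pos|auto]. }
split; [apply Ex, Hlb|].
apply filterlim_locally. intros eps.
pose proof (proj1 (is_series_rsum b (Series b)) (Series_correct _ Hb)) as Hlim.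
assert (Hp : 0 < eps / 3) by (destruct eps; simpl; lra).
apply is_lim_seq_spec in Hlim.
destruct (Hlim (mkposreal _ Hp)) as [N HN]. specialize (HN N (le_n N)). simpl in HN.
pose proof (rsum_filterlim F f l N Hl) as Hr.
pose proof (proj1 (filterlim_locally _ _) Hr (mkposreal _ Hp)) as Hr'.
generalize (filter_and _ _ Hd Hr'). apply filter_imp. intros u [H1 H2].
pose proof (Tail (fun n => f n u) H1 N) as T1.
pose proof (Tail l Hlb N) as T2.
change (Rabs (rsum (fun i => f i u) N - rsum l N) < eps / 3) in H2.
change (Rabs (Series (fun n => f n u) - Series l) < eps).
revert HN T1 T2 H2. unfold Rabs. repeat destruct Rcase_abs; lra.
Qed.

(** * Interchange of summation for nonnegative double series, through square partial sums *)

Section Square.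
Variables (f : nat -> nat -> R) (r : nat -> R).
Hypothesis (f0 : forall i j, 0 <= f i j) (fr : forall i, is_series (f i) (r i)).

Let sq M := rsum (fun i => rsum (f i) M) M.

Lemma sq_le_rows M : sq M <= rsum r M.
Proof. apply rsum_le. intros i _. apply rsum_le_series; auto. Qed.

(** The first M rows cut at column K lie inside the square of side max M K; then K tends to
    infinity. *)
Lemma rows_le_sq M (B : R) : (forall K, sq K <= B) -> rsum r M <= B.
Proof.
intros HB.
assert (L : is_lim_seq (fun L => rsum (fun i => rsum (f i) L) M) (rsum r M)).
{ apply (rsum_filterlim eventually (fun i L => rsum (f i) L) r M).
  intros i. apply (is_series_rsum (f i) (r i)), fr. }
apply (is_lim_seq_le (fun L => rsum (fun i => rsum (f i) L) M) (fun _ => B) (rsum r M) B);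
  [|exact L|apply is_lim_seq_const].
intros K. apply Rle_trans with (sq (Nat.max M K)); [|apply HB].
unfold sq. apply Rle_trans with (rsum (fun i => rsum (f i) (Nat.max M K)) M).
- apply rsum_le. intros i _. apply rsum_mono; [apply f0|lia].
- apply rsum_mono; [|lia]. intros i. apply rsum_pos; auto.
Qed.

Lemma sq_mono M : sq M <= sq (S M).
Proof.
unfold sq. apply Rle_trans with (rsum (fun i => rsum (f i) (S M)) M).
- apply rsum_le. intros i _. apply rsum_mono; [apply f0|lia].
- apply rsum_mono; [|lia]. intros i. apply rsum_pos; auto.
Qed.

(** The partial sums of the row sums are squeezed between [sq] and its limit. Squares are the right
    truncation because they are invariant under swapping the two indices, which the symmetrization
    arguments need. *)
Lemma rows_of_square (l : R) : is_lim_seq sq l -> is_series r l.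
Proof.
intros H.
assert (B : forall K, sq K <= l) by (intros K; apply (is_lim_seq_incr_compare _ _ H sq_mono)).
apply is_series_rsum.
apply (is_lim_seq_le_le sq _ (fun _ => l)); [|exact H|apply is_lim_seq_const].
intros n; split; [apply sq_le_rows|apply rows_le_sq, B].
Qed.

Lemma square_of_rows (l : R) : is_series r l -> is_lim_seq sq l.
Proof.
intros H.
assert (r0 : forall i, 0 <= r i) by (intros i; apply (series_ge0 (f i)); auto).
assert (B : forall K, sq K <= l).
{ intros K. eapply Rle_trans; [apply sq_le_rows|]. apply rsum_le_series; auto. }
destruct (ex_finite_lim_seq_incr sq l sq_mono B) as [l' Hl'].
pose proof (rows_of_square l' Hl') as H'.
apply is_series_unique in H. apply is_series_unique in H'. rewrite <- H, H'. exact Hl'.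
Qed.
End Square.

Section Triangle.
Variables (F : nat -> nat -> R) (r : nat -> R).
Hypothesis (F0 : forall i j, (i < j)%nat -> 0 <= F i j)
  (Fr : forall i, is_series (fun l => F i (S i + l)%nat) (r i)).

Let f i j := if Nat.ltb i j then F i j else 0.

Lemma tri_nonneg i j : 0 <= f i j.
Proof. unfold f. destruct (Nat.ltb_spec i j); [auto|lra]. Qed.

Lemma tri_row i : is_series (f i) (r i).
Proof.
replace (r i) with (r i + rsum (f i) (S i)).
- apply (is_series_unshift (f i)). eapply is_series_ext; [|apply Fr].
  intros n. unfold f. destruct (Nat.ltb_spec i (S i + n)); [reflexivity|lia].
- rewrite (rsum_ext _ (fun _ => 0)), rsum_const; [lra|].
  intros j Hj. unfold f. destruct (Nat.ltb_spec i j); [lia|reflexivity].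
Qed.

Lemma tri_square M :
  rsum (fun i => rsum (f i) M) M = rsum (fun l => rsum (fun i => F i l) l) M.
Proof.
rewrite rsum_exch. apply rsum_ext. intros j Hj.
assert (G : forall M, (j <= M)%nat -> rsum (fun i => f i j) M = rsum (fun i => F i j) j).
{ induction 1 as [|K HK IH].
  - apply rsum_ext. intros i Hi. unfold f. destruct (Nat.ltb_spec i j); [reflexivity|lia].
  - simpl. rewrite IH. unfold f. destruct (Nat.ltb_spec K j); [lia|lra]. }
apply G; lia.
Qed.

(** For an array supported on i < j, the square sum of side M is exactly the M-th partial sum of the
    finite column sums. *)
Lemma tri_cols (l : R) : is_series r l -> is_series (fun l => rsum (fun i => F i l) l) l.
Proof.
intros H. apply is_series_rsum.
eapply is_lim_seq_ext; [apply tri_square|].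
apply (square_of_rows f r tri_nonneg tri_row l H).
Qed.

End Triangle.

(** * Connected sums for the central binomial coefficient *)

(* H_k = O(root8 k) and conn x k = O(root8 k ^ -4) make every boundary term below vanish. *)
Definition root8 (k : nat) : R := sqrt (sqrt (sqrt (INR (S k)))).

Lemma INR_Sn_pos n : 0 < INR (S n).
Proof. apply lt_0_INR; lia. Qed.

Lemma root8_pow8 k : root8 k ^ 8 = INR (S k).
Proof.
unfold root8. pose proof (INR_Sn_pos k).
replace (sqrt (sqrt (sqrt (INR (S k)))) ^ 8)
  with (((sqrt (sqrt (sqrt (INR (S k)))) ^ 2) ^ 2) ^ 2) by ring.
rewrite !pow2_sqrt; auto using sqrt_pos; lra.
Qed.

Lemma root8_ge1 k : 1 <= root8 k.
Proof.
assert (H : forall y, 1 <= y -> 1 <= sqrt y) by (intros y Hy; rewrite <- sqrt_1; apply sqrt_le_1_alt; lra).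
unfold root8. do 3 apply H. rewrite S_INR. pose proof (pos_INR k); lra.
Qed.

Lemma root8_inv_lim : is_lim_seq (fun k => / root8 k) 0.
Proof.
apply is_lim_seq_ext with (fun k => sqrt (sqrt (sqrt (/ INR (S k))))).
- intros k. unfold root8. rewrite !sqrt_inv; reflexivity.
- rewrite <- sqrt_0, <- sqrt_0, <- sqrt_0 at 1.
  do 3 (apply is_lim_seq_continuous; [apply continuity_pt_filterlim, continuous_sqrt|]).
  apply (is_lim_seq_incr_1 (fun k => / INR k)).
  apply (is_lim_seq_inv INR p_infty); [apply is_lim_seq_INR|discriminate].
Qed.

Lemma harm_S m k : harm m (S k) = harm m k + / INR (S k) ^ m.
Proof. reflexivity. Qed.

Lemma harm_pos m k : 0 <= harm m k.
Proof.
induction k; [simpl; lra|]. rewrite harm_S.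
pose proof (pow_lt _ m (INR_Sn_pos k)) as H. apply Rinv_0_lt_compat in H. lra.
Qed.

(** The increment 1/(k+1) is compared with that of 16 (k+1)^(1/8). With u and v consecutive eighth
    roots, v^8 - u^8 = 1, and the factorization of v^8 - u^8 bounds it by 8 v^7 (v - u). *)
Lemma harm_le_root8 k : harm 1 k <= 16 * root8 k.
Proof.
induction k; [simpl; pose proof (root8_ge1 0); lra|].
rewrite harm_S, pow_1.
pose proof (root8_ge1 k) as H1. pose proof (root8_ge1 (S k)) as H2.
pose proof (root8_pow8 k) as P1. pose proof (root8_pow8 (S k)) as P2.
rewrite S_INR in P2. rewrite S_INR in P2.
set (u := root8 k) in *. set (v := root8 (S k)) in *.
assert (Huv : u <= v).
{ destruct (Rle_lt_dec u v) as [h|h]; auto.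
  assert (v ^ 8 <= u ^ 8) by (apply pow_incr; lra). rewrite S_INR in P1. lra. }
assert (P3 : v ^ 8 - u ^ 8 <= (v - u) * (8 * v ^ 7)).
{ replace (v ^ 8 - u ^ 8) with ((v - u) *
   (v^7 + v^6*u^1 + v^5*u^2 + v^4*u^3 + v^3*u^4 + v^2*u^5 + v^1*u^6 + u^7)) by ring.
  apply Rmult_le_compat_l; [lra|].
  assert (E : forall a b, v ^ a * u ^ b <= v ^ a * v ^ b).
  { intros a b. apply Rmult_le_compat_l; [apply pow_le; lra|apply pow_incr; lra]. }
  pose proof (E 6%nat 1%nat); pose proof (E 5%nat 2%nat); pose proof (E 4%nat 3%nat);
  pose proof (E 3%nat 4%nat); pose proof (E 2%nat 5%nat); pose proof (E 1%nat 6%nat);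
  pose proof (E 0%nat 7%nat).
  rewrite <- !pow_add in *. simpl Nat.add in *. rewrite ?pow_O in *. lra. }
assert (Hv7 : 0 < v ^ 7) by (apply pow_lt; lra).
assert (Hk : 0 < INR (S k)) by apply INR_Sn_pos.
assert (H3 : / INR (S k) <= 16 * (v - u)).
{ rewrite S_INR in *. apply Rmult_le_reg_l with (INR k + 1); [lra|].
  rewrite Rinv_r by lra.
  assert (H7 : v ^ 7 <= v ^ 8).
  { change (v ^ 8) with (v * v ^ 7). nra. }
  assert (1 <= (v - u) * (8 * v ^ 7)) by lra.
  assert ((v - u) * (8 * v^7) <= (v - u) * (8 * v ^ 8)) by nra.
  pose proof (pos_INR k).
  (* Since v^8 = k + 2 is at most 2 (k + 1), the constant 8 becomes 16. *)
  assert ((v - u) * (8 * (INR k + 1 + 1)) <= (v - u) * (16 * (INR k + 1))) by (apply Rmult_le_compat_l; lra).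
  rewrite P2 in *. nra. }
lra.
Qed.

Fixpoint conn (x : R) (k : nat) : R :=
  match k with O => 1 | S j => conn x j * INR (S j) / (x + INR (S j)) end.

(* Complete homogeneous symmetric functions of 1/(x+1), ..., 1/(x+k): up to sign, the first
   Taylor coefficients of conn in x, since
   conn (x+h) k = conn x k (1 - h recip_h1 x k + h^2 recip_h2 x k - ...). *)
Definition recip_h1 (x : R) (k : nat) : R := rsum (fun i => / (x + INR (S i))) k.

Definition recip_h2 (x : R) (k : nat) : R := rsum (fun i => recip_h1 x (S i) / (x + INR (S i))) k.

(** The second elementary symmetric function of 1, 1/2, ..., 1/k. *)
Definition harm_e2 (k : nat) : R := rsum (fun i => harm 1 i / INR (S i)) k.

Lemma conn_S x k : conn x (S k) = conn x k * INR (S k) / (x + INR (S k)).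
Proof. reflexivity. Qed.

Lemma recip_h1_S x k : recip_h1 x (S k) = recip_h1 x k + / (x + INR (S k)).
Proof. reflexivity. Qed.

Lemma recip_h2_S x k : recip_h2 x (S k) = recip_h2 x k + recip_h1 x (S k) / (x + INR (S k)).
Proof. reflexivity. Qed.

Lemma conn_pos x k : -1 < x -> 0 < conn x k.
Proof.
intros Hx. induction k; [simpl; lra|]. rewrite conn_S.
pose proof (INR_Sn_pos k). pose proof (pos_INR k). rewrite S_INR in *.
apply Rdiv_lt_0_compat; nra.
Qed.

Lemma conn_le_root8 x k : 1/2 <= x -> conn x k <= / root8 k ^ 4.
Proof.
intros Hx.
(* The bound propagates because (k+1)(k+2) <= (k+3/2)^2. *)
assert (H : conn x k ^ 2 <= / INR (S k)).
{ induction k; [simpl; lra|].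
  rewrite conn_S. pose proof (pos_INR k). rewrite !S_INR in *.
  replace ((conn x k * (INR k + 1) / (x + (INR k + 1))) ^ 2)
    with (conn x k ^ 2 * ((INR k + 1) / (x + (INR k + 1))) ^ 2) by (field; lra).
  apply Rle_trans with (/ (INR k + 1) * ((INR k + 1) / (1/2 + (INR k + 1))) ^ 2).
  - apply Rmult_le_compat; [apply pow2_ge_0|apply pow2_ge_0|exact IHk|].
    apply pow_incr. split; [apply Rlt_le, Rdiv_lt_0_compat; lra|].
    apply Rmult_le_compat_l; [lra|]. apply Rinv_le_contravar; lra.
  - apply Rle_trans with ((INR k + 1) / ((INR k + 1) * (INR k + 1 + 1)));
      [|right; field; lra].
    replace (/ (INR k + 1) * ((INR k + 1) / (1 / 2 + (INR k + 1))) ^ 2)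
      with ((INR k + 1) / (1 / 2 + (INR k + 1)) ^ 2) by (field; lra).
    apply Rmult_le_compat_l; [lra|]. apply Rinv_le_contravar; nra. }
assert (P : root8 k ^ 4 * root8 k ^ 4 = INR (S k)) by (rewrite <- root8_pow8; ring).
pose proof (INR_Sn_pos k) as Hk.
assert (P0 : 0 < root8 k ^ 4) by (apply pow_lt; pose proof (root8_ge1 k); lra).
pose proof (conn_pos x k ltac:(lra)) as Hg.
apply Rsqr_incr_0_var; [|apply Rlt_le, Rinv_0_lt_compat; auto].
unfold Rsqr. rewrite <- Rinv_mult, P. replace (conn x k * conn x k) with (conn x k ^ 2) by ring. exact H.
Qed.

(** All weights used are at most quadratic in harmonic numbers, so the product is of order
    [root8 k ^ 2 / root8 k ^ 4]. *)
Lemma conn_lim (w : nat -> R) x : 1/2 <= x ->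
  (forall k, 0 <= w k <= (1 + harm 1 k) ^ 2) -> is_lim_seq (fun k => w k * conn x k) 0.
Proof.
intros Hx Hw.
apply is_lim_seq_le_le with (fun _ => 0) (fun k => 289 * (/ root8 k * / root8 k)).
- intros k. pose proof (conn_pos x k ltac:(lra)) as Hg. specialize (Hw k).
  split; [nra|].
  pose proof (harm_le_root8 k). pose proof (root8_ge1 k). pose proof (harm_pos 1 k).
  apply Rle_trans with ((17 * root8 k) ^ 2 * / root8 k ^ 4).
  + apply Rmult_le_compat; try lra; [|apply conn_le_root8; auto].
    eapply Rle_trans; [apply Hw|]. apply pow_incr; lra.
  + right. field. lra.
- apply is_lim_seq_const.
- replace 0 with (289 * (0 * 0)) by ring.
  apply (is_lim_seq_scal_l _ 289 (0 * 0)).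
  apply (is_lim_seq_mult' _ _ 0 0); apply root8_inv_lim.
Qed.

Lemma harm_1_S k : harm 1 (S k) = harm 1 k + / INR (S k).
Proof. rewrite harm_S, pow_1. reflexivity. Qed.

Lemma harm_e2_S k : harm_e2 (S k) = harm_e2 k + harm 1 k / INR (S k).
Proof. reflexivity. Qed.

Lemma harm_e2_bounds k : 0 <= harm_e2 k <= harm 1 k ^ 2.
Proof.
induction k; [unfold harm_e2; simpl; lra|].
rewrite harm_e2_S, harm_1_S. pose proof (harm_pos 1 k).
assert (0 < / INR (S k)) by (apply Rinv_0_lt_compat, INR_Sn_pos).
unfold Rdiv. set (i := / INR (S k)) in *. set (h := harm 1 k) in *.
assert (0 <= h * i) by nra. split; nra.
Qed.

Lemma recip_h1_bounds x k : 1/2 <= x -> 0 <= recip_h1 x k <= harm 1 k.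
Proof.
intros Hx. induction k; [unfold recip_h1; simpl; lra|].
rewrite recip_h1_S, harm_1_S. pose proof (INR_Sn_pos k).
assert (0 < / (x + INR (S k))) by (apply Rinv_0_lt_compat; lra).
assert (/ (x + INR (S k)) <= / INR (S k)) by (apply Rinv_le_contravar; lra). lra.
Qed.

Lemma recip_h2_bounds x k : 1/2 <= x -> 0 <= recip_h2 x k <= harm 1 k ^ 2.
Proof.
intros Hx. induction k; [unfold recip_h2; simpl; lra|].
rewrite recip_h2_S. pose proof (recip_h1_bounds x (S k) Hx) as Ha. rewrite harm_1_S in *. pose proof (INR_Sn_pos k).
pose proof (harm_pos 1 k).
assert (0 < / (x + INR (S k))) by (apply Rinv_0_lt_compat; lra).
assert (/ (x + INR (S k)) <= / INR (S k)) by (apply Rinv_le_contravar; lra).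
unfold Rdiv. set (i := / INR (S k)) in *. set (j := / (x + INR (S k))) in *.
set (h := harm 1 k) in *. set (l := recip_h1 x (S k)) in *.
assert (l * j <= (h + i) * i) by (apply Rmult_le_compat; lra).
assert (0 <= l * j) by nra. assert (0 <= h * i) by nra. split; nra.
Qed.

(** * Transport identities of the connector in k and in x, and the sums they give *)

Lemma conn_transport_k x k : 0 < x -> conn x (S k) / INR (S k) = (conn x k - conn x (S k)) / x.
Proof. intros Hx. rewrite conn_S. pose proof (INR_Sn_pos k). field. lra. Qed.

(** Divided by k^2, this splits the term at x - 1 into the term at x plus conn x k / (k x); the sum
    of the latter over k is what the transport in k evaluates. *)
Lemma conn_transport_x x k : 0 < x -> conn (x - 1) k = conn x k * (1 + INR k / x).
Proof.
intros Hx. induction k; [simpl; field; lra|].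
rewrite !conn_S, IHk. pose proof (pos_INR k). rewrite S_INR. field. lra.
Qed.

Lemma H1_transport_x x k : 0 < x -> recip_h1 (x - 1) k = recip_h1 x k + / x - / (x + INR k).
Proof.
intros Hx. induction k; [unfold recip_h1; simpl; field; lra|].
rewrite !recip_h1_S, IHk. pose proof (pos_INR k). rewrite S_INR. field. lra.
Qed.

(** Up to sign, the coefficient of h when [conn_transport_x] is expanded at x + h. *)
Lemma conn_H1_transport_x x k : 0 < x ->
  conn (x - 1) k * recip_h1 (x - 1) k = conn x k * (recip_h1 x k + INR k / x * (recip_h1 x k + / x)).
Proof.
intros Hx. rewrite conn_transport_x, H1_transport_x by auto. pose proof (pos_INR k).
field. lra.
Qed.

(** The coefficient of h^2 in the same expansion, divided by [conn x k / x]; the factor x + k is x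
    (1 + k/x). *)
Lemma H2_transport_x x k : 0 < x ->
  (x + INR k) * recip_h2 (x - 1) k = (x + INR k) * recip_h2 x k + INR k * (recip_h1 x k / x + / x ^ 2).
Proof.
intros Hx. induction k; [unfold recip_h2; simpl; field; lra|].
pose proof (pos_INR k).
rewrite !recip_h2_S, H1_transport_x, recip_h1_S by auto. rewrite S_INR.
replace (x - 1 + (INR k + 1)) with (x + INR k) by ring.
apply Rmult_eq_reg_l with (x + INR k); [|lra].
replace ((x + INR k) * ((x + (INR k + 1)) *
   (recip_h2 (x - 1) k + (recip_h1 x k + / (x + (INR k + 1)) + / x - / (x + (INR k + 1))) / (x + INR k))))
 with ((x + (INR k + 1)) * ((x + INR k) * recip_h2 (x - 1) k)
   + (x + (INR k + 1)) * (recip_h1 x k + / x)) by (field; lra).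
rewrite IHk. field. lra.
Qed.

Lemma conn_H2_transport_x x k : 0 < x ->
  conn (x - 1) k * recip_h2 (x - 1) k = conn x k * (recip_h2 x k + INR k / x * (recip_h2 x k + recip_h1 x k / x + / x ^ 2)).
Proof.
intros Hx. rewrite conn_transport_x by auto. pose proof (pos_INR k).
replace (conn x k * (1 + INR k / x) * recip_h2 (x - 1) k)
  with (conn x k / x * ((x + INR k) * recip_h2 (x - 1) k)) by (field; lra).
rewrite H2_transport_x by auto. field. lra.
Qed.

(** Summation by parts: f will be a weight times the connector, and b collects what the increments
    of the weight contribute. *)
Lemma transport_sum (x l : R) (f b : nat -> R) : 0 < x ->
  is_lim_seq f 0 -> is_series b l ->
  is_series (fun k => (f k - f (S k)) / x + b k / x) ((f O + l) / x).
Proof.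
intros Hx Hf Hb.
pose proof (is_series_tele f _ 0 (fun n => eq_refl) Hf) as Ht.
eapply is_series_eq; [apply (is_series_lin (/x) (/x) _ _ _ _ Ht Hb)| |].
- intros n; simpl. field; lra.
- simpl. field; lra.
Qed.

Lemma conn_sum x : 1/2 <= x -> is_series (fun k => 1 * (conn x (S k) / INR (S k))) (/ x).
Proof.
intros Hx.
assert (Hl : is_lim_seq (conn x) 0).
{ apply is_lim_seq_ext with (fun k => 1 * conn x k); [intros; lra|].
  apply conn_lim; auto. intros k; pose proof (harm_pos 1 k); nra. }
assert (H0 : is_series (fun _ : nat => 0) 0).
{ apply is_series_rsum. apply is_lim_seq_ext with (fun _ => 0); [|apply is_lim_seq_const].
  intros n. rewrite rsum_const; lra. }
pose proof (transport_sum x 0 (conn x) _ ltac:(lra) Hl H0) as T.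
eapply is_series_eq; [exact T| |].
- intros k; cbv beta. rewrite conn_transport_k by lra. field; lra.
- simpl. field; lra.
Qed.

(** When the increment v is an earlier weight over k+1, the hypothesis is the previous sum. Each
    further level of a nested harmonic sum therefore costs one factor 1/x. *)
Lemma conn_sum_weight x w v l : 1/2 <= x -> w O = 0 ->
  (forall k, 0 <= w k <= (1 + harm 1 k) ^ 2) ->
  (forall k, w (S k) = w k + v k) ->
  is_series (fun k => v k * conn x (S k)) l ->
  is_series (fun k => w k * (conn x (S k) / INR (S k))) (l / x).
Proof.
intros Hx H0 Hw Hv Hl.
pose proof (transport_sum x l (fun k => w k * conn x k) _ ltac:(lra) (conn_lim w x Hx Hw) Hl) as T.
eapply is_series_eq; [exact T| |].
- intros k; cbv beta. rewrite Hv. rewrite conn_transport_k by lra. field; lra.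
- simpl. rewrite H0. field; lra.
Qed.

Lemma is_series_ext_R (f h : nat -> R) (l : R) :
  (forall n, f n = h n) -> is_series f l -> is_series h l.
Proof. apply is_series_ext. Qed.

Lemma conn_sum_harm1 x : 1/2 <= x ->
  is_series (fun k => harm 1 k * (conn x (S k) / INR (S k))) (/ x ^ 2).
Proof.
intros Hx. replace (/ x ^ 2) with (/ x / x) by (field; lra).
apply conn_sum_weight with (v := fun k => / INR (S k)); auto.
- intros k. pose proof (harm_pos 1 k); nra.
- intros; apply harm_1_S.
- eapply is_series_ext_R; [|apply conn_sum; auto].
  intros n; simpl. unfold Rdiv. ring.
Qed.

Lemma conn_sum_e2 x : 1/2 <= x ->
  is_series (fun k => harm_e2 k * (conn x (S k) / INR (S k))) (/ x ^ 3).
Proof.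
intros Hx. replace (/ x ^ 3) with (/ x ^ 2 / x) by (field; lra).
apply conn_sum_weight with (v := fun k => harm 1 k / INR (S k)); auto.
- intros k. pose proof (harm_pos 1 k); pose proof (harm_e2_bounds k); nra.
- eapply is_series_ext_R; [|apply conn_sum_harm1; auto].
  intros n; simpl. unfold Rdiv. ring.
Qed.

Lemma harm2_le_harm1 k : harm 2 k <= harm 1 k * (1 + harm 1 k).
Proof.
induction k; [simpl; lra|].
rewrite harm_1_S, harm_S. pose proof (harm_pos 1 k).
assert (0 < / INR (S k)) by (apply Rinv_0_lt_compat, INR_Sn_pos).
replace (/ INR (S k) ^ 2) with (/ INR (S k) * / INR (S k))
  by (field; pose proof (INR_Sn_pos k); lra).
nra.
Qed.

Lemma conn_sum_harm2 x l : 1/2 <= x ->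
  is_series (fun k => 1 * (conn x (S k) / INR (S k) ^ 2)) l ->
  is_series (fun k => harm 2 k * (conn x (S k) / INR (S k))) (l / x).
Proof.
intros Hx Hl.
apply conn_sum_weight with (v := fun k => / INR (S k) ^ 2); auto.
- intros k. pose proof (harm_pos 1 k); pose proof (harm_pos 2 k).
  pose proof (harm2_le_harm1 k); nra.
- eapply is_series_ext_R; [|exact Hl].
  intros n; cbv beta. unfold Rdiv. ring.
Qed.

(** Here [recip_h1] has an increment too, namely 1/(x+k+1). Since conn x k / (x+k+1) = conn x (k+1)
    / (k+1), it produces the second term of the hypothesis. *)
Lemma conn_sum_weight_h1 x w v l : 1/2 <= x ->
  (forall k, 0 <= w k <= 1 + harm 1 k) ->
  (forall k, w (S k) = w k + v k) ->
  is_series (fun k => v k * (recip_h1 x (S k) * conn x (S k))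
    + w k * (conn x (S k) / INR (S k))) l ->
  is_series (fun k => w k * recip_h1 x (S k) * (conn x (S k) / INR (S k))) (l / x).
Proof.
intros Hx Hw Hv Hl.
assert (Hb : forall k, 0 <= w k * recip_h1 x k <= (1 + harm 1 k) ^ 2).
{ intros k. pose proof (recip_h1_bounds x k Hx). specialize (Hw k). 
  pose proof (harm_pos 1 k). split; [nra|]. simpl. rewrite Rmult_1_r.
  apply Rmult_le_compat; lra. }
pose proof (transport_sum x l (fun k => w k * recip_h1 x k * conn x k) _ ltac:(lra) (conn_lim _ x Hx Hb) Hl) as T.
eapply is_series_eq; [exact T| |].
- intros k; cbv beta. rewrite Hv, recip_h1_S, conn_S. pose proof (INR_Sn_pos k). field; lra.
- unfold recip_h1; simpl. field; lra.
Qed.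

Lemma conn_sum_h1 x : 1/2 <= x ->
  is_series (fun k => 1 * recip_h1 x (S k) * (conn x (S k) / INR (S k))) (/ x ^ 2).
Proof.
intros Hx. replace (/ x ^ 2) with (/ x / x) by (field; lra).
apply (conn_sum_weight_h1 x (fun _ => 1) (fun _ => 0)); auto.
- intros k. pose proof (harm_pos 1 k); lra.
- intros; lra.
- eapply is_series_ext_R; [|apply conn_sum; auto]. intros; cbv beta; lra.
Qed.

Lemma conn_sum_harm1_h1 x : 1/2 <= x ->
  is_series (fun k => harm 1 k * recip_h1 x (S k) * (conn x (S k) / INR (S k))) (2 / x ^ 3).
Proof.
intros Hx. replace (2 / x ^ 3) with ((1 * / x ^ 2 + 1 * / x ^ 2) / x) by (field; lra).
apply (conn_sum_weight_h1 x _ (fun k => / INR (S k))); auto.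
- intros k. pose proof (harm_pos 1 k); lra.
- apply harm_1_S.
- eapply is_series_ext_R; [|apply is_series_lin; [apply conn_sum_h1|apply conn_sum_harm1]; auto].
  intros; cbv beta; unfold Rdiv; ring.
Qed.

Lemma conn_sum_h2 x : 1/2 <= x ->
  is_series (fun k => recip_h2 x (S k) * (conn x (S k) / INR (S k))) (/ x ^ 3).
Proof.
intros Hx. 
assert (Hb : forall k, 0 <= recip_h2 x k <= (1 + harm 1 k) ^ 2).
{ intros k. pose proof (recip_h2_bounds x k Hx). pose proof (harm_pos 1 k). nra. }
pose proof (transport_sum x _ (fun k => recip_h2 x k * conn x k) _ ltac:(lra) (conn_lim _ x Hx Hb) (conn_sum_h1 x Hx)) as T.
eapply is_series_eq; [exact T| |].
- intros k; cbv beta. rewrite recip_h2_S, conn_S. pose proof (INR_Sn_pos k). field; lra.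
- unfold recip_h2; simpl. field; lra.
Qed.

(** * Descent in x: the transport in x is iterated over the half-integers *)

Definition tail (D : nat -> R) (n : nat) : R := Series (fun m => D (n + m)%nat).

Lemma tail_series D n : ex_series D -> is_series (fun m => D (n + m)%nat) (tail D n).
Proof.
intros [l Hl]. apply Series_correct. eexists. apply (is_series_shift D l n Hl).
Qed.

Lemma tail_lim D : ex_series D -> is_lim_seq (tail D) 0.
Proof.
intros [l Hl].
apply is_lim_seq_ext with (fun n => l - rsum D n).
- intros n. symmetry. apply is_series_unique, is_series_shift, Hl.
- replace 0 with (l - l) by ring.
  apply is_lim_seq_minus'; [apply is_lim_seq_const|apply is_series_rsum, Hl].
Qed.

Lemma tail_pos D n : (forall m, 0 <= D m) -> ex_series D -> 0 <= tail D n.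
Proof. intros H Hx. eapply series_ge0; [|apply tail_series, Hx]. intros; apply H. Qed.

Lemma is_lim_seq_shift1 (u : nat -> R) (l : R) : is_lim_seq u l -> is_lim_seq (fun n => u (S n)) l.
Proof. intros H. apply -> is_lim_seq_incr_1. exact H. Qed.

(** Summing the recurrence over k gives E n - E (n+1) = D n, and the majorant c forces E n to 0, so
    E n is the tail of D. *)
Lemma descent (e d c : nat -> nat -> R) (D C : nat -> R) :
  (forall n k, e n k = e (S n) k + d n k) ->
  (forall n, is_series (d n) (D n)) ->
  (forall n k, 0 <= e (S n) k <= c n k) ->
  (forall n, is_series (c n) (C n)) -> is_lim_seq C 0 ->
  ex_series D /\ forall n, is_series (e n) (tail D n).
Proof.
intros He Hd Hc HC HC0.
assert (E1 : forall n, ex_series (e (S n))).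
{ intros n. apply (ex_series_squeeze _ (c n)); auto. eexists; apply HC. }
(* Only the terms [e (S n)] are dominated. In the applications [e 0] sits at x = -1/2, and its
   convergence is inherited from [e 1] and [d 0]. *)
assert (E0 : forall n, ex_series (e n)).
{ intros n. apply (ex_series_ext (fun k => e (S n) k + d n k)); [intros; symmetry; apply He|].
  apply (ex_series_plus (e (S n)) (d n)); auto. eexists; apply Hd. }
set (E := fun n => Series (e n)).
assert (HE : forall n, E n - E (S n) = D n).
{ intros n. unfold E. rewrite <- (is_series_unique _ _ (Hd n)), <- Series_minus; auto.
  apply Series_ext. intros k. rewrite (He n k). ring. }
assert (Hlim : is_lim_seq E 0).
{ apply is_lim_seq_incr_1. apply (is_lim_seq_le_le (fun _ => 0) _ C); auto using is_lim_seq_const.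
  intros n; split.
  - apply (series_ge0 (e (S n))); [intros k; apply Hc|apply Series_correct; auto].
  - unfold E. rewrite <- (is_series_unique _ _ (HC n)). apply Series_le; auto. eexists; apply HC. }
assert (HD : forall n, is_series (fun m => D (n + m)%nat) (E n)).
{ intros n. pose proof (is_series_tele (fun m => E (n + m)%nat) (fun m => D (n + m)%nat) 0) as T.
  cbv beta in T. rewrite Nat.add_0_r in T. rewrite <- (Rminus_0_r (E n)). apply T.
  - intros m. rewrite Nat.add_succ_r. apply HE.
  - apply is_lim_seq_ext with (fun m => E (m + n)%nat); [intros; f_equal; lia|].
    apply -> is_lim_seq_incr_n. exact Hlim. }
split.
- exists (E O). exact (HD O).
- intros n. replace (tail D n) with (E n); [apply Series_correct; auto|].
  symmetry. apply is_series_unique, HD.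
Qed.

Definition half_odd (n : nat) : R := INR n + 1/2.

Lemma half_odd_ge n : 1/2 <= half_odd n.
Proof. unfold half_odd. pose proof (pos_INR n); lra. Qed.

Lemma half_odd_S n : half_odd (S n) - 1 = half_odd n.
Proof. unfold half_odd. rewrite S_INR. ring. Qed.

(* cbterm 0 k = 4^(k+1) / ((k+1)^2 C(2k+2,k+1)); raising n shifts the connector in x. *)
Definition cbterm (n k : nat) : R := conn (half_odd n - 1) (S k) / INR (S k) ^ 2.

Lemma cbterm_S n k : cbterm (S n) k = conn (half_odd n) (S k) / INR (S k) ^ 2.
Proof. unfold cbterm. rewrite half_odd_S. reflexivity. Qed.

Lemma cbterm_S_bounds n k : 0 <= cbterm (S n) k <= conn (half_odd n) (S k) / INR (S k).
Proof.
rewrite cbterm_S. pose proof (half_odd_ge n). pose proof (conn_pos (half_odd n) (S k) ltac:(lra)).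
assert (1 <= INR (S k)) by (rewrite S_INR; pose proof (pos_INR k); lra).
split.
- apply Rlt_le, Rdiv_lt_0_compat; auto. apply pow_lt; lra.
- apply Rmult_le_compat_l; [lra|]. apply Rinv_le_contravar; nra.
Qed.

(** By [conn_transport_x], [cbterm n k] exceeds [cbterm (S n) k] by conn x (k+1) / ((k+1) x) with x
    = n + 1/2, whose weighted sum over k is F n / x. *)
Lemma descent_weight (w : nat -> R) (F : nat -> R) :
  (forall k, 0 <= w k) ->
  (forall n, is_series (fun k => w k * (conn (half_odd n) (S k) / INR (S k))) (F n)) ->
  is_lim_seq F 0 ->
  ex_series (fun n => F n / half_odd n) /\
  forall n, is_series (fun k => w k * cbterm n k) (tail (fun n => F n / half_odd n) n).
Proof.
intros Hw HF HF0.
apply (descent (fun n k => w k * cbterm n k)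
  (fun n k => / half_odd n * (w k * (conn (half_odd n) (S k) / INR (S k))))
  (fun n k => w k * (conn (half_odd n) (S k) / INR (S k))) _ F); auto.
- intros n k. rewrite cbterm_S. unfold cbterm. pose proof (half_odd_ge n). rewrite conn_transport_x by lra.
  pose proof (INR_Sn_pos k). field; lra.
- intros n. eapply is_series_eq; [apply (is_series_scalR (/ half_odd n)), HF| |].
  + intros; reflexivity.
  + unfold Rdiv; ring.
- intros n k. pose proof (cbterm_S_bounds n k). specialize (Hw k). split; [nra|].
  apply Rmult_le_compat_l; lra.
Qed.

Lemma descent_weight_h1 (w : nat -> R) (F G : nat -> R) :
  (forall k, 0 <= w k) ->
  (forall n, is_series (fun k => w k * (conn (half_odd n) (S k) / INR (S k))) (F n)) ->
  (forall n, is_series (fun k => w k * recip_h1 (half_odd n) (S k) * (conn (half_odd n) (S k) / INR (S k))) (G n)) ->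
  is_lim_seq G 0 ->
  ex_series (fun n => G n / half_odd n + F n / half_odd n ^ 2) /\
  forall n, is_series (fun k => w k * recip_h1 (half_odd n - 1) (S k) * cbterm n k)
    (tail (fun n => G n / half_odd n + F n / half_odd n ^ 2) n).
Proof.
intros Hw HF HG HG0.
apply (descent (fun n k => w k * recip_h1 (half_odd n - 1) (S k) * cbterm n k)
  (fun n k => / half_odd n * (w k * recip_h1 (half_odd n) (S k) * (conn (half_odd n) (S k) / INR (S k)))
     + / half_odd n ^ 2 * (w k * (conn (half_odd n) (S k) / INR (S k))))
  (fun n k => w k * recip_h1 (half_odd n) (S k) * (conn (half_odd n) (S k) / INR (S k))) _ G); auto.
- intros n k. rewrite cbterm_S, half_odd_S. unfold cbterm. pose proof (half_odd_ge n).
  pose proof (INR_Sn_pos k).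
  replace (w k * recip_h1 (half_odd n - 1) (S k) * (conn (half_odd n - 1) (S k) / INR (S k) ^ 2))
    with (w k * (conn (half_odd n - 1) (S k) * recip_h1 (half_odd n - 1) (S k)) / INR (S k) ^ 2) by (field; lra).
  rewrite conn_H1_transport_x by lra. field; lra.
- intros n. eapply is_series_eq;
   [apply (is_series_lin (/ half_odd n) (/ half_odd n ^ 2) _ _ _ _ (HG n) (HF n))| |].
  + intros; reflexivity.
  + unfold Rdiv; ring.
- intros n k. pose proof (cbterm_S_bounds n k). specialize (Hw k). rewrite half_odd_S.
  pose proof (recip_h1_bounds (half_odd n) (S k) (half_odd_ge n)).
  assert (0 <= w k * recip_h1 (half_odd n) (S k)) by nra. split; [nra|].
  apply Rmult_le_compat_l; lra.
Qed.

Definition half_pow (s m : nat) : R := / half_odd m ^ s.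

Lemma half_pow_pos s m : 0 < half_pow s m.
Proof. apply Rinv_0_lt_compat, pow_lt. pose proof (half_odd_ge m); lra. Qed.

Lemma tail_ext D D' n : (forall m, D m = D' m) -> tail D n = tail D' n.
Proof. intros H; apply Series_ext; intros; apply H. Qed.

Lemma half_pow_lim s : is_lim_seq (half_pow (S s)) 0.
Proof.
apply (is_lim_seq_le_le (fun _ => 0) _ (fun n => 2 ^ s * / half_odd n)).
- intros n. split; [apply Rlt_le, half_pow_pos|]. unfold half_pow. pose proof (half_odd_ge n).
  simpl pow. rewrite Rinv_mult, Rmult_comm. apply Rmult_le_compat_r.
  + apply Rlt_le, Rinv_0_lt_compat; lra.
  + rewrite <- pow_inv. apply pow_incr. split; [apply Rlt_le, Rinv_0_lt_compat; lra|].
    rewrite <- (Rinv_inv 2). apply Rinv_le_contravar; lra.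
- apply is_lim_seq_const.
- replace 0 with (2 ^ s * 0) by ring. apply (is_lim_seq_scal_l _ (2 ^ s) 0).
  apply (is_lim_seq_inv half_odd p_infty); [|discriminate].
  unfold half_odd. apply (is_lim_seq_plus _ _ p_infty (1/2) p_infty);
   [apply is_lim_seq_INR|apply is_lim_seq_const|reflexivity].
Qed.

(** The first component is a convergence proof for the sum of 1/(m+1/2)^2. It and its analogues for
    exponents 3 and 4, in [descent_harm1] and [descent_e2], are the source of convergence for most
    later series. *)
Lemma descent_one : ex_series (half_pow 2) /\ forall n, is_series (fun k => 1 * cbterm n k) (tail (half_pow 2) n).
Proof.
destruct (descent_weight (fun _ => 1) (half_pow 1)) as [A B].
- intros; lra.
- intros n. unfold half_pow; rewrite pow_1. apply conn_sum, half_odd_ge.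
- apply half_pow_lim.
- assert (E : forall n, half_pow 1 n / half_odd n = half_pow 2 n).
  { intros n. unfold half_pow. pose proof (half_odd_ge n). field. lra. }
  split; [eapply ex_series_ext; [|exact A]; exact E|].
  intros n. rewrite <- (tail_ext _ _ n E). apply B.
Qed.

Lemma descent_harm1 : ex_series (half_pow 3) /\ forall n, is_series (fun k => harm 1 k * cbterm n k) (tail (half_pow 3) n).
Proof.
destruct (descent_weight (harm 1) (half_pow 2)) as [A B].
- apply harm_pos.
- intros n. apply conn_sum_harm1, half_odd_ge.
- apply half_pow_lim.
- assert (E : forall n, half_pow 2 n / half_odd n = half_pow 3 n).
  { intros n. unfold half_pow. pose proof (half_odd_ge n). field. lra. }
  split; [eapply ex_series_ext; [|exact A]; exact E|].
  intros n. rewrite <- (tail_ext _ _ n E). apply B.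
Qed.

Lemma descent_e2 : ex_series (half_pow 4) /\ forall n, is_series (fun k => harm_e2 k * cbterm n k) (tail (half_pow 4) n).
Proof.
destruct (descent_weight harm_e2 (half_pow 3)) as [A B].
- apply harm_e2_bounds.
- intros n. apply conn_sum_e2, half_odd_ge.
- apply half_pow_lim.
- assert (E : forall n, half_pow 3 n / half_odd n = half_pow 4 n).
  { intros n. unfold half_pow. pose proof (half_odd_ge n). field. lra. }
  split; [eapply ex_series_ext; [|exact A]; exact E|].
  intros n. rewrite <- (tail_ext _ _ n E). apply B.
Qed.

(** With one more factor 1/(k+1) in the weight, the sum required at stage n is the one already known
    at stage n+1. So each division by k+1 adds one strict level of nesting. *)
Lemma descent_weight_div (w : nat -> R) (D : nat -> R) :
  (forall k, 0 <= w k) -> ex_series D ->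
  (forall n, is_series (fun k => w k * cbterm n k) (tail D n)) ->
  ex_series (fun n => tail D (S n) / half_odd n) /\
  forall n, is_series (fun k => w k / INR (S k) * cbterm n k) (tail (fun n => tail D (S n) / half_odd n) n).
Proof.
intros Hw HD HF.
apply (descent_weight (fun k => w k / INR (S k)) (fun n => tail D (S n))).
- intros k. apply Rmult_le_pos; auto. apply Rlt_le, Rinv_0_lt_compat, INR_Sn_pos.
- intros n. eapply is_series_ext_R; [|apply (HF (S n))].
  intros k; cbv beta. rewrite cbterm_S. pose proof (INR_Sn_pos k). field. lra.
- apply is_lim_seq_shift1, tail_lim, HD.
Qed.

Lemma descent_harm2 : ex_series (fun n => tail (half_pow 2) (S n) / half_odd n / half_odd n) /\
  forall n, is_series (fun k => harm 2 k * cbterm n k) (tail (fun n => tail (half_pow 2) (S n) / half_odd n / half_odd n) n).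
Proof.
apply (descent_weight (harm 2) (fun n => tail (half_pow 2) (S n) / half_odd n)).
- apply harm_pos.
- intros n. apply conn_sum_harm2; [apply half_odd_ge|].
  eapply is_series_ext_R; [|apply (proj2 descent_one (S n))]. intros k; cbv beta. rewrite cbterm_S; reflexivity.
- apply (is_lim_seq_ext (fun n => tail (half_pow 2) (S n) * half_pow 1 n)).
  { intros n. unfold half_pow at 2. rewrite pow_1. reflexivity. }
  replace 0 with (0 * 0) by ring. apply (is_lim_seq_mult' _ _ 0 0); [|apply half_pow_lim].
  apply is_lim_seq_shift1, tail_lim, descent_one.
Qed.

Lemma descent_h1 : ex_series (fun n => 2 * half_pow 3 n) /\
  forall n, is_series (fun k => 1 * recip_h1 (half_odd n - 1) (S k) * cbterm n k) (tail (fun n => 2 * half_pow 3 n) n).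
Proof.
destruct (descent_weight_h1 (fun _ => 1) (half_pow 1) (half_pow 2)) as [A B].
- intros; lra.
- intros n. unfold half_pow; rewrite pow_1. apply conn_sum, half_odd_ge.
- intros n. apply conn_sum_h1, half_odd_ge.
- apply half_pow_lim.
- assert (E : forall n, half_pow 2 n / half_odd n + half_pow 1 n / half_odd n ^ 2 = 2 * half_pow 3 n).
  { intros n. unfold half_pow. pose proof (half_odd_ge n). field. lra. }
  split; [eapply ex_series_ext; [|exact A]; exact E|].
  intros n. rewrite <- (tail_ext _ _ n E). apply B.
Qed.

Lemma descent_harm1_h1 : forall n, 
  is_series (fun k => harm 1 k * recip_h1 (half_odd n - 1) (S k) * cbterm n k) (tail (fun n => 3 * half_pow 4 n) n).
Proof.
destruct (descent_weight_h1 (harm 1) (half_pow 2) (fun n => 2 * half_pow 3 n)) as [A B].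
- apply harm_pos.
- intros n. apply conn_sum_harm1, half_odd_ge.
- intros n. apply conn_sum_harm1_h1, half_odd_ge.
- replace 0 with (2 * 0) by ring. apply (is_lim_seq_scal_l _ 2 0), half_pow_lim.
- assert (E : forall n, 2 * half_pow 3 n / half_odd n + half_pow 2 n / half_odd n ^ 2 = 3 * half_pow 4 n).
  { intros n. unfold half_pow. pose proof (half_odd_ge n). field. lra. }
  intros n. rewrite <- (tail_ext _ _ n E). apply B.
Qed.

Lemma descent_h1_div : ex_series (fun n => tail (fun n => 2 * half_pow 3 n) (S n) / half_odd n + tail (half_pow 2) (S n) / half_odd n ^ 2) /\
  forall n, 
  is_series (fun k => 1 / INR (S k) * recip_h1 (half_odd n - 1) (S k) * cbterm n k) 
   (tail (fun n => tail (fun n => 2 * half_pow 3 n) (S n) / half_odd n + tail (half_pow 2) (S n) / half_odd n ^ 2) n).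
Proof.
apply (descent_weight_h1 (fun k => 1 / INR (S k)) (fun n => tail (half_pow 2) (S n)) 
   (fun n => tail (fun n => 2 * half_pow 3 n) (S n))).
- intros k. apply Rlt_le, Rdiv_lt_0_compat; [lra|apply INR_Sn_pos].
- intros n. eapply is_series_ext_R; [|apply (proj2 descent_one (S n))].
  intros k; cbv beta. rewrite cbterm_S. pose proof (INR_Sn_pos k). field. lra.
- intros n. eapply is_series_ext_R; [|apply (proj2 descent_h1 (S n))].
  intros k; cbv beta. rewrite cbterm_S, half_odd_S. pose proof (INR_Sn_pos k). field. lra.
- apply is_lim_seq_shift1, tail_lim, descent_h1.
Qed.

Lemma descent_h2 : forall n, 
  is_series (fun k => recip_h2 (half_odd n - 1) (S k) * cbterm n k) (tail (fun n => 3 * half_pow 4 n) n).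
Proof.
(* The increment has three parts, from [conn_H2_transport_x]; each sums over k to 1/x^4, hence the
   factor 3. *)
apply (descent (fun n k => recip_h2 (half_odd n - 1) (S k) * cbterm n k)
  (fun n k => 1 * (/ half_odd n * (recip_h2 (half_odd n) (S k) * (conn (half_odd n) (S k) / INR (S k)))
     + / half_odd n ^ 2 * (1 * recip_h1 (half_odd n) (S k) * (conn (half_odd n) (S k) / INR (S k))))
     + / half_odd n ^ 3 * (1 * (conn (half_odd n) (S k) / INR (S k))))
  (fun n k => recip_h2 (half_odd n) (S k) * (conn (half_odd n) (S k) / INR (S k))) _ (half_pow 3)); auto.
- intros n k. rewrite cbterm_S, half_odd_S. unfold cbterm. pose proof (half_odd_ge n).
  pose proof (INR_Sn_pos k).
  replace (recip_h2 (half_odd n - 1) (S k) * (conn (half_odd n - 1) (S k) / INR (S k) ^ 2))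
    with ((conn (half_odd n - 1) (S k) * recip_h2 (half_odd n - 1) (S k)) / INR (S k) ^ 2) by (field; lra).
  rewrite conn_H2_transport_x by lra. field; lra.
- intros n. pose proof (half_odd_ge n). eapply is_series_eq;
   [apply (is_series_lin 1 (/ half_odd n ^ 3)); [apply (is_series_lin (/ half_odd n) (/ half_odd n ^ 2));
     [apply (conn_sum_h2 (half_odd n))|apply (conn_sum_h1 (half_odd n))]|apply (conn_sum (half_odd n))]; auto| |].
  + intros; reflexivity.
  + unfold half_pow. field; lra.
- intros n k. pose proof (cbterm_S_bounds n k). rewrite half_odd_S.
  pose proof (recip_h2_bounds (half_odd n) (S k) (half_odd_ge n)). split; [nra|].
  apply Rmult_le_compat_l; lra.
- intros n. apply conn_sum_h2, half_odd_ge.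
- apply half_pow_lim.
Qed.

Lemma rsum_mult_r f c n : rsum (fun i => f i * c) n = rsum f n * c.
Proof. induction n; simpl; [|rewrite IHn]; lra. Qed.

(** Interchange over pairs n < m. It brings the iterated tails produced by the descent to the usual
    nested form, with the largest index outermost. *)
Lemma tail_cols (a b : nat -> R) (l : R) :
  (forall n, 0 <= a n) -> (forall n, 0 <= b n) -> ex_series b ->
  is_series (fun n => a n * tail b (S n)) l -> is_series (fun l => rsum a l * b l) l.
Proof.
intros Ha Hb Eb H.
apply (is_series_ext_R (fun l => rsum (fun n => a n * b l) l)).
- intros n; apply rsum_mult_r.
- apply (tri_cols (fun n m => a n * b m) (fun n => a n * tail b (S n))); auto.
  + intros; apply Rmult_le_pos; auto.
  + intros i. apply (is_series_scalR (a i)), tail_series, Eb.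
Qed.

Lemma rsum_e2 (a : nat -> R) n :
  rsum (fun m => rsum a m * a m) n = (rsum a n ^ 2 - rsum (fun m => a m ^ 2) n) / 2.
Proof. induction n; [simpl; lra|]. rewrite !rsum_S, IHn. field. Qed.

Lemma series_square (a : nat -> R) (s s2 : R) :
  (forall n, 0 <= a n) -> is_series a s -> is_series (fun n => a n ^ 2) s2 ->
  is_series (fun n => rsum a n * a n) ((s ^ 2 - s2) / 2).
Proof.
intros Ha Hs Hs2. apply is_series_rsum.
apply is_lim_seq_ext with (fun n => /2 * (rsum a n * rsum a n - rsum (fun n => a n ^ 2) n)).
- intros n. rewrite rsum_e2. field.
- replace ((s ^ 2 - s2) / 2) with (/2 * (s * s - s2)) by field.
  apply (is_lim_seq_scal_l _ (/2) (s * s - s2)).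
  apply is_lim_seq_minus'; [apply (is_lim_seq_mult' _ _ s s)|];
   apply is_series_rsum; auto.
Qed.

Lemma half_pow_ge0 s n : 0 <= half_pow s n.
Proof. apply Rlt_le, half_pow_pos. Qed.

Lemma half_pow_1 n : half_pow 1 n = / half_odd n.
Proof. unfold half_pow. rewrite pow_1. reflexivity. Qed.

Lemma half_pow_2 n : half_pow 2 n = / half_odd n / half_odd n.
Proof. unfold half_pow. pose proof (half_odd_ge n). field. lra. Qed.

Lemma half_pow_add s t n : half_pow s n * half_pow t n = half_pow (s + t) n.
Proof.
unfold half_pow. pose proof (half_odd_ge n). rewrite pow_add, Rinv_mult. reflexivity.
Qed.

(* half_zeta s = 2^s t(s), where t(s) is the sum of 1/N^s over odd N. *)
Definition half_zeta (s : nat) : R := Series (half_pow s).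

Lemma tail_0 D : tail D 0 = Series D.
Proof. apply Series_ext. reflexivity. Qed.

Lemma half_zeta2_series : is_series (half_pow 2) (half_zeta 2). Proof. apply Series_correct, descent_one. Qed.
Lemma half_zeta3_series : is_series (half_pow 3) (half_zeta 3). Proof. apply Series_correct, descent_harm1. Qed.
Lemma half_zeta4_series : is_series (half_pow 4) (half_zeta 4). Proof. apply Series_correct, descent_e2. Qed.

(* half_zeta22, half_zeta31, half_zeta211 are 16 t(2,2), 16 t(3,1), 16 t(2,1,1). *)
Definition half_zeta22 : R := (half_zeta 2 ^ 2 - half_zeta 4) / 2.

Lemma half_zeta22_series : is_series (fun n => rsum (half_pow 2) n * half_pow 2 n) half_zeta22.
Proof.
apply series_square; [apply half_pow_ge0|apply half_zeta2_series|].
eapply is_series_ext_R; [|apply half_zeta4_series]. intros n. simpl. rewrite Rmult_1_r, half_pow_add. reflexivity.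
Qed.

Definition half_zeta31 : R := Series (fun n => rsum (half_pow 1) n * half_pow 3 n).
Definition half_zeta211 : R := Series (fun n => rsum (fun m => rsum (half_pow 1) m * half_pow 1 m) n * half_pow 2 n).

Lemma cbterm_harm1_div : is_series (fun k => harm 1 k / INR (S k) * cbterm 0 k) half_zeta31 /\
   is_series (fun n => rsum (half_pow 1) n * half_pow 3 n) half_zeta31 /\
   is_series (fun n => half_pow 1 n * tail (half_pow 3) (S n)) half_zeta31.
Proof.
destruct descent_harm1 as [X Y].
destruct (descent_weight_div (harm 1) (half_pow 3) (harm_pos 1) X Y) as [A B].
specialize (B O). rewrite tail_0 in B.
pose proof (Series_correct _ A) as C.
assert (C' : is_series (fun n => half_pow 1 n * tail (half_pow 3) (S n)) (Series (fun n => tail (half_pow 3) (S n) / half_odd n))).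
{ eapply is_series_ext_R; [|exact C]. intros n; cbv beta. rewrite half_pow_1. unfold Rdiv; ring. }
pose proof (tail_cols _ _ _ (half_pow_ge0 1) (half_pow_ge0 3) X C') as D.
unfold half_zeta31. rewrite (is_series_unique _ _ D). auto.
Qed.

Lemma cbterm_harm2 : is_series (fun k => harm 2 k * cbterm 0 k) half_zeta22 /\
   is_series (fun n => half_pow 2 n * tail (half_pow 2) (S n)) half_zeta22.
Proof.
destruct descent_harm2 as [X Y]. specialize (Y O). rewrite tail_0 in Y.
pose proof (Series_correct _ X) as C.
assert (C' : is_series (fun n => half_pow 2 n * tail (half_pow 2) (S n)) (Series (fun n => tail (half_pow 2) (S n) / half_odd n / half_odd n))).
{ eapply is_series_ext_R; [|exact C]. intros n; cbv beta. rewrite half_pow_2. unfold Rdiv; ring. }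
pose proof (tail_cols _ _ _ (half_pow_ge0 2) (half_pow_ge0 2) (proj1 descent_one) C') as D.
rewrite <- (is_series_unique _ _ half_zeta22_series), (is_series_unique _ _ D). auto.
Qed.

(** Two divisions of the weight 1 give the sum over n < m < p of 1/(x_n x_m x_p^2), where x_n = n +
    1/2; [tail_cols] is applied once for each level. *)
Lemma cbterm_div2 : is_series (fun k => / INR (S k) ^ 2 * cbterm 0 k) half_zeta211 /\
   is_series (fun n => rsum (fun m => rsum (half_pow 1) m * half_pow 1 m) n * half_pow 2 n) half_zeta211.
Proof.
destruct descent_one as [X Y].
destruct (descent_weight_div (fun _ => 1) (half_pow 2)) as [A B]; auto; [intros; lra|].
destruct (descent_weight_div _ _ (fun k => Rlt_le _ _ (Rdiv_lt_0_compat _ _ Rlt_0_1 (INR_Sn_pos k))) A B) as [A' B'].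
specialize (B' O). rewrite tail_0 in B'.
pose proof (Series_correct _ A') as C.
set (S1 := Series _) in B', C.
set (Y2 := fun n => tail (half_pow 2) (S n) / half_odd n) in *.
assert (Y20 : forall n, 0 <= Y2 n).
{ intros n. apply Rmult_le_pos; [apply tail_pos; auto; apply half_pow_ge0|].
  pose proof (half_odd_ge n). apply Rlt_le, Rinv_0_lt_compat; lra. }
assert (C' : is_series (fun n => half_pow 1 n * tail Y2 (S n)) S1).
{ eapply is_series_ext_R; [|exact C]. intros n; cbv beta. rewrite half_pow_1. unfold Rdiv; ring. }
pose proof (tail_cols _ _ _ (half_pow_ge0 1) Y20 A C') as D.
assert (C2 : is_series (fun n => (rsum (half_pow 1) n * half_pow 1 n) * tail (half_pow 2) (S n)) S1).
{ eapply is_series_ext_R; [|exact D]. intros n; cbv beta. unfold Y2. rewrite half_pow_1. unfold Rdiv; ring. }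
assert (P : forall n, 0 <= rsum (half_pow 1) n * half_pow 1 n).
{ intros n. apply Rmult_le_pos; [apply rsum_pos; intros|]; apply half_pow_ge0. }
pose proof (tail_cols _ _ _ P (half_pow_ge0 2) X C2) as D2.
unfold half_zeta211. rewrite (is_series_unique _ _ D2). split; [|exact D2].
eapply is_series_ext_R; [|exact B']. intros k; cbv beta. pose proof (INR_Sn_pos k). field; lra.
Qed.

Lemma half_odd_0 : half_odd 0 - 1 = -1/2.
Proof. unfold half_odd; simpl; lra. Qed.

Lemma cbterm_harm1_h1 : is_series (fun k => harm 1 k * recip_h1 (-1/2) (S k) * cbterm 0 k) (3 * half_zeta 4).
Proof.
pose proof (descent_harm1_h1 O) as H. rewrite tail_0 in H. rewrite half_odd_0 in H.
eapply is_series_eq; [exact H|reflexivity|apply (Series_scal_l 3)].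
Qed.

Lemma cbterm_h2 : is_series (fun k => recip_h2 (-1/2) (S k) * cbterm 0 k) (3 * half_zeta 4).
Proof.
pose proof (descent_h2 O) as H. rewrite tail_0 in H. rewrite half_odd_0 in H.
eapply is_series_eq; [exact H|reflexivity|apply (Series_scal_l 3)].
Qed.

Lemma cbterm_h1_div : is_series (fun k => / INR (S k) * recip_h1 (-1/2) (S k) * cbterm 0 k) (2 * half_zeta31 + half_zeta22).
Proof.
pose proof (proj2 descent_h1_div O) as H. rewrite tail_0 in H.
eapply is_series_eq; [exact H| |].
- intros k; cbv beta. rewrite half_odd_0.
  unfold Rdiv; rewrite Rmult_1_l; reflexivity.
- apply is_series_unique.
  destruct cbterm_harm1_div as [_ [_ B]]. destruct cbterm_harm2 as [_ C].
  replace (2 * half_zeta31 + half_zeta22) with (2 * half_zeta31 + 1 * half_zeta22) by ring.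
  eapply is_series_ext_R; [|apply (is_series_lin 2 1 _ _ _ _ B C)].
  intros n; cbv beta. unfold tail at 3. rewrite (Series_scal_l 2 (fun m => half_pow 3 (S n + m))).
  fold (tail (half_pow 3) (S n)). rewrite half_pow_1, half_pow_2. pose proof (half_odd_ge n). field. lra.
Qed.

Lemma cbterm_e2 : is_series (fun k => harm_e2 k * cbterm 0 k) (half_zeta 4).
Proof. pose proof (proj2 descent_e2 O) as H. rewrite tail_0 in H. exact H. Qed.

Lemma half_pow_1_INR i : / (-1/2 + INR (S i)) = half_pow 1 i.
Proof. unfold half_pow, half_odd. rewrite pow_1, S_INR. f_equal. lra. Qed.

Lemma recip_h1_half n : recip_h1 (-1/2) n = rsum (half_pow 1) n.
Proof. apply rsum_ext. intros; apply half_pow_1_INR. Qed.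

(** Newton's identity 2 h_2 = p_1^2 + p_2 for the numbers 1/(i + 1/2). *)
Lemma recip_h2_half n : 2 * recip_h2 (-1/2) n = rsum (half_pow 1) n ^ 2 + rsum (half_pow 2) n.
Proof.
induction n; [unfold recip_h2; simpl; lra|].
rewrite recip_h2_S, recip_h1_half, Rmult_plus_distr_l, IHn.
replace (rsum (half_pow 1) (S n) / (-1/2 + INR (S n))) with (rsum (half_pow 1) (S n) * half_pow 1 n)
  by (rewrite <- half_pow_1_INR; reflexivity).
rewrite !rsum_S. rewrite <- (half_pow_add 1 1). ring.
Qed.

Lemma harm_e2_newton k : 2 * harm_e2 k = harm 1 k ^ 2 - harm 2 k.
Proof.
induction k; [unfold harm_e2; simpl; lra|].
rewrite harm_e2_S, Rmult_plus_distr_l, IHk, harm_1_S, harm_S. pose proof (INR_Sn_pos k). field; lra.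
Qed.

Lemma harm_double m n : harm m (2 * n) = / 2 ^ m * (harm m n + rsum (half_pow m) n).
Proof.
induction n; [simpl; lra|].
replace (2 * S n)%nat with (S (S (2 * n))) by lia.
rewrite !harm_S, rsum_S, IHn.
assert (E1 : INR (S (2 * n)) = 2 * half_odd n) by (rewrite S_INR, mult_INR; unfold half_odd; simpl; lra).
assert (E2 : INR (S (S (2 * n))) = 2 * INR (S n)) by (rewrite !S_INR, mult_INR; simpl; lra).
rewrite E1, E2, !Rpow_mult_distr. unfold half_pow.
pose proof (half_odd_ge n). pose proof (INR_Sn_pos n).
assert (2 ^ m <> 0) by (apply pow_nonzero; lra).
assert (half_odd n ^ m <> 0) by (apply pow_nonzero; lra).
assert (INR (S n) ^ m <> 0) by (apply pow_nonzero; lra).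
field. auto.
Qed.

(** Put u = 1/(k+1), H = H_k and P = [recip_h1 (-1/2) (S k)]. By [harm_double] and Newton's
    identities the weight is half of e_2 + H_k^(2) + H u + u^2 + H P + u P + h_2, and each of these
    seven sums is known from the descent. *)
Lemma sum_squares :
  is_series (fun k => (harm 1 (2 * S k) ^ 2 + harm 2 (2 * S k)) * cbterm 0 k)
    (/2 * (7 * half_zeta 4 + 2 * half_zeta22 + 3 * half_zeta31 + half_zeta211)).
Proof.
pose proof (is_series_lin 1 1 _ _ _ _ cbterm_e2 (proj1 cbterm_harm2)) as P1.
pose proof (is_series_lin 1 1 _ _ _ _ (proj1 cbterm_harm1_div) (proj1 cbterm_div2)) as P2.
pose proof (is_series_lin 1 1 _ _ _ _ cbterm_harm1_h1 cbterm_h1_div) as P3.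
pose proof (is_series_lin 1 1 _ _ _ _ P1 P2) as P4.
pose proof (is_series_lin 1 1 _ _ _ _ P3 cbterm_h2) as P5.
pose proof (is_series_lin (/2) (/2) _ _ _ _ P4 P5) as P6.
eapply is_series_eq; [exact P6| |].
- intros k; cbv beta. rewrite !harm_double, !recip_h1_half, harm_1_S, harm_S.
  replace (harm_e2 k) with (/2 * (harm 1 k ^ 2 - harm 2 k)) by (rewrite <- harm_e2_newton; field).
  replace (recip_h2 (-1/2) (S k)) with (/2 * (rsum (half_pow 1) (S k) ^ 2 + rsum (half_pow 2) (S k)))
    by (rewrite <- recip_h2_half; field).
  pose proof (INR_Sn_pos k). field. lra.
- simpl. ring.
Qed.

(** * Linear Euler sums with shifted denominators *)

(** The terms of a Hurwitz zeta series. The shifts used are 1 for integers, 1/2 for odd numbers, and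
    1/4 and 3/4 for the classes 1 and 3 modulo 4. *)
Definition shift_pow (c : R) (s n : nat) : R := / (INR n + c) ^ s.

Lemma shift_pow_pos c s n : 0 < c -> 0 < shift_pow c s n.
Proof. intros Hc. apply Rinv_0_lt_compat, pow_lt. pose proof (pos_INR n); lra. Qed.

Lemma shift_pow_1 c n : shift_pow c 1 n = / (INR n + c).
Proof. unfold shift_pow. rewrite pow_1. reflexivity. Qed.

Lemma shift_pow_le c s n : 1/4 <= c -> shift_pow c s n <= 2 ^ s * half_pow s n.
Proof.
intros Hc. unfold shift_pow, half_pow, half_odd. pose proof (pos_INR n).
apply Rle_trans with (/ (/2 * (INR n + 1/2)) ^ s).
- apply Rinv_le_contravar; [apply pow_lt; lra|]. apply pow_incr; lra.
- right. rewrite Rpow_mult_distr, Rinv_mult, pow_inv, Rinv_inv. reflexivity.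
Qed.

Lemma ex_shift_pow c s : 1/4 <= c -> ex_series (half_pow s) -> ex_series (shift_pow c s).
Proof.
intros Hc H. apply (ex_series_squeeze _ (fun n => 2 ^ s * half_pow s n)).
- intros n. split; [apply Rlt_le, shift_pow_pos; lra|apply shift_pow_le; auto].
- apply (ex_series_scal_l (2 ^ s) (half_pow s) H).
Qed.

Lemma series_inv_diff x : 0 < x ->
  is_series (fun i => / (INR i + x) - / (INR (S i) + x)) (/ x).
Proof.
intros Hx.
pose proof (is_series_tele (fun i => / (INR i + x)) _ 0 (fun n => eq_refl)) as T.
eapply is_series_eq; [apply T|reflexivity|].
- apply (is_lim_seq_inv _ p_infty); [|discriminate].
  apply (is_lim_seq_plus _ _ p_infty x p_infty);
   [apply is_lim_seq_INR|apply is_lim_seq_const|reflexivity].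
- cbv beta. simpl. rewrite Rplus_0_l. lra.
Qed.

(** The recurrence psi(c+m) = psi(c) + 1/c + ... + 1/(c+m-1) of the digamma function, with h =
    psi(c) + gamma. *)
Lemma digamma_shift c h m : 0 < c ->
  is_series (fun i => / INR (S i) - / (INR i + c)) h ->
  is_series (fun i => / INR (S i) - / (INR i + (INR m + c))) (h + rsum (shift_pow c 1) m).
Proof.
intros Hc H. induction m as [|m IH].
- simpl. rewrite Rplus_0_r. eapply is_series_ext_R; [|exact H].
  intros; cbv beta. rewrite Rplus_0_l. reflexivity.
- pose proof (pos_INR m).
  pose proof (is_series_lin 1 1 _ _ _ _ IH (series_inv_diff (INR m + c) ltac:(lra))) as T.
  eapply is_series_eq; [exact T| |].
  + intros n; cbv beta. rewrite !S_INR.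
    replace (INR n + 1 + (INR m + c)) with (INR n + (INR m + 1 + c)) by ring. ring.
  + rewrite rsum_S, shift_pow_1. ring.
Qed.

Lemma harm_series n :
  is_series (fun i => / INR (S i) - / (INR i + (INR n + 1))) (harm 1 n).
Proof.
pose proof (digamma_shift 1 0 n Rlt_0_1) as T.
replace (harm 1 n) with (0 + rsum (shift_pow 1 1) n).
- apply T. apply (is_series_ext_R (fun _ => 0 * 0)).
  + intros i. rewrite S_INR. ring.
  + pose proof (is_series_scalR 0 _ _ half_zeta2_series) as Z. rewrite Rmult_0_l in Z.
    eapply is_series_ext_R; [|exact Z]. intros; simpl; ring.
- clear T. rewrite Rplus_0_l. induction n; [reflexivity|].
  rewrite rsum_S, IHn, harm_1_S, shift_pow_1, S_INR. reflexivity.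
Qed.

Lemma ex_digamma c : 1/4 <= c <= 1 -> ex_series (fun i => / INR (S i) - / (INR i + c)).
Proof.
intros Hc. apply (ex_series_dom _ (shift_pow c 2)); [|apply ex_shift_pow; [lra|apply descent_one]].
intros n. rewrite S_INR. unfold shift_pow. pose proof (pos_INR n).
replace (/ (INR n + 1) - / (INR n + c)) with (- ((1 - c) / ((INR n + 1) * (INR n + c)))) by (field; lra).
rewrite Rabs_Ropp, Rabs_pos_eq.
- apply Rle_trans with (1 / ((INR n + c) * (INR n + c))); [|right; field; lra].
  apply Rmult_le_compat; try lra.
  + apply Rlt_le, Rinv_0_lt_compat. nra.
  + apply Rinv_le_contravar; nra.
- apply Rmult_le_pos; [lra|]. apply Rlt_le, Rinv_0_lt_compat. nra.
Qed.

Lemma rsum_harm n : rsum (fun i => / INR (n - i)) n = harm 1 n.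
Proof.
rewrite (rsum_ext _ (fun i => (fun j => / INR (S j)) (n - S i)%nat)).
- rewrite (rsum_rev (fun j => / INR (S j))). induction n; [reflexivity|].
  rewrite rsum_S, IHn, harm_1_S. reflexivity.
- intros i Hi. cbv beta. do 2 f_equal. lia.
Qed.

(* Evaluation of sum 1/(x^2 (s-x) s) over x < s in c + N, first by rows (fixed x), then by columns. *)
Lemma linear_euler_sum c h z2 z4 : 1/4 <= c <= 1 ->
  is_series (fun i => / INR (S i) - / (INR i + c)) h ->
  is_series (shift_pow c 2) z2 -> is_series (shift_pow c 4) z4 ->
  is_series (fun l => (harm 1 l - h) * shift_pow c 3 l) (3/2 * z4 - z2 ^ 2 / 2).
Proof.
intros Hc Hh H2 H4.
set (x := fun n => INR n + c).
assert (x0 : forall n, 0 < x n) by (intros n; unfold x; pose proof (pos_INR n); lra).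
set (r := fun m => (h + rsum (shift_pow c 1) (S m)) * shift_pow c 3 m).
set (F := fun m l => / (x m ^ 2 * INR (l - m) * x l)).
assert (F0 : forall m l, (m < l)%nat -> 0 <= F m l).
{ intros m l Hml. apply Rlt_le, Rinv_0_lt_compat. pose proof (x0 m); pose proof (x0 l).
  assert (0 < INR (l - m)) by (apply lt_0_INR; lia).
  apply Rmult_lt_0_compat; auto. apply Rmult_lt_0_compat; auto. apply pow_lt; auto. }
(* Along a row s = x + d with d >= 1, and x/(d (x+d)) = 1/d - 1/(x+d), so the digamma value at x + 1
   appears. *)
assert (Fr : forall m, is_series (fun i => F m (S m + i)%nat) (r m)).
{ intros m. unfold r. rewrite Rmult_comm.
  eapply is_series_ext_R; [|apply (is_series_scalR (shift_pow c 3 m)), (digamma_shift c h (S m)); [lra|exact Hh]].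
  intros i; cbv beta. unfold F, shift_pow. fold (x m).
  replace (S m + i - m)%nat with (S i) by lia.
  replace (INR i + (INR (S m) + c)) with (INR (S i) + x m) by (unfold x; rewrite !S_INR; ring).
  replace (x (S m + i)%nat) with (INR (S i) + x m)
   by (unfold x; rewrite plus_INR, !S_INR; ring).
  pose proof (x0 m). pose proof (INR_Sn_pos i). field. lra. }
assert (r0 : forall m, 0 <= r m).
{ intros m. apply (series_ge0 (fun i => F m (S m + i)%nat)); auto. intros i; apply F0; lia. }
assert (hneg : h <= 0).
{ apply Ropp_le_cancel. rewrite Ropp_0.
  apply (series_ge0 (fun i => -1 * (/ INR (S i) - / (INR i + c)))).
  - intros i. pose proof (pos_INR i). rewrite S_INR.
    assert (/ (INR i + 1) <= / (INR i + c)) by (apply Rinv_le_contravar; lra). lra.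
  - replace (- h) with (-1 * h) by ring. apply is_series_scalR, Hh. }
assert (Er : ex_series r).
{ apply (ex_series_squeeze _ (fun m => 16 * (rsum (half_pow 1) m * half_pow 3 m) + 16 * half_pow 4 m)).
  - intros m; split; auto. unfold r.
    assert (B1 : rsum (shift_pow c 1) (S m) <= 2 * rsum (half_pow 1) (S m)).
    { rewrite <- rsum_scal. apply rsum_le. intros i _. 
      pose proof (shift_pow_le c 1 i ltac:(lra)). lra. }
    pose proof (shift_pow_le c 3 m ltac:(lra)) as B3. pose proof (shift_pow_pos c 3 m ltac:(lra)).
    assert (0 <= rsum (half_pow 1) (S m)) by (apply rsum_pos; intros; apply half_pow_ge0).
    apply Rle_trans with (2 * rsum (half_pow 1) (S m) * (2 ^ 3 * half_pow 3 m)).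
    + apply Rle_trans with (2 * rsum (half_pow 1) (S m) * shift_pow c 3 m); [nra|].
      apply Rmult_le_compat_l; lra.
    + rewrite rsum_S. right. rewrite <- (half_pow_add 1 3). ring.
  - apply (ex_series_plus (fun m => 16 * (rsum (half_pow 1) m * half_pow 3 m)) (fun m => 16 * half_pow 4 m)).
    + apply (ex_series_scal_l 16 (fun m => rsum (half_pow 1) m * half_pow 3 m)). eexists; apply cbterm_harm1_div.
    + apply (ex_series_scal_l 16 (half_pow 4)). eexists; apply half_zeta4_series. }
pose proof (Series_correct _ Er) as Hr.
pose proof (tri_cols F r F0 Fr _ Hr) as Hcol.
assert (H22 : is_series (fun n => rsum (shift_pow c 2) n * shift_pow c 2 n) ((z2 ^ 2 - z4) / 2)).
{ apply series_square; auto; [intros; apply Rlt_le, shift_pow_pos; lra|].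
  eapply is_series_ext_R; [|exact H4]. intros n; unfold shift_pow. 
  rewrite pow_inv, <- pow_mult. reflexivity. }
pose proof (is_series_lin 1 (-1) _ _ _ _ Hcol Hr) as D1.
pose proof (is_series_lin 1 (-1) _ _ _ _ D1 H22) as D2.
pose proof (is_series_lin 1 1 _ _ _ _ D2 H4) as D3.
eapply is_series_eq; [exact D3| |field].
intros l. cbv beta.
(* Along a column s is fixed and 1/(x^2 (s-x)) = 1/(s x^2) + 1/(s^2 x) + 1/(s^2 (s-x)). The sums of
   1/x cancel against those of the rows, except for the diagonal term, which gives
   [shift_pow c 4 l]. *)
replace (rsum (fun i => F i l) l)
  with (shift_pow c 2 l * rsum (shift_pow c 2) l + shift_pow c 3 l * rsum (shift_pow c 1) l + shift_pow c 3 l * harm 1 l).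
- unfold r. rewrite rsum_S.
  replace (shift_pow c 4 l) with (shift_pow c 1 l * shift_pow c 3 l); [ring|].
  unfold shift_pow. rewrite <- Rinv_mult, <- pow_add. reflexivity.
- rewrite <- rsum_harm, <- !rsum_scal, <- !rsum_plus.
  apply rsum_ext. intros i Hi. unfold F, shift_pow. fold (x l) (x i).
  assert (E : x l = x i + INR (l - i)) by (unfold x; rewrite minus_INR by lia; ring).
  pose proof (x0 i). assert (0 < INR (l - i)) by (apply lt_0_INR; lia).
  rewrite E. field. lra.
Qed.

(* Symmetrizing 1/(x^2 y (x+y)) in x, y gives 1/(x^2 y^2). *)
Lemma tail_euler_sum c z2 z4 rho : 1/4 <= c <= 1 ->
  is_series (shift_pow c 2) z2 -> is_series (shift_pow c 4) z4 ->
  (forall n, is_series (fun j => / (INR j + (INR n + 2 * c)) - / (INR j + (INR n + 1))) (rho n)) ->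
  is_series (fun n => rho n * shift_pow c 3 n) (3/2 * z4 - z2 ^ 2).
Proof.
intros Hc H2 H4 Hrho.
pose proof (Series_correct _ (ex_digamma c Hc)) as Hh.
set (h := Series _) in Hh.
set (x := fun n => INR n + c).
assert (x0 : forall n, 0 < x n) by (intros n; unfold x; pose proof (pos_INR n); lra).
set (f := fun n j => / (x n ^ 2 * x j * (x n + x j))).
assert (f0 : forall i j, 0 <= f i j).
{ intros i j. pose proof (x0 i); pose proof (x0 j). apply Rlt_le, Rinv_0_lt_compat.
  apply Rmult_lt_0_compat; [|lra]. apply Rmult_lt_0_compat; auto. apply pow_lt; auto. }
(* The three digamma-type series combine termwise to 1/x_j - 1/(x_n + x_j) = x_n / (x_j (x_n +
   x_j)). *)
assert (fr : forall n, is_series (f n) (((harm 1 n - h) - rho n) * shift_pow c 3 n)).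
{ intros n.
  pose proof (is_series_lin 1 (-1) _ _ _ _ (harm_series n) Hh) as D1.
  pose proof (is_series_lin 1 (-1) _ _ _ _ D1 (Hrho n)) as D2.
  pose proof (is_series_scalR (shift_pow c 3 n) _ _ D2) as D3.
  eapply is_series_eq; [exact D3| |ring].
  intros j; cbv beta. unfold f, shift_pow. fold (x n).
  replace (INR j + (INR n + 2 * c)) with (x n + x j) by (unfold x; ring). fold (x j).
  pose proof (x0 n). pose proof (x0 j). pose proof (pos_INR n). pose proof (pos_INR j).
  rewrite !S_INR. field. lra. }
assert (sq : is_lim_seq (fun M => rsum (fun i => rsum (f i) M) M) (z2 * z2 / 2)).
{ apply is_lim_seq_ext with (fun M => /2 * (rsum (shift_pow c 2) M * rsum (shift_pow c 2) M)).
  - intros M. 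
    assert (E : rsum (fun i => rsum (f i) M) M + rsum (fun i => rsum (f i) M) M
      = rsum (shift_pow c 2) M * rsum (shift_pow c 2) M); [|lra].
    rewrite (rsum_exch f M M) at 2. rewrite <- rsum_plus.
    rewrite <- rsum_scal. apply rsum_ext. intros i _.
    rewrite <- rsum_plus, <- rsum_mult_r. apply rsum_ext. intros j _.
    unfold f, shift_pow. fold (x i) (x j). pose proof (x0 i). pose proof (x0 j). field. lra.
  - replace (z2 * z2 / 2) with (/2 * (z2 * z2)) by field.
    apply (is_lim_seq_scal_l _ (/2) (z2 * z2)).
    apply (is_lim_seq_mult' _ _ z2 z2); apply is_series_rsum; auto. }
pose proof (rows_of_square f _ f0 fr _ sq) as D1.
pose proof (linear_euler_sum c h z2 z4 Hc Hh H2 H4) as D2.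
pose proof (is_series_lin 1 (-1) _ _ _ _ D2 D1) as D3.
eapply is_series_eq; [exact D3| |field].
intros n; cbv beta. ring.
Qed.

(** * Sums over all half-integers *)

Lemma ln_le_sub1 x : 0 < x -> ln x <= x - 1.
Proof.
intros Hx. rewrite <- (ln_exp (x - 1)). apply ln_le; auto.
pose proof (exp_ineq1_le (x - 1)). lra.
Qed.

Lemma ln_step x : 0 < x -> / (x + 1) <= ln (x + 1) - ln x <= / x.
Proof.
intros Hx. split.
- pose proof (ln_le_sub1 (x / (x + 1)) ltac:(apply Rdiv_lt_0_compat; lra)) as H.
  rewrite ln_div in H by lra.
  replace (x / (x + 1) - 1) with (- / (x + 1)) in H by (field; lra). lra.
- pose proof (ln_le_sub1 ((x + 1) / x) ltac:(apply Rdiv_lt_0_compat; lra)) as H.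
  rewrite ln_div in H by lra.
  replace ((x + 1) / x - 1) with (/ x) in H by (field; lra). lra.
Qed.

Lemma harm_ln_bounds n m :
  ln (INR (S n + m) + 1) - ln (INR (S n) + 1) <= harm 1 (S n + m) - harm 1 (S n)
  <= ln (INR (S n + m)) - ln (INR (S n)).
Proof.
induction m as [|m IH]; [rewrite Nat.add_0_r; lra|].
replace (S n + S m)%nat with (S (S n + m)) by lia.
rewrite harm_1_S, S_INR.
assert (H : 0 < INR (S n + m)) by (apply lt_0_INR; lia).
pose proof (ln_step _ H). pose proof (ln_step (INR (S n + m) + 1) ltac:(lra)). lra.
Qed.

Lemma lim_harm_double : is_lim_seq (fun n => harm 1 (2 * n) - harm 1 n) (ln 2).
Proof.
apply is_lim_seq_incr_1.
apply (is_lim_seq_le_le (fun n => ln (2 - / (INR (S n) + 1))) _ (fun _ => ln 2)).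
- intros n. pose proof (harm_ln_bounds n (S n)) as [B1 B2].
  replace (S n + S n)%nat with (2 * S n)%nat in * by lia.
  pose proof (INR_Sn_pos n) as Hn.
  rewrite mult_INR in B1, B2. change (INR 2) with 2 in *.
  rewrite <- ln_div in B1, B2 by lra.
  replace (2 * INR (S n) / INR (S n)) with 2 in B2 by (field; lra).
  replace ((2 * INR (S n) + 1) / (INR (S n) + 1)) with (2 - / (INR (S n) + 1)) in B1 by (field; lra).
  lra.
- replace (ln 2) with (ln (2 - 0)) by (f_equal; lra).
  apply (is_lim_seq_continuous ln (fun n => 2 - / (INR (S n) + 1)) (2 - 0)).
  + apply derivable_continuous_pt. exists (/ (2 - 0)). apply derivable_pt_lim_ln. lra.
  + apply is_lim_seq_minus'; [apply is_lim_seq_const|].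
    apply (is_lim_seq_inv _ p_infty); [|discriminate].
    apply (is_lim_seq_plus _ _ p_infty 1 p_infty); [|apply is_lim_seq_const|reflexivity].
    apply -> is_lim_seq_incr_1. apply is_lim_seq_INR.
- apply is_lim_seq_const.
Qed.

Lemma digamma_half : is_series (fun i => / INR (S i) - / (INR i + 1/2)) (-2 * ln 2).
Proof.
apply is_series_rsum.
apply is_lim_seq_ext with (fun n => -2 * (harm 1 (2 * n) - harm 1 n)).
- intros n. rewrite harm_double, pow_1, rsum_minus.
  replace (harm 1 n) with (rsum (fun i => / INR (S i)) n).
  + replace (rsum (half_pow 1) n) with (rsum (fun i => / (INR i + 1/2)) n); [field|].
    apply rsum_ext; intros; rewrite half_pow_1; reflexivity.
  + induction n; [reflexivity|]. rewrite rsum_S, IHn, harm_1_S. reflexivity.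
- apply (is_lim_seq_scal_l _ (-2) (ln 2)), lim_harm_double.
Qed.

Lemma ln2_pos : 0 < ln 2.
Proof. rewrite <- ln_1. apply ln_increasing; lra. Qed.

Lemma half_odd_neq i m : INR i - half_odd m <> 0.
Proof.
unfold half_odd. intros H.
assert (E : INR (2 * i) = INR (2 * m + 1)) by (rewrite plus_INR, !mult_INR; simpl; lra).
apply INR_eq in E. lia.
Qed.

Lemma lim_half_odd : is_lim_seq half_odd p_infty.
Proof.
unfold half_odd. apply (is_lim_seq_plus _ _ p_infty (1/2) p_infty);
 [apply is_lim_seq_INR|apply is_lim_seq_const|reflexivity].
Qed.

(* The sum of 1/(i+x) over all (positive and negative) half-integers x. *)
Lemma bilateral_half i : is_series (fun m => / (INR i + half_odd m) + / (INR i - half_odd m)) 0.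
Proof.
induction i as [|i IH].
- pose proof (is_series_scalR 0 _ _ half_zeta2_series) as Z. rewrite Rmult_0_l in Z.
  eapply is_series_ext_R; [|exact Z].
  intros n; cbv beta. simpl. pose proof (half_odd_ge n). field. lra.
(* Passing from i to i + 1 shifts both halves of the bilateral sum. The boundary terms are -1/(i +
   1/2) and 1/(i + 1/2), which cancel. *)
- pose proof (is_series_tele (fun m => / (INR i + half_odd m)) _ 0 (fun n => eq_refl)) as T1.
  pose proof (is_series_tele (fun m => / (INR i + 1 - half_odd m)) _ 0 (fun n => eq_refl)) as T2.
  pose proof (pos_INR i).
  assert (A1 : is_lim_seq (fun m => / (INR i + half_odd m)) 0).
  { apply (is_lim_seq_inv _ p_infty); [|discriminate].
    apply (is_lim_seq_plus _ _ (INR i) p_infty p_infty);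
     [apply is_lim_seq_const|apply lim_half_odd|reflexivity]. }
  assert (A2 : is_lim_seq (fun m => / (INR i + 1 - half_odd m)) 0).
  { apply (is_lim_seq_inv _ m_infty); [|discriminate].
    apply (is_lim_seq_minus _ _ (INR i + 1) p_infty m_infty);
     [apply is_lim_seq_const|apply lim_half_odd|reflexivity]. }
  pose proof (is_series_lin (-1) 1 _ _ _ _ (T1 A1) (T2 A2)) as D1.
  pose proof (is_series_lin 1 1 _ _ _ _ IH D1) as D2.
  eapply is_series_eq; [exact D2| |].
  + intros m; cbv beta.
    replace (INR i + 1 - half_odd (S m)) with (INR i - half_odd m) by (unfold half_odd; rewrite !S_INR; ring).
    replace (INR i + half_odd (S m)) with (INR (S i) + half_odd m) by (unfold half_odd; rewrite !S_INR; ring).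
    replace (INR i + 1 - half_odd m) with (INR (S i) - half_odd m) by (rewrite !S_INR; ring).
    ring.
  + cbv beta. unfold half_odd. simpl (INR 0). field. lra.
Qed.

Lemma is_series_rsum_fin (f : nat -> nat -> R) (l : nat -> R) n :
  (forall i, is_series (f i) (l i)) ->
  is_series (fun m => rsum (fun i => f i m) n) (rsum l n).
Proof.
intros H. induction n.
- pose proof (is_series_scalR 0 _ _ half_zeta2_series) as Z. rewrite Rmult_0_l in Z.
  eapply is_series_ext_R; [|exact Z]. intros; cbv beta; simpl; ring.
- pose proof (is_series_lin 1 1 _ _ _ _ IHn (H n)) as D.
  eapply is_series_eq; [exact D| |]; [intros; cbv beta|]; rewrite !rsum_S; ring.
Qed.

(* Partial sums of h(x) and h(-x), where h(x) = sum_i (1/i - 1/(i+x)), at x = m + 1/2. *)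
Definition dig_pos (n m : nat) : R := rsum (fun i => / INR (S i) - / (INR (S i) + half_odd m)) n.
Definition dig_neg (n m : nat) : R := rsum (fun i => / INR (S i) - / (INR (S i) - half_odd m)) n.

(** For each i, (2/i - 1/(i+x) - 1/(i-x)) / x^2 = -(1/(i+x) + 1/(i-x)) / i^2, and [bilateral_half]
    applies. *)
Lemma dig_sum n : is_series (fun m => (dig_pos n m + dig_neg n m) * half_pow 2 m) 0.
Proof.
pose proof (is_series_rsum_fin _ _ n
  (fun i => is_series_scalR (- / INR (S i) ^ 2) _ _ (bilateral_half (S i)))) as D.
eapply is_series_eq; [exact D| |].
- intros m; cbv beta. unfold dig_pos, dig_neg. rewrite <- rsum_plus, <- rsum_mult_r.
  apply rsum_ext. intros i _. rewrite half_pow_2.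
  pose proof (INR_Sn_pos i). pose proof (half_odd_ge m). pose proof (half_odd_neq (S i) m). field. lra.
- rewrite (rsum_ext _ (fun _ => 0)), rsum_const; [ring|]. intros; ring.
Qed.

Lemma rsum_mult f h n : rsum f n * rsum h n = rsum (fun i => rsum (fun j => f i * h j) n) n.
Proof.
rewrite <- rsum_mult_r. apply rsum_ext. intros i _. rewrite rsum_scal. reflexivity.
Qed.

(** The product over x^2 is the double sum of -1/(i j (i+x) (j-x)), and 1/((i+x)(j-x)) = (1/(i+x) +
    1/(j-x)) / (i+j). Averaging with i and j swapped completes the bilateral terms for both i and
    j. *)
Lemma dig_prod n : is_series (fun m => dig_pos n m * dig_neg n m * half_pow 2 m) 0.
Proof.
pose proof (is_series_scalR (-/2) _ _ (is_series_rsum_fin _ _ n (fun i =>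
  is_series_rsum_fin _ _ n (fun j =>
   is_series_scalR (/ (INR (S i) * INR (S j) * (INR (S i) + INR (S j)))) _ _
    (is_series_lin 1 1 _ _ _ _ (bilateral_half (S i)) (bilateral_half (S j))))))) as D.
eapply is_series_eq; [exact D| |].
- intros m; cbv beta. unfold dig_pos, dig_neg. rewrite rsum_mult.
  match goal with |- _ * ?s = ?r * _ => set (A := s); set (B := r) end.
  (* The identity holds only after symmetrization, so B is doubled and one copy has its two sums
     exchanged. *)
  assert (E : (B * half_pow 2 m) + (B * half_pow 2 m) = - A); [|lra].
  replace (B * half_pow 2 m + B * half_pow 2 m) with (half_pow 2 m * (B + B)) by ring.
  unfold B at 2. rewrite rsum_exch. unfold B. rewrite <- rsum_plus, <- rsum_scal.
  unfold A. replace (- rsum (fun i => rsum (fun j => / (INR (S i) * INR (S j) * (INR (S i) + INR (S j))) *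
     (1 * (/ (INR (S i) + half_odd m) + / (INR (S i) - half_odd m)) +
      1 * (/ (INR (S j) + half_odd m) + / (INR (S j) - half_odd m)))) n) n)
   with (-1 * rsum (fun i => rsum (fun j => / (INR (S i) * INR (S j) * (INR (S i) + INR (S j))) *
     (1 * (/ (INR (S i) + half_odd m) + / (INR (S i) - half_odd m)) +
      1 * (/ (INR (S j) + half_odd m) + / (INR (S j) - half_odd m)))) n) n) by ring.
  rewrite <- rsum_scal. apply rsum_ext. intros i _.
  rewrite <- rsum_plus, <- !rsum_scal. apply rsum_ext. intros j _. rewrite half_pow_2.
  pose proof (INR_Sn_pos i). pose proof (INR_Sn_pos j). pose proof (half_odd_ge m).
  pose proof (half_odd_neq (S i) m). pose proof (half_odd_neq (S j) m). field. repeat split; lra.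
- rewrite (rsum_ext _ (fun _ => 0)), rsum_const; [ring|].
  intros i _. rewrite (rsum_ext _ (fun _ => 0)), rsum_const; [ring|]. intros; ring.
Qed.

Lemma dig_pos_series m :
  is_series (fun i => / INR (S i) - / (INR (S i) + half_odd m)) (-2 * ln 2 + rsum (half_pow 1) (S m)).
Proof.
pose proof (digamma_shift (1/2) _ (S m) ltac:(lra) digamma_half) as T.
eapply is_series_ext_R; [|exact T].
intros i; cbv beta. do 2 f_equal. unfold half_odd. rewrite !S_INR. ring.
Qed.

Lemma dig_neg_series m :
  is_series (fun i => / INR (S i) - / (INR (S i) - half_odd m)) (-2 * ln 2 + rsum (half_pow 1) m).
Proof.
induction m as [|m IH].
- eapply is_series_eq; [exact digamma_half| |simpl; ring].
  intros n; cbv beta. do 2 f_equal. unfold half_odd. rewrite S_INR. simpl. lra.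
- pose proof (is_series_tele (fun i => / (INR i - half_odd m)) _ 0 (fun n => eq_refl)) as T.
  pose proof (is_series_lin 1 (-1) _ _ _ _ IH (T ltac:(
    apply (is_lim_seq_inv _ p_infty); [|discriminate];
    apply (is_lim_seq_minus _ _ p_infty (half_odd m) p_infty);
     [apply is_lim_seq_INR|apply is_lim_seq_const|reflexivity]))) as D.
  eapply is_series_eq; [exact D| |].
  + intros i; cbv beta.
    replace (INR (S i) - half_odd (S m)) with (INR i - half_odd m) by (unfold half_odd; rewrite !S_INR; ring). ring.
  + rewrite rsum_S, half_pow_1. simpl (INR 0). pose proof (half_odd_ge m). field. lra.
Qed.

Lemma harm_le_half m : harm 1 m <= rsum (half_pow 1) m.
Proof.
induction m; [simpl; lra|]. rewrite harm_1_S, rsum_S, half_pow_1.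
apply Rplus_le_compat; auto. unfold half_odd. rewrite S_INR. pose proof (pos_INR m).
apply Rinv_le_contravar; lra.
Qed.

Lemma dig_pos_bound n m : Rabs (dig_pos n m) <= 2 + 2 * rsum (half_pow 1) m.
Proof.
pose proof ln2_pos. pose proof (half_odd_ge m).
assert (P : forall i, 0 <= / INR (S i) - / (INR (S i) + half_odd m)).
{ intros i. pose proof (INR_Sn_pos i).
  assert (/ (INR (S i) + half_odd m) <= / INR (S i)) by (apply Rinv_le_contravar; lra). lra. }
assert (U : dig_pos n m <= -2 * ln 2 + rsum (half_pow 1) (S m)) by (apply rsum_le_series; auto; apply dig_pos_series).
assert (L : 0 <= dig_pos n m) by (apply rsum_pos; auto).
assert (0 <= rsum (half_pow 1) m) by (apply rsum_pos; intros; apply half_pow_ge0).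
rewrite Rabs_pos_eq by auto. rewrite rsum_S, half_pow_1 in U.
assert (/ half_odd m <= 2) by (rewrite <- (Rinv_inv 2); apply Rinv_le_contravar; lra). lra.
Qed.

Lemma dig_neg_head n m : (n <= m)%nat -> 0 <= dig_neg n m <= 2 * rsum (half_pow 1) m.
Proof.
intros Hnm.
assert (P : forall i, (i < m)%nat -> half_odd m - INR (S i) = half_odd (m - S i)).
{ intros i Hi. unfold half_odd. rewrite minus_INR by lia. ring. }
assert (P2 : forall i, (i < m)%nat ->
  / INR (S i) - / (INR (S i) - half_odd m) = / INR (S i) + half_pow 1 (m - S i)).
{ intros i Hi. rewrite half_pow_1, <- P by auto. pose proof (INR_Sn_pos i).
  pose proof (half_odd_neq (S i) m). field. lra. }
assert (P3 : forall i, 0 <= / INR (S i) + half_pow 1 (m - S i)).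
{ intros i. pose proof (half_pow_ge0 1 (m - S i)). pose proof (Rinv_0_lt_compat _ (INR_Sn_pos i)). lra. }
unfold dig_neg. rewrite (rsum_ext _ (fun i => / INR (S i) + half_pow 1 (m - S i))) by (intros; apply P2; lia).
split; [apply rsum_pos; auto|].
apply Rle_trans with (rsum (fun i => / INR (S i) + half_pow 1 (m - S i)) m); [apply rsum_mono; auto|].
rewrite rsum_plus, (rsum_rev (half_pow 1)). pose proof (harm_le_half m).
replace (rsum (fun i => / INR (S i)) m) with (harm 1 m); [lra|].
clear. induction m; [reflexivity|]. rewrite harm_1_S, rsum_S, IHm. reflexivity.
Qed.

(** The bound must be uniform in n. The terms are positive for i < m and negative afterwards, so the
    partial sums rise until n = m and then decrease to a limit that is at least -2 ln 2. *)
Lemma dig_neg_bound n m : Rabs (dig_neg n m) <= 2 + 2 * rsum (half_pow 1) m.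
Proof.
assert (R0 : 0 <= rsum (half_pow 1) m) by (apply rsum_pos; intros; apply half_pow_ge0).
destruct (Nat.le_gt_cases n m) as [H|H].
- pose proof (dig_neg_head n m H). rewrite Rabs_pos_eq; lra.
- pose proof (dig_neg_head m m (le_n m)) as B.
  assert (N : forall i, - (/ INR (S (m + i)) - / (INR (S (m + i)) - half_odd m)) >= 0).
  { intros i. assert (0 < INR (S (m + i)) - half_odd m).
    { unfold half_odd. rewrite S_INR, plus_INR. pose proof (pos_INR i). lra. }
    pose proof (half_odd_ge m).
    assert (/ INR (S (m + i)) <= / (INR (S (m + i)) - half_odd m)) by (apply Rinv_le_contravar; lra). lra. }
  pose proof (is_series_scalR (-1) _ _ (is_series_shift _ _ m (dig_neg_series m))) as S1.
  cbv beta in S1. fold (dig_neg m m) in S1.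
  assert (E : forall K, dig_neg (m + K) m = dig_neg m m
     - rsum (fun i => -1 * (/ INR (S (m + i)) - / (INR (S (m + i)) - half_odd m))) K).
  { induction K; [rewrite Nat.add_0_r; simpl; ring|].
    rewrite Nat.add_succ_r, rsum_S. unfold dig_neg at 1. rewrite rsum_S. fold (dig_neg (m + K) m).
    rewrite IHK. ring. }
  replace n with (m + (n - m))%nat by lia. rewrite E.
  assert (Np : forall i, 0 <= -1 * (/ INR (S (m + i)) - / (INR (S (m + i)) - half_odd m)))
    by (intros i; specialize (N i); lra).
  pose proof (rsum_le_series _ _ (n - m) Np S1) as Hs.
  assert (Hp : 0 <= rsum (fun i => -1 * (/ INR (S (m + i)) - / (INR (S (m + i)) - half_odd m))) (n - m)).
  { apply rsum_pos. auto. }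
  cbv beta in Hs.
  assert (ln 2 <= 1) by (pose proof (ln_le_sub1 2); lra).
  apply Rabs_le. lra.
Qed.

(** The majorant for letting n tend to infinity in [dig_sum] and [dig_prod]. Since r^2 = 2 e_2 +
    p_2, it converges by the convergence of [half_zeta211] and [half_zeta22]. *)
Lemma ex_rsum_sq : ex_series (fun m => (2 + 2 * rsum (half_pow 1) m) ^ 2 * half_pow 2 m).
Proof.
pose proof (is_series_lin 8 8 _ _ _ _ half_zeta2_series
  (is_series_lin 2 1 _ _ _ _ (proj2 cbterm_div2) half_zeta22_series)) as D.
apply (ex_series_squeeze _ _ ) with (2 := ex_intro _ _ D).
intros m; cbv beta. pose proof (half_pow_ge0 2 m). split.
- apply Rmult_le_pos; auto. apply pow2_ge_0.
- rewrite rsum_e2.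
  rewrite (rsum_ext (fun m => half_pow 1 m ^ 2) (half_pow 2)).
  2: { intros i _. rewrite <- (half_pow_add 1 1). ring. }
  set (r := rsum (half_pow 1) m). set (s := rsum (half_pow 2) m).
  replace (8 * half_pow 2 m + 8 * (2 * ((r ^ 2 - s) / 2 * half_pow 2 m) + 1 * (s * half_pow 2 m)))
    with ((8 + 8 * r ^ 2) * half_pow 2 m) by field.
  apply Rmult_le_compat_r; auto. pose proof (pow2_ge_0 (r - 1)). lra.
Qed.

Lemma series_zero_limit (f : nat -> nat -> R) (l b : nat -> R) :
  ex_series b -> (forall m n, Rabs (f m n) <= b m) ->
  (forall m, is_lim_seq (f m) (l m)) -> (forall n, is_series (fun m => f m n) 0) ->
  is_series l 0.
Proof.
intros Hb Hd Hl Hf.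
destruct (tannery eventually f l b Hb) as [E T]; auto.
{ exists O. auto. }
replace 0 with (Series l); [apply Series_correct, E|].
assert (T' : is_lim_seq (fun n => Series (fun m => f m n)) (Series l)) by exact T.
apply (is_lim_seq_ext _ (fun _ => 0)) in T'; [|intros; apply is_series_unique, Hf].
apply is_lim_seq_unique in T'. rewrite Lim_seq_const in T'. injection T'; auto.
Qed.

Lemma dig_pos_lim m : is_lim_seq (fun n => dig_pos n m) (-2 * ln 2 + rsum (half_pow 1) (S m)).
Proof. apply (is_series_rsum (fun i => / INR (S i) - / (INR (S i) + half_odd m))), dig_pos_series. Qed.

Lemma dig_neg_lim m : is_lim_seq (fun n => dig_neg n m) (-2 * ln 2 + rsum (half_pow 1) m).
Proof. apply (is_series_rsum (fun i => / INR (S i) - / (INR (S i) - half_odd m))), dig_neg_series. Qed.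

(** With L = 2 ln 2 and odd sums a, b at m and m+1, the vanishing sums have weights (a - L)(b - L)
    and (a - L) + (b - L). The first plus L times the second is a b - L^2, free of linear terms. *)
Lemma rsum_consecutive_product :
  is_series (fun m => rsum (half_pow 1) m * rsum (half_pow 1) (S m) * half_pow 2 m) (4 * ln 2 ^ 2 * half_zeta 2).
Proof.
assert (P : is_series (fun m => (-2 * ln 2 + rsum (half_pow 1) (S m)) * (-2 * ln 2 + rsum (half_pow 1) m) * half_pow 2 m) 0).
{ apply (series_zero_limit (fun m n => dig_pos n m * dig_neg n m * half_pow 2 m) _ _ ex_rsum_sq).
  - intros m n. rewrite !Rabs_mult, (Rabs_pos_eq (half_pow 2 m)) by apply half_pow_ge0.
    apply Rmult_le_compat_r; [apply half_pow_ge0|]. rewrite <- Rsqr_pow2. unfold Rsqr.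
    apply Rmult_le_compat; auto using Rabs_pos, dig_pos_bound, dig_neg_bound.
  - intros m. apply (is_lim_seq_mult' (fun n => dig_pos n m * dig_neg n m) (fun _ => half_pow 2 m));
     [|apply is_lim_seq_const]. apply (is_lim_seq_mult' _ _); [apply dig_pos_lim|apply dig_neg_lim].
  - apply dig_prod. }
assert (Q : is_series (fun m => ((-2 * ln 2 + rsum (half_pow 1) (S m)) + (-2 * ln 2 + rsum (half_pow 1) m)) * half_pow 2 m) 0).
{ apply (series_zero_limit (fun m n => (dig_pos n m + dig_neg n m) * half_pow 2 m) _ _ ex_rsum_sq).
  - intros m n. rewrite !Rabs_mult, (Rabs_pos_eq (half_pow 2 m)) by apply half_pow_ge0.
    apply Rmult_le_compat_r; [apply half_pow_ge0|].
    eapply Rle_trans; [apply Rabs_triang|].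
    pose proof (dig_pos_bound n m). pose proof (dig_neg_bound n m).
    assert (0 <= rsum (half_pow 1) m) by (apply rsum_pos; intros; apply half_pow_ge0). nra.
  - intros m. apply (is_lim_seq_mult' (fun n => dig_pos n m + dig_neg n m) (fun _ => half_pow 2 m));
     [|apply is_lim_seq_const]. apply (is_lim_seq_plus' _ _); [apply dig_pos_lim|apply dig_neg_lim].
  - apply dig_sum. }
pose proof (is_series_lin 1 (2 * ln 2) _ _ _ _ P Q) as D.
pose proof (is_series_lin 1 (4 * ln 2 ^ 2) _ _ _ _ D half_zeta2_series) as D2.
eapply is_series_eq; [exact D2| |].
- intros m; cbv beta. ring.
- ring.
Qed.

(** For r = [rsum (half_pow 1) m], the product of consecutive sums is r^2 + r/x, and r^2 = 2 e_2 +
    p_2. *)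
Lemma half_zeta211_value : half_zeta211 = /2 * (4 * ln 2 ^ 2 * half_zeta 2 - half_zeta31 - half_zeta22).
Proof.
unfold half_zeta211. apply is_series_unique.
pose proof (is_series_lin 1 (-1) _ _ _ _ rsum_consecutive_product (proj1 (proj2 cbterm_harm1_div))) as D1.
pose proof (is_series_lin (/2) (-/2) _ _ _ _ D1 half_zeta22_series) as D2.
eapply is_series_eq; [exact D2| |ring].
intros m; cbv beta. rewrite rsum_e2, rsum_S.
rewrite (rsum_ext (fun m => half_pow 1 m ^ 2) (half_pow 2)).
- rewrite <- (half_pow_add 1 2). field.
- intros i _. rewrite <- (half_pow_add 1 1). ring.
Qed.

(** * Ballot numbers and the sum over squares of odd numbers *)

(* ballot k i = binomial(2k+1, k-i) / 4^(k+1) *)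
Fixpoint ballot (k i : nat) : R :=
  match k with
  | O => match i with O => 1/4 | S _ => 0 end
  | S k' => match i with
            | O => (3 * ballot k' 0 + ballot k' 1) / 4
            | S i' => (ballot k' i' + 2 * ballot k' i + ballot k' (S i)) / 4
            end
  end.

Lemma ballot_S0 k : ballot (S k) 0 = (3 * ballot k 0 + ballot k 1) / 4.
Proof. reflexivity. Qed.

Lemma ballot_SS k i :
  ballot (S k) (S i) = (ballot k i + 2 * ballot k (S i) + ballot k (S (S i))) / 4.
Proof. reflexivity. Qed.

Lemma ballot_ge0 k i : 0 <= ballot k i.
Proof.
revert i; induction k; intros i.
- destruct i; simpl; lra.
- destruct i; [rewrite ballot_S0|rewrite ballot_SS];
  repeat match goal with |- context [ballot k ?j] => pose proof (IHk j); generalize dependent (ballot k j); intros end; lra.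
Qed.

Lemma ballot_0 k i : (k < i)%nat -> ballot k i = 0.
Proof.
revert i; induction k; intros i Hi.
- destruct i; [lia|reflexivity].
- destruct i; [lia|]. rewrite ballot_SS, !IHk by lia. field.
Qed.

Lemma ballot_ratio k i :
  (INR k + INR i + 2) * ballot k (S i) = (INR k - INR i) * ballot k i.
Proof.
revert i; induction k; intros i.
- destruct i; simpl; lra.
- destruct i.
  + rewrite ballot_SS, ballot_S0. pose proof (IHk O) as E0. pose proof (IHk 1%nat) as E1.
    rewrite !S_INR in *. simpl (INR 0) in *.
    set (a := ballot k 0) in *. set (b := ballot k 1) in *. set (c := ballot k 2) in *.
    apply Rmult_eq_reg_l with 4; [|lra].
    replace (4 * ((INR k + 1 + 0 + 2) * ((a + 2 * b + c) / 4)))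
      with ((INR k + 3) * a + 2 * (INR k + 3) * b + (INR k + (0 + 1) + 2) * c) by field.
    rewrite E1.
    replace (4 * ((INR k + 1 - 0) * ((3 * a + b) / 4)))
      with ((INR k + 1) * (3 * a + b)) by field. lra.
  + rewrite !ballot_SS. pose proof (IHk i) as E0. pose proof (IHk (S i)) as E1.
    pose proof (IHk (S (S i))) as E2. rewrite !S_INR in *.
    set (a := ballot k i) in *. set (b := ballot k (S i)) in *.
    set (c := ballot k (S (S i))) in *. set (d := ballot k (S (S (S i)))) in *. lra.
Qed.

(** A quotient of binomials, as the difference of squares is (k+1-i)(k+2+i). In Fourier terms it is
    the second-order differential equation relating sin^(2k+3) to sin^(2k+1). *)
Lemma ballot_rec k i :
  ballot (S k) i * (half_odd (S k) ^ 2 - half_odd i ^ 2) = (INR k + 1) * half_odd (S k) * ballot k i.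
Proof.
unfold half_odd. destruct i.
- rewrite ballot_S0. pose proof (ballot_ratio k 0) as E0. rewrite !S_INR in *. simpl (INR 0) in *.
  set (a := ballot k 0) in *. set (b := ballot k 1) in *.
  replace ((3 * a + b) / 4 * ((INR k + 1 + 1 / 2) ^ 2 - (0 + 1 / 2) ^ 2))
    with ((INR k + 1) / 4 * (3 * (INR k + 2) * a + (INR k + 0 + 2) * b)) by field.
  rewrite E0. field.
- rewrite ballot_SS. pose proof (ballot_ratio k i) as E0. pose proof (ballot_ratio k (S i)) as E1.
  rewrite !S_INR in *.
  set (a := ballot k i) in *. set (b := ballot k (S i)) in *. set (c := ballot k (S (S i))) in *.
  replace ((a + 2 * b + c) / 4 * ((INR k + 1 + 1 / 2) ^ 2 - (INR i + 1 + 1 / 2) ^ 2))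
    with (((INR k + INR i + 3) * ((INR k - INR i) * a)
       + 2 * (INR k - INR i) * (INR k + INR i + 3) * b
       + (INR k - INR i) * ((INR k + (INR i + 1) + 2) * c)) / 4) by field.
  rewrite <- E0, E1. field.
Qed.

Lemma ballot_x k i :
  half_odd (S i) * ballot (S k) (S i) = half_odd (S k) / 4 * (ballot k i - ballot k (S (S i))).
Proof.
rewrite ballot_SS. pose proof (ballot_ratio k i) as E0. pose proof (ballot_ratio k (S i)) as E1.
unfold half_odd. rewrite !S_INR in *.
set (a := ballot k i) in *. set (b := ballot k (S i)) in *. set (c := ballot k (S (S i))) in *. lra.
Qed.

Lemma ballot_x0 k :
  half_odd 0 * ballot (S k) 0 = half_odd (S k) / 4 * (ballot k 0 - ballot k 1).
Proof.
rewrite ballot_S0. pose proof (ballot_ratio k 0) as E0.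
unfold half_odd. rewrite !S_INR in *. simpl (INR 0) in *.
set (a := ballot k 0) in *. set (b := ballot k 1) in *. lra.
Qed.

(** Telescoping by [ballot_x]. For n = k+1 the right side vanishes, which expresses that the
    derivative of sin^(2k+3) is 0 at the origin. *)
Lemma ballot_alt_sum k n :
  rsum (fun i => (-1) ^ i * (half_odd i * ballot (S k) i)) (S n)
  = half_odd (S k) / 4 * ((-1) ^ n * (ballot k n - ballot k (S n))).
Proof.
induction n.
- rewrite rsum_S, ballot_x0. simpl. ring.
- rewrite rsum_S, IHn, ballot_x. simpl pow. ring.
Qed.

Lemma rsum_zero_tail (f : nat -> R) n m : (n <= m)%nat ->
  (forall i, (n <= i)%nat -> f i = 0) -> rsum f m = rsum f n.
Proof.
intros H Hf. induction H; auto. rewrite rsum_S, IHle, Hf by auto. ring.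
Qed.

(** For s = 1 this is, up to a constant factor, the Wallis integral of sin^(2k+1) over a quarter
    period, integrated term by term. *)
Definition ballot_alt (s k : nat) : R := rsum (fun i => (-1) ^ i * (ballot k i * half_pow s i)) (S k).

Lemma ballot_alt_ext s k n : (k < n)%nat ->
  ballot_alt s k = rsum (fun i => (-1) ^ i * (ballot k i * half_pow s i)) n.
Proof.
intros H. symmetry. apply rsum_zero_tail; [lia|].
intros i Hi. rewrite ballot_0 by lia. ring.
Qed.

Lemma half_odd_sq_mul s i : half_odd i ^ 2 * half_pow (S (S s)) i = half_pow s i.
Proof.
unfold half_pow. pose proof (half_odd_ge i). simpl pow.
assert (half_odd i ^ s <> 0) by (apply pow_nonzero; lra). field. split; auto; lra.
Qed.

(** Insert x_i^2 in the numerator of the s-sum and apply [ballot_rec] to the difference of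
    squares. *)
Lemma ballot_alt_step s k :
  half_odd (S k) ^ 2 * ballot_alt (S (S s)) (S k) - ballot_alt s (S k) = (INR k + 1) * half_odd (S k) * ballot_alt (S (S s)) k.
Proof.
rewrite (ballot_alt_ext (S (S s)) k (S (S k))) by lia. unfold ballot_alt.
rewrite <- !rsum_scal, <- rsum_minus. apply rsum_ext. intros i _.
rewrite <- (half_odd_sq_mul s i).
replace (half_odd (S k) ^ 2 * ((-1) ^ i * (ballot (S k) i * half_pow (S (S s)) i)) -
  (-1) ^ i * (ballot (S k) i * (half_odd i ^ 2 * half_pow (S (S s)) i)))
 with ((-1) ^ i * half_pow (S (S s)) i * (ballot (S k) i * (half_odd (S k) ^ 2 - half_odd i ^ 2))) by ring.
rewrite ballot_rec. ring.
Qed.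

Lemma ballot_alt_1 k : ballot_alt 1 k = INR (S k) * cbterm 0 k / 4.
Proof.
induction k.
- unfold ballot_alt, cbterm, half_odd, half_pow, half_odd. simpl. field.
(* This is [ballot_alt_step] with exponent -1 for the lower sum, which is 0 by [ballot_alt_sum];
   what remains is the recurrence of (k+1) times [cbterm 0 k]. *)
- assert (E : half_odd (S k) ^ 2 * ballot_alt 1 (S k) = (INR k + 1) * half_odd (S k) * ballot_alt 1 k).
  { rewrite (ballot_alt_ext 1 k (S (S k))) by lia. unfold ballot_alt.
    rewrite <- !rsum_scal.
    transitivity (rsum (fun i => (-1) ^ i * (half_odd i * ballot (S k) i)) (S (S k))
       + rsum (fun i => (INR k + 1) * half_odd (S k) * ((-1) ^ i * (ballot k i * half_pow 1 i))) (S (S k))).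
    - rewrite <- rsum_plus. apply rsum_ext. intros i _.
      replace ((INR k + 1) * half_odd (S k) * ((-1) ^ i * (ballot k i * half_pow 1 i)))
        with ((-1) ^ i * half_pow 1 i * ((INR k + 1) * half_odd (S k) * ballot k i)) by ring.
      rewrite <- ballot_rec, half_pow_1. pose proof (half_odd_ge i). field. lra.
    - rewrite ballot_alt_sum, !ballot_0 by lia. ring. }
  pose proof (half_odd_ge (S k)) as Hx.
  apply Rmult_eq_reg_l with (half_odd (S k) ^ 2); [|apply pow_nonzero; lra].
  rewrite E, IHk. unfold cbterm. rewrite half_odd_0, (conn_S _ (S k)).
  pose proof (pos_INR k). unfold half_odd. rewrite !S_INR. field. lra.
Qed.

(** In [ballot_alt_step] with s = 1, the quotient of the sums for exponents 3 and 1 grows by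
    1/x_{k+1}^2 at each step. *)
Lemma ballot_alt_3 k : ballot_alt 3 k = ballot_alt 1 k * rsum (half_pow 2) (S k).
Proof.
induction k.
- unfold ballot_alt. rewrite !rsum_S. cbn [rsum]. rewrite <- (half_pow_add 1 2). ring.
- pose proof (ballot_alt_step 1 k) as E. rewrite IHk in E.
  assert (E1 : half_odd (S k) ^ 2 * ballot_alt 1 (S k) = (INR k + 1) * half_odd (S k) * ballot_alt 1 k).
  { rewrite !ballot_alt_1. unfold cbterm. rewrite half_odd_0, (conn_S _ (S k)).
    pose proof (pos_INR k). unfold half_odd. rewrite !S_INR. field. lra. }
  pose proof (half_odd_ge (S k)) as Hx.
  apply Rmult_eq_reg_l with (half_odd (S k) ^ 2); [|apply pow_nonzero; lra].
  rewrite rsum_S.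
  replace (half_odd (S k) ^ 2 * (ballot_alt 1 (S k) * (rsum (half_pow 2) (S k) + half_pow 2 (S k))))
    with ((half_odd (S k) ^ 2 * ballot_alt 1 (S k)) * rsum (half_pow 2) (S k) + ballot_alt 1 (S k) * (half_odd (S k) ^ 2 * half_pow 2 (S k))) by ring.
  rewrite E1, (half_odd_sq_mul 0). unfold half_pow at 2. simpl pow. lra.
Qed.

Lemma ballot_le k i : ballot k (S i) <= ballot k i.
Proof.
pose proof (ballot_ratio k i) as E. pose proof (ballot_ge0 k i). pose proof (ballot_ge0 k (S i)).
pose proof (pos_INR k). pose proof (pos_INR i). nra.
Qed.

Lemma ballot_lim0 : is_lim_seq (fun k => ballot k 0) 0.
Proof.
assert (B : forall k, ballot k 0 ^ 2 <= / INR (S k)).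
{ assert (B' : forall k, ballot k 0 ^ 2 <= / (INR k + 2)).
  { induction k; [simpl; lra|].
    pose proof (ballot_rec k 0) as E. pose proof (pos_INR k) as Hk.
    assert (E' : ballot (S k) 0 = ballot k 0 * ((INR k + 3/2) / (INR k + 2))).
    { apply Rmult_eq_reg_r with (half_odd (S k) ^ 2 - half_odd 0 ^ 2).
      - rewrite E. unfold half_odd. rewrite !S_INR. simpl (INR 0). field. lra.
      - unfold half_odd. rewrite !S_INR. simpl (INR 0). nra. }
    rewrite E', Rpow_mult_distr, S_INR.
    apply Rle_trans with (/ (INR k + 2) * ((INR k + 3/2) / (INR k + 2)) ^ 2).
    - apply Rmult_le_compat_r; [apply pow2_ge_0|exact IHk].
    - apply Rmult_le_reg_r with ((INR k + 2) ^ 3 * (INR k + 1 + 2)).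
      + apply Rmult_lt_0_compat; [apply pow_lt|]; lra.
      + replace (/ (INR k + 2) * ((INR k + 3 / 2) / (INR k + 2)) ^ 2 * ((INR k + 2) ^ 3 * (INR k + 1 + 2)))
          with ((INR k + 3/2) ^ 2 * (INR k + 3)) by (field; lra).
        replace (/ (INR k + 1 + 2) * ((INR k + 2) ^ 3 * (INR k + 1 + 2)))
          with ((INR k + 2) ^ 3) by (field; lra). nra. }
  intros k. eapply Rle_trans; [apply B'|]. rewrite S_INR. pose proof (pos_INR k).
  apply Rinv_le_contravar; lra. }
apply is_lim_seq_le_le with (fun _ => 0) (fun k => sqrt (/ INR (S k))).
- intros k. split; [apply ballot_ge0|].
  rewrite <- (sqrt_pow2 (ballot k 0)) by apply ballot_ge0. apply sqrt_le_1_alt, B.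
- apply is_lim_seq_const.
- rewrite <- sqrt_0 at 1. apply is_lim_seq_continuous; [apply continuity_pt_filterlim, continuous_sqrt|].
  apply (is_lim_seq_incr_1 (fun k => / INR k)).
  apply (is_lim_seq_inv INR p_infty); [apply is_lim_seq_INR|discriminate].
Qed.

Lemma ballot_lim i : is_lim_seq (fun k => ballot k i) 0.
Proof.
apply is_lim_seq_le_le with (fun _ => 0) (fun k => ballot k 0).
- intros k. split; [apply ballot_ge0|]. induction i; [lra|].
  eapply Rle_trans; [apply ballot_le|exact IHi].
- apply is_lim_seq_const.
- apply ballot_lim0.
Qed.

(* First-passage probabilities of the simple random walk sum to 1. *)
Lemma ballot_hitting i : is_series (fun k => ballot k i - ballot k (S i)) 1.
Proof.
induction i.
- pose proof (is_series_tele (fun k => 4 * ballot k 0) _ (4 * 0) (fun n => eq_refl)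
    (is_lim_seq_scal_l _ 4 0 (ballot_lim 0))) as T.
  eapply is_series_eq; [exact T| |].
  + intros k; cbv beta. rewrite ballot_S0. field.
  + simpl. field.
- pose proof (is_series_tele (fun k => 4 * ballot k (S i)) _ (4 * 0) (fun n => eq_refl)
    (is_lim_seq_scal_l _ 4 0 (ballot_lim (S i)))) as T.
  pose proof (is_series_lin 1 1 _ _ _ _ IHi T) as D.
  eapply is_series_eq; [exact D| |].
  + intros k; cbv beta. rewrite ballot_SS. field.
  + simpl. field.
Qed.

Definition ballot_weight (i k : nat) : R := ballot k i / INR (S k).

Lemma ballot_weight_ge0 i k : 0 <= ballot_weight i k.
Proof.
apply Rmult_le_pos; [apply ballot_ge0|]. apply Rlt_le, Rinv_0_lt_compat, INR_Sn_pos.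
Qed.

(** [ballot_ratio] is equivalent to (k+1)(b_i - b_{i+1}) = (i+1)(b_i + b_{i+1}), which reduces the
    sum to [ballot_hitting]. *)
Lemma ballot_weight_pair i : is_series (fun k => ballot_weight i k + ballot_weight (S i) k) (/ INR (S i)).
Proof.
pose proof (is_series_scalR (/ INR (S i)) _ _ (ballot_hitting i)) as T.
eapply is_series_eq; [exact T| |ring].
intros k; cbv beta. unfold ballot_weight. pose proof (ballot_ratio k i) as E.
pose proof (pos_INR k). pose proof (pos_INR i). rewrite !S_INR.
apply Rmult_eq_reg_l with ((INR i + 1) * (INR k + 1)); [|nra].
replace ((INR i + 1) * (INR k + 1) * (/ (INR i + 1) * (ballot k i - ballot k (S i))))
  with ((INR k + 1) * (ballot k i - ballot k (S i))) by (field; lra).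
replace ((INR i + 1) * (INR k + 1) * (ballot k i / (INR k + 1) + ballot k (S i) / (INR k + 1)))
  with ((INR i + 1) * (ballot k i + ballot k (S i))) by (field; lra). lra.
Qed.

Definition ballot_tail (i : nat) : R := Series (ballot_weight i).

Lemma ballot_tail_series i : is_series (ballot_weight i) (ballot_tail i).
Proof.
apply Series_correct.
apply (ex_series_squeeze _ (fun k => ballot_weight i k + ballot_weight (S i) k)); [|eexists; apply ballot_weight_pair].
intros k. pose proof (ballot_weight_ge0 i k). pose proof (ballot_weight_ge0 (S i) k). lra.
Qed.

Lemma ballot_tail_pair i : ballot_tail i + ballot_tail (S i) = / INR (S i).
Proof.
rewrite <- (is_series_unique _ _ (ballot_weight_pair i)). symmetry. apply is_series_unique.
eapply is_series_eq; [apply (is_series_lin 1 1 _ _ _ _ (ballot_tail_series i) (ballot_tail_series (S i)))| |];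
 [intros; cbv beta|]; ring.
Qed.

Lemma ballot_tail_bounds i : 0 <= ballot_tail i <= / INR (S i).
Proof.
assert (P : forall j, 0 <= ballot_tail j) by (intros j; apply (series_ge0 (ballot_weight j)); [apply ballot_weight_ge0|apply ballot_tail_series]).
pose proof (ballot_tail_pair i). pose proof (P i). pose proof (P (S i)). lra.
Qed.

(** [ballot_tail_pair] is iterated two steps at a time, which makes the alternating tail an ordinary
    series of differences. *)
Lemma ballot_tail_alternating i :
  is_series (fun m => / INR (S (i + 2 * m)) - / INR (S (S (i + 2 * m)))) (ballot_tail i).
Proof.
pose proof (is_series_tele (fun m => ballot_tail (i + 2 * m)) _ 0 (fun n => eq_refl)) as T.
eapply is_series_eq; [apply T| |].
- apply (is_lim_seq_le_le (fun _ => 0) _ (fun m => / INR (S m))).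
  + intros m. pose proof (ballot_tail_bounds (i + 2 * m)). split; [lra|].
    eapply Rle_trans; [apply H|]. apply Rinv_le_contravar; [apply INR_Sn_pos|].
    apply le_INR. lia.
  + apply is_lim_seq_const.
  + apply (is_lim_seq_incr_1 (fun k => / INR k)).
    apply (is_lim_seq_inv INR p_infty); [apply is_lim_seq_INR|discriminate].
- intros m; cbv beta. rewrite <- !ballot_tail_pair.
  replace (i + 2 * S m)%nat with (S (S (i + 2 * m))) by lia. ring.
- cbv beta. rewrite Nat.add_0_r. ring.
Qed.

Lemma is_series_finite (a : nat -> R) n :
  (forall i, (n <= i)%nat -> a i = 0) -> is_series a (rsum a n).
Proof.
intros H. apply is_series_rsum.
apply (is_lim_seq_ext_loc (fun _ => rsum a n)); [|apply is_lim_seq_const].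
exists n. intros m Hm. symmetry. apply rsum_zero_tail; auto.
Qed.

Lemma pow_m1_abs i : Rabs ((-1) ^ i) = 1.
Proof. apply pow_1_abs. Qed.

(** By [ballot_alt_1] and [ballot_alt_3] the k-th term is 4 [ballot_alt 3 k] / (k+1), a double sum
    with signs. Since the weights of a fixed i sum to at most 1 over k, the i-th term is dominated
    by 4/x_i^3 and k can be summed first. *)
Lemma cbterm_odd_square_tannery :
  ex_series (fun i => 4 * (-1) ^ i * half_pow 3 i * ballot_tail i) /\
  is_series (fun k => cbterm 0 k * rsum (half_pow 2) (S k)) (Series (fun i => 4 * (-1) ^ i * half_pow 3 i * ballot_tail i)).
Proof.
destruct (tannery eventually (fun i n => 4 * (-1) ^ i * half_pow 3 i * rsum (ballot_weight i) n)
   (fun i => 4 * (-1) ^ i * half_pow 3 i * ballot_tail i) (fun i => 4 * half_pow 3 i)) as [E T].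
- apply (ex_series_scal_l 4 (half_pow 3)), descent_harm1.
- exists O. intros n _ i.
  rewrite !Rabs_mult, pow_m1_abs, (Rabs_pos_eq 4), (Rabs_pos_eq (half_pow 3 i)) by (lra || apply half_pow_ge0).
  assert (B : 0 <= rsum (ballot_weight i) n <= 1).
  { split; [apply rsum_pos; intros; apply ballot_weight_ge0|].
    eapply Rle_trans; [apply (rsum_le_series _ _ n (ballot_weight_ge0 i) (ballot_tail_series i))|].
    eapply Rle_trans; [apply ballot_tail_bounds|]. rewrite <- Rinv_1.
    apply Rinv_le_contravar; [lra|]. rewrite S_INR. pose proof (pos_INR i). lra. }
  rewrite Rabs_pos_eq by lra. pose proof (half_pow_ge0 3 i). nra.
- intros i. apply (is_lim_seq_scal_l (rsum (ballot_weight i)) (4 * (-1) ^ i * half_pow 3 i) (ballot_tail i)).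
  apply is_series_rsum, ballot_tail_series.
- split; [exact E|]. apply is_series_rsum.
  eapply is_lim_seq_ext; [|exact T].
  intros n; cbv beta.
  (* For k < n only the indices i < n contribute, so the inner series is a finite sum and the
     exchange is finite. *)
  assert (Z : forall i, (n <= i)%nat -> 4 * (-1) ^ i * half_pow 3 i * rsum (ballot_weight i) n = 0).
  { intros i Hi. rewrite (rsum_ext _ (fun _ => 0)), rsum_const; [ring|].
    intros k Hk. unfold ballot_weight. rewrite ballot_0 by lia. unfold Rdiv; ring. }
  rewrite (is_series_unique _ _ (is_series_finite _ n Z)).
  rewrite (rsum_ext _ (fun i => rsum (fun k => 4 * (-1) ^ i * half_pow 3 i * ballot_weight i k) n))
    by (intros; rewrite rsum_scal; reflexivity).
  rewrite rsum_exch. apply rsum_ext. intros k Hk.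
  transitivity (4 / INR (S k) * ballot_alt 3 k).
  + rewrite (ballot_alt_ext 3 k n) by lia. rewrite <- rsum_scal. apply rsum_ext. intros i _.
    unfold ballot_weight, Rdiv. ring.
  + rewrite ballot_alt_3, ballot_alt_1. pose proof (INR_Sn_pos k). field. lra.
Qed.

Lemma rsum_even_odd a n :
  rsum a (2 * n) = rsum (fun i => a (2 * i)%nat) n + rsum (fun i => a (2 * i + 1)%nat) n.
Proof.
induction n; [simpl; ring|].
replace (2 * S n)%nat with (S (S (2 * n))) by lia. rewrite !rsum_S, IHn.
replace (2 * n + 1)%nat with (S (2 * n)) by lia. ring.
Qed.

Lemma Series_even_odd (a : nat -> R) (s1 s2 : R) :
  ex_series a -> is_series (fun i => a (2 * i)%nat) s1 ->
  is_series (fun i => a (2 * i + 1)%nat) s2 -> Series a = s1 + s2.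
Proof.
intros Ha H1 H2.
pose proof (proj1 (is_series_rsum _ _) (Series_correct _ Ha)) as H.
assert (S2 : is_lim_seq (fun n => rsum a (2 * n)) (Series a)).
{ apply (is_lim_seq_subseq (rsum a) (Series a) (fun n => (2 * n)%nat)); [|exact H].
  apply eventually_subseq. intros n; lia. }
assert (S3 : is_lim_seq (fun n => rsum a (2 * n)) (s1 + s2)).
{ eapply is_lim_seq_ext; [intros; symmetry; apply rsum_even_odd|].
  apply is_lim_seq_plus'; apply is_series_rsum; auto. }
apply is_lim_seq_unique in S2. apply is_lim_seq_unique in S3.
rewrite S2 in S3. injection S3; auto.
Qed.

Lemma half_pow_even s i : half_pow s (2 * i) = / 2 ^ s * shift_pow (1/4) s i.
Proof.
unfold half_pow, shift_pow, half_odd. rewrite <- Rinv_mult, <- Rpow_mult_distr. do 2 f_equal.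
rewrite mult_INR. simpl. lra.
Qed.

Lemma half_pow_odd s i : half_pow s (2 * i + 1) = / 2 ^ s * shift_pow (3/4) s i.
Proof.
unfold half_pow, shift_pow, half_odd. rewrite <- Rinv_mult, <- Rpow_mult_distr. do 2 f_equal.
rewrite plus_INR, mult_INR. simpl. lra.
Qed.

Lemma half_zeta_split s z1 z3 : ex_series (half_pow s) -> is_series (shift_pow (1/4) s) z1 -> is_series (shift_pow (3/4) s) z3 ->
  half_zeta s = / 2 ^ s * (z1 + z3).
Proof.
intros E H1 H3. rewrite Rmult_plus_distr_l.
apply Series_even_odd; auto.
- eapply is_series_ext_R; [|apply is_series_scalR, H1]. intros; symmetry; apply half_pow_even.
- eapply is_series_ext_R; [|apply is_series_scalR, H3]. intros; symmetry; apply half_pow_odd.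
Qed.

Lemma pow_m1_even i : (-1) ^ (2 * i) = 1.
Proof. rewrite pow_mult. replace ((-1)^2) with 1 by ring. apply pow1. Qed.

Lemma pow_m1_odd i : (-1) ^ (2 * i + 1) = -1.
Proof. rewrite pow_add, pow_m1_even. ring. Qed.

Lemma catalan_split z1 z3 : is_series (shift_pow (1/4) 2) z1 -> is_series (shift_pow (3/4) 2) z3 ->
  catalan = (z1 - z3) / 16.
Proof.
intros H1 H3. replace ((z1 - z3) / 16) with (/16 * z1 + -/16 * z3) by field.
assert (E : forall n, (-1) ^ n / INR (2 * n + 1) ^ 2 = (-1) ^ n * half_pow 2 n / 4).
{ intros n. replace (INR (2 * n + 1)) with (2 * half_odd n)
   by (unfold half_odd; rewrite plus_INR, mult_INR; simpl; lra).
  rewrite half_pow_2. pose proof (half_odd_ge n). field. lra. }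
unfold catalan. apply Series_even_odd.
- apply (ex_series_dom _ (half_pow 2)); [|apply descent_one].
  intros n. rewrite E. unfold Rdiv. rewrite !Rabs_mult, pow_m1_abs. pose proof (half_pow_ge0 2 n).
  rewrite (Rabs_pos_eq (half_pow 2 n)), Rabs_pos_eq; lra.
- eapply is_series_ext_R; [|apply is_series_scalR, H1].
  intros i; cbv beta. rewrite E, pow_m1_even, half_pow_even. field.
- eapply is_series_ext_R; [|apply is_series_scalR, H3].
  intros i; cbv beta. rewrite E, pow_m1_odd, half_pow_odd. field.
Qed.

Lemma ballot_tail_even n : is_series (fun j => / (INR j + (INR n + 2 * (1/4))) - / (INR j + (INR n + 1))) (2 * ballot_tail (2 * n)).
Proof.
eapply is_series_ext_R; [|apply (is_series_scalR 2), ballot_tail_alternating].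
intros m; cbv beta. rewrite !S_INR, plus_INR, !mult_INR. change (INR 2) with 2.
pose proof (pos_INR m). pose proof (pos_INR n). field. lra.
Qed.

(** With 2c = 3/2 the two fractions come in the opposite order; this minus sign absorbs the factor
    (-1)^i at odd i. *)
Lemma ballot_tail_odd n : is_series (fun j => / (INR j + (INR n + 2 * (3/4))) - / (INR j + (INR n + 1))) (-2 * ballot_tail (2 * n + 1)).
Proof.
eapply is_series_ext_R; [|apply (is_series_scalR (-2)), ballot_tail_alternating].
intros m; cbv beta. rewrite !S_INR, !plus_INR, !mult_INR. change (INR 2) with 2. change (INR 1) with 1.
pose proof (pos_INR m). pose proof (pos_INR n). field. lra.
Qed.

(** Both residue classes contribute (3/2 z4 - z2^2)/4 with the same sign. The identity a^2 + b^2 =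
    ((a+b)^2 + (a-b)^2)/2 turns the squares into [half_zeta 2 ^ 2] and [catalan ^ 2]. *)
Lemma cbterm_odd_square :
  is_series (fun k => cbterm 0 k * rsum (half_pow 2) (S k)) (6 * half_zeta 4 - 2 * half_zeta 2 ^ 2 - 32 * catalan ^ 2).
Proof.
destruct cbterm_odd_square_tannery as [E T].
assert (X2 : forall c, 1/4 <= c -> is_series (shift_pow c 2) (Series (shift_pow c 2))).
{ intros c Hc. apply Series_correct, ex_shift_pow; [lra|apply descent_one]. }
assert (X4 : forall c, 1/4 <= c -> is_series (shift_pow c 4) (Series (shift_pow c 4))).
{ intros c Hc. apply Series_correct, ex_shift_pow; [lra|apply descent_e2]. }
pose proof (X2 (1/4) ltac:(lra)) as A2. pose proof (X2 (3/4) ltac:(lra)) as B2.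
pose proof (X4 (1/4) ltac:(lra)) as A4. pose proof (X4 (3/4) ltac:(lra)) as B4.
pose proof (tail_euler_sum (1/4) _ _ _ ltac:(lra) A2 A4 ballot_tail_even) as R1.
pose proof (tail_euler_sum (3/4) _ _ _ ltac:(lra) B2 B4 ballot_tail_odd) as R3.
rewrite (catalan_split _ _ A2 B2).
rewrite (half_zeta_split 2 _ _ (proj1 descent_one) A2 B2), (half_zeta_split 4 _ _ (proj1 descent_e2) A4 B4).
set (a2 := Series (shift_pow (1/4) 2)) in *. set (b2 := Series (shift_pow (3/4) 2)) in *.
set (a4 := Series (shift_pow (1/4) 4)) in *. set (b4 := Series (shift_pow (3/4) 4)) in *.
replace (6 * (/ 2 ^ 4 * (a4 + b4)) - 2 * (/ 2 ^ 2 * (a2 + b2)) ^ 2 - 32 * ((a2 - b2) / 16) ^ 2)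
  with (/4 * (3 / 2 * a4 - a2 ^ 2) + /4 * (3 / 2 * b4 - b2 ^ 2)) by field.
erewrite <- Series_even_odd; [exact T|exact E| |].
- eapply is_series_ext_R; [|apply is_series_scalR, R1].
  intros n; cbv beta. rewrite pow_m1_even, half_pow_even. field.
- eapply is_series_ext_R; [|apply is_series_scalR, R3].
  intros n; cbv beta. rewrite pow_m1_odd, half_pow_odd. field.
Qed.

(** * Zeta values *)

Lemma shift_pow_one s n : shift_pow 1 s n = / INR (S n) ^ s.
Proof. unfold shift_pow. rewrite S_INR. reflexivity. Qed.

Lemma zeta_series s : ex_series (half_pow s) -> is_series (shift_pow 1 s) (zeta s).
Proof.
intros H. replace (zeta s) with (Series (shift_pow 1 s)).
- apply Series_correct, ex_shift_pow; [lra|exact H].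
- apply Series_ext, shift_pow_one.
Qed.

Lemma half_zeta_zeta s : ex_series (half_pow s) -> half_zeta s = (2 ^ s - 1) * zeta s.
Proof.
intros H. pose proof (zeta_series s H) as Z.
assert (P : 2 ^ s <> 0) by (apply pow_nonzero; lra).
assert (E : zeta s = / 2 ^ s * half_zeta s + / 2 ^ s * zeta s).
{ rewrite <- (is_series_unique _ _ Z) at 1. apply Series_even_odd.
  - eexists; exact Z.
  - eapply is_series_ext_R; [|apply is_series_scalR, (Series_correct _ H)].
    intros n. unfold half_pow, shift_pow, half_odd. rewrite <- Rinv_mult, <- Rpow_mult_distr, mult_INR.
    do 2 f_equal. simpl. lra.
  - eapply is_series_ext_R; [|apply is_series_scalR, Z].
    intros n. unfold shift_pow. rewrite <- Rinv_mult, <- Rpow_mult_distr, plus_INR, mult_INR.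
    do 2 f_equal. simpl. lra. }
apply Rmult_eq_reg_l with (/ 2 ^ s); [|apply Rinv_neq_0_compat; auto].
replace (/ 2 ^ s * ((2 ^ s - 1) * zeta s)) with (zeta s - / 2 ^ s * zeta s) by (field; auto). lra.
Qed.

Lemma rsum_shift_pow_one n : rsum (shift_pow 1 1) n = harm 1 n.
Proof. induction n; [reflexivity|]. rewrite rsum_S, IHn, shift_pow_one, harm_S. reflexivity. Qed.

Lemma rsum_rev_diff s n : rsum (fun i => / INR (n - i) ^ s) n = rsum (shift_pow 1 s) n.
Proof.
rewrite <- (rsum_rev (shift_pow 1 s)). apply rsum_ext. intros i Hi. rewrite shift_pow_one.
do 3 f_equal. lia.
Qed.

(* Partial fractions of 1/(x^2 y^2) in terms of x + y. *)
Lemma zeta2_shuffle :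
  is_series (fun l => 2 * (rsum (shift_pow 1 2) l * shift_pow 1 2 l) + 4 * (harm 1 l * shift_pow 1 3 l)) (zeta 2 ^ 2).
Proof.
pose proof (zeta_series 2 (proj1 descent_one)) as Z.
pose proof (tri_cols (fun m l => shift_pow 1 2 m * / INR (l - m) ^ 2) (fun m => zeta 2 * shift_pow 1 2 m)) as T.
eapply is_series_ext_R; [|apply T].
- intros l; cbv beta.
  transitivity (shift_pow 1 2 l * rsum (shift_pow 1 2) l + shift_pow 1 2 l * rsum (fun i => / INR (l - i) ^ 2) l
     + 2 * shift_pow 1 3 l * rsum (shift_pow 1 1) l + 2 * shift_pow 1 3 l * rsum (fun i => / INR (l - i) ^ 1) l).
  + rewrite <- !rsum_scal, <- !rsum_plus. apply rsum_ext. intros i Hi. unfold shift_pow.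
    replace (INR l + 1) with (INR i + 1 + INR (l - i)) by (rewrite minus_INR by lia; ring).
    assert (0 < INR (l - i)) by (apply lt_0_INR; lia). pose proof (pos_INR i). field. lra.
  + rewrite !rsum_rev_diff, !rsum_shift_pow_one. ring.
- intros i j H. apply Rmult_le_pos; [apply Rlt_le, shift_pow_pos; lra|].
  apply Rlt_le, Rinv_0_lt_compat, pow_lt, lt_0_INR. lia.
- intros i. rewrite Rmult_comm. eapply is_series_ext_R; [|apply is_series_scalR, Z].
  intros n; cbv beta. rewrite (shift_pow_one 2 n). do 4 f_equal. lia.
- replace (zeta 2 ^ 2) with (zeta 2 * zeta 2) by ring. apply is_series_scalR, Z.
Qed.

Lemma shift_pow_sq c s n : shift_pow c s n ^ 2 = shift_pow c (s * 2) n.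
Proof. unfold shift_pow. rewrite pow_inv, <- pow_mult. reflexivity. Qed.

(** The shuffle form 2 zeta(2,2) + 4 zeta(3,1) of zeta(2)^2 is compared with the stuffle form 2
    zeta(2,2) + zeta(4). *)
Lemma zeta31 : is_series (fun l => harm 1 l * shift_pow 1 3 l) (zeta 4 / 4).
Proof.
pose proof (zeta_series 2 (proj1 descent_one)) as Z2. pose proof (zeta_series 4 (proj1 descent_e2)) as Z4.
assert (H22 : is_series (fun n => rsum (shift_pow 1 2) n * shift_pow 1 2 n) ((zeta 2 ^ 2 - zeta 4) / 2)).
{ apply series_square; auto; [intros; apply Rlt_le, shift_pow_pos; lra|].
  eapply is_series_ext_R; [|exact Z4]. intros n; rewrite shift_pow_sq. reflexivity. }
pose proof (is_series_lin (/4) (-/2) _ _ _ _ zeta2_shuffle H22) as D.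
eapply is_series_eq; [exact D| |field]. intros n; cbv beta. field.
Qed.

(** The sum in [zeta31] is also the case c = 1, h = 0 of [linear_euler_sum]; the two values must
    agree. *)
Lemma zeta2_sq : zeta 2 ^ 2 = 5/2 * zeta 4.
Proof.
pose proof (zeta_series 2 (proj1 descent_one)) as Z2. pose proof (zeta_series 4 (proj1 descent_e2)) as Z4.
assert (H0 : is_series (fun i => / INR (S i) - / (INR i + 1)) 0).
{ eapply is_series_ext_R; [|apply (harm_series 0)]. intros n; cbv beta. simpl (INR 0). do 2 f_equal. ring. }
pose proof (linear_euler_sum 1 0 _ _ ltac:(lra) H0 Z2 Z4) as L.
pose proof (is_series_unique _ _ zeta31) as U.
rewrite (Series_ext _ (fun l => (harm 1 l - 0) * shift_pow 1 3 l)) in U by (intros; ring).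
rewrite (is_series_unique _ _ L) in U. lra.
Qed.

Lemma series_even_part (a : nat -> R) (s s' : R) :
  is_series a s -> is_series (fun n => (-1) ^ n * a n) s' ->
  is_series (fun m => a (2 * m)%nat) ((s + s') / 2).
Proof.
intros H1 H2. apply is_series_rsum.
assert (D : is_lim_seq (rsum (fun n => /2 * a n + /2 * ((-1) ^ n * a n))) ((s + s') / 2)).
{ apply is_series_rsum. eapply is_series_eq; [apply (is_series_lin (/2) (/2) _ _ _ _ H1 H2)|reflexivity|field]. }
apply (is_lim_seq_ext (fun n => rsum (fun n => /2 * a n + /2 * ((-1) ^ n * a n)) (2 * n))).
- intros n. rewrite rsum_even_odd.
  rewrite (rsum_ext (fun i => _ * a (2 * i + 1)%nat + _) (fun _ => 0)), rsum_const.
  + rewrite Rmult_0_r, Rplus_0_r. apply rsum_ext. intros i _. rewrite pow_m1_even. field.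
  + intros i _. rewrite pow_m1_odd. field.
- apply (is_lim_seq_subseq (rsum (fun n => /2 * a n + /2 * ((-1) ^ n * a n))) ((s + s') / 2) (fun n => (2 * n)%nat)); [|exact D].
  apply eventually_subseq. intros n; lia.
Qed.

(** At n = 2m the term H_{2m}/(2m+1)^3 is 1/16 of (H_m + [rsum (half_pow 1) m]) [half_pow 3 m]. The
    part with H_m is removed by [linear_euler_sum] at c = 1/2, where h = -2 ln 2 brings in
    zeta(3). *)
Lemma half_zeta31_alternating w : is_series (fun n => (-1) ^ n * (harm 1 n * shift_pow 1 3 n)) w ->
  half_zeta31 = -37/4 * zeta 4 + 8 * w + 14 * ln 2 * zeta 3.
Proof.
intros Hw.
pose proof (series_even_part _ _ _ zeta31 Hw) as E.
pose proof (linear_euler_sum (1/2) _ _ _ ltac:(lra) digamma_half half_zeta2_series half_zeta4_series) as L.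
pose proof (is_series_lin 16 (-1) _ _ _ _ E L) as D1.
pose proof (is_series_lin 1 (2 * ln 2) _ _ _ _ D1 half_zeta3_series) as D2.
unfold half_zeta31. apply is_series_unique.
eapply is_series_eq; [exact D2| |].
- intros n; cbv beta. rewrite harm_double, pow_1.
  replace (shift_pow 1 3 (2 * n)) with (/ 8 * half_pow 3 n).
  + change (shift_pow (1/2) 3 n) with (half_pow 3 n). field.
  + unfold half_pow, shift_pow, half_odd. rewrite mult_INR. simpl (INR 2). pose proof (pos_INR n). field. lra.
- rewrite !half_zeta_zeta by (apply descent_one || apply descent_harm1 || apply descent_e2).
  replace (((2 ^ 2 - 1) * zeta 2) ^ 2) with (9 * zeta 2 ^ 2) by ring.
  rewrite zeta2_sq. field.
Qed.

(** * Polylogarithms *)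

Definition pl_coef (a : nat -> R) (s n : nat) : R := a n / INR (S n) ^ s.
(** The quotient of [pl] by x, kept as a power series so that it makes sense at 0; it is the
    derivative of the next [pl] and the bounded factor in x ln x terms. *)
Definition pl_quot (a : nat -> R) (s : nat) (x : R) : R := PSeries (pl_coef a s) x.

(* sum a_n x^(n+1) / (n+1)^s *)
Definition pl (a : nat -> R) (s : nat) (x : R) : R := x * pl_quot a s x.

Lemma pl_coef_S a s n : pl_coef a s n = INR (S n) * pl_coef a (S s) n.
Proof.
unfold pl_coef. pose proof (INR_Sn_pos n). rewrite <- tech_pow_Rmult.
assert (INR (S n) ^ s <> 0) by (apply pow_nonzero; lra). field. lra.
Qed.

Lemma pl_coef_bound a s : (forall n, Rabs (a n) <= INR (S n)) -> forall n, Rabs (pl_coef a (S s) n) <= 1.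
Proof.
intros H n. pose proof (INR_Sn_pos n) as Hn.
assert (1 <= INR (S n)) by (rewrite S_INR; pose proof (pos_INR n); lra).
unfold pl_coef, Rdiv. rewrite Rabs_mult, Rabs_inv, (Rabs_pos_eq (_ ^ _)) by (apply pow_le; lra).
apply Rmult_le_reg_r with (INR (S n) ^ S s); [apply pow_lt; auto|].
rewrite Rmult_assoc, Rinv_l, Rmult_1_r, Rmult_1_l by (apply pow_nonzero; lra).
eapply Rle_trans; [apply H|]. rewrite <- tech_pow_Rmult.
rewrite <- (Rmult_1_r (INR (S n))) at 1. apply Rmult_le_compat_l; [lra|]. apply pow_R1_Rle; lra.
Qed.

Lemma pl_coef_radius a s x : (forall n, Rabs (a n) <= INR (S n)) -> Rabs x < 1 ->
  Rbar_lt (Rabs x) (CV_radius (pl_coef a (S s))).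
Proof.
intros H Hx. apply Rbar_lt_le_trans with 1; [exact Hx|].
apply (proj1 (CV_radius_bounded (pl_coef a (S s)))).
exists 1. intros n. rewrite pow1, Rmult_1_r. apply pl_coef_bound, H.
Qed.

Lemma pl_derive a s x : (forall n, Rabs (a n) <= INR (S n)) -> Rabs x < 1 ->
  is_derive (pl a (S s)) x (pl_quot a s x).
Proof.
intros H Hx.
apply (is_derive_ext (PSeries (PS_incr_1 (pl_coef a (S s))))).
- intros t. apply PSeries_incr_1.
- replace (pl_quot a s x) with (PSeries (PS_derive (PS_incr_1 (pl_coef a (S s)))) x).
  + apply is_derive_PSeries. rewrite CV_radius_incr_1. apply pl_coef_radius; auto.
  + apply PSeries_ext. intros n. unfold PS_derive, PS_incr_1. rewrite <- pl_coef_S. reflexivity.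
Qed.

Lemma pl_quot_pl a s x : x <> 0 -> pl_quot a s x = pl a s x / x.
Proof. intros Hx. unfold pl. field. exact Hx. Qed.

Lemma pl_derive' a s x d : (forall n, Rabs (a n) <= INR (S n)) -> Rabs x < 1 -> x <> 0 ->
  pl a s x = d -> is_derive (pl a (S s)) x (d / x).
Proof. intros H Hx H0 <-. rewrite <- pl_quot_pl by auto. apply pl_derive; auto. Qed.

(** The coefficients are absolutely summable, so Tannery's theorem covers the endpoints 1 and -1 as
    well. *)
Lemma pl_quot_lim a s (phi : nat -> R) (y : R) : ex_series (fun n => Rabs (pl_coef a s n)) ->
  (forall n, Rabs (phi n) <= 1) -> is_lim_seq phi y ->
  is_lim_seq (fun n => pl_quot a s (phi n)) (pl_quot a s y).
Proof.
intros Hs Hp Hy.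
apply (tannery eventually (fun k n => pl_coef a s k * phi n ^ k) (fun k => pl_coef a s k * y ^ k) _ Hs).
- exists O. intros n _ k. rewrite Rabs_mult.
  rewrite <- (Rmult_1_r (Rabs (pl_coef a s k))) at 2. apply Rmult_le_compat_l; [apply Rabs_pos|].
  rewrite <- RPow_abs. rewrite <- (pow1 k). apply pow_incr. split; [apply Rabs_pos|apply Hp].
- intros k. apply (is_lim_seq_scal_l (fun n => phi n ^ k) (pl_coef a s k) (y ^ k)).
  induction k; [apply is_lim_seq_const|].
  apply (is_lim_seq_mult' phi (fun n => phi n ^ k) y (y ^ k)); auto.
Qed.

Lemma pl_lim a s (phi : nat -> R) (y : R) : ex_series (fun n => Rabs (pl_coef a s n)) ->
  (forall n, Rabs (phi n) <= 1) -> is_lim_seq phi y ->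
  is_lim_seq (fun n => pl a s (phi n)) (pl a s y).
Proof.
intros Hs Hp Hy. apply (is_lim_seq_mult' phi _ y); auto. apply pl_quot_lim; auto.
Qed.

Definition one (n : nat) : R := 1.

Lemma one_bound n : Rabs (one n) <= INR (S n).
Proof. unfold one. rewrite Rabs_R1, S_INR. pose proof (pos_INR n); lra. Qed.

Lemma harm_bound n : Rabs (harm 1 n) <= INR (S n).
Proof.
rewrite Rabs_pos_eq by apply harm_pos. induction n; [simpl; lra|].
rewrite harm_1_S, (S_INR (S n)).
assert (/ INR (S n) <= 1).
{ rewrite <- Rinv_1. apply Rinv_le_contravar; [lra|]. rewrite S_INR. pose proof (pos_INR n); lra. }
lra.
Qed.

Lemma zero_derive_const (G D : R -> R) a b : a < b ->
  (forall x, a < x < b -> is_derive G x (D x)) -> (forall x, a < x < b -> D x = 0) ->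
  forall x y, a < x < b -> a < y < b -> G x = G y.
Proof.
intros Hab HG HD.
assert (P : forall x y, a < x < b -> a < y < b -> x < y -> G x = G y).
{ intros x y Hx Hy Hxy. apply (eq_is_derive G x y); auto.
  intros t Ht. change (is_derive G t 0). rewrite <- (HD t) by lra. apply HG; lra. }
intros x y Hx Hy. destruct (Rtotal_order x y) as [H|[->|H]]; auto. symmetry; auto.
Qed.

Lemma pl_0 a s : pl a s 0 = 0.
Proof. unfold pl; ring. Qed.

Lemma pl_one_1 x : Rabs x < 1 -> pl one 1 x = - ln (1 - x).
Proof.
intros Hx. apply Rabs_def2 in Hx.
assert (E : pl one 1 x + ln (1 - x) = pl one 1 0 + ln (1 - 0)).
{ apply (zero_derive_const (fun t => pl one 1 t + ln (1 - t)) (fun t => pl_quot one 0 t - / (1 - t)) (-1) 1); try lra.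
  - intros t Ht. apply (is_derive_plus (pl one 1)).
    + apply pl_derive; [apply one_bound|]. apply Rabs_def1; lra.
    + auto_derive; [lra|]. field. lra.
  - intros t Ht. unfold pl_quot, PSeries.
    rewrite (Series_ext _ (fun n => t ^ n)).
    + rewrite Series_geom by (apply Rabs_def1; lra). ring.
    + intros n. unfold pl_coef, one. rewrite pow_O. field. }
rewrite pl_0, Rminus_0_r, ln_1 in E. lra.
Qed.

Lemma ex_pl_quot a s x : (forall n, Rabs (a n) <= INR (S n)) -> Rabs x < 1 ->
  ex_series (fun n => pl_coef a s n * x ^ n).
Proof.
intros H Hx.
apply (ex_series_ext (fun n => PS_derive (PS_incr_1 (pl_coef a (S s))) n * x ^ n)).
- intros n. unfold PS_derive, PS_incr_1. rewrite <- pl_coef_S. reflexivity.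
- apply (ex_pseries_R (PS_derive (PS_incr_1 (pl_coef a (S s)))) x).
  apply ex_pseries_derive. rewrite CV_radius_incr_1. apply pl_coef_radius; auto.
Qed.

(** H_{n+1} = H_n + 1/(n+1) becomes A = x A + [pl one 1 x] for the generating function A. *)
Lemma pl_quot_harm_0 x : Rabs x < 1 -> pl_quot (harm 1) 0 x = - ln (1 - x) / (1 - x).
Proof.
intros Hx. 
assert (E : pl_quot (harm 1) 0 x = x * pl_quot (harm 1) 0 x + pl one 1 x).
{ unfold pl, pl_quot at 1, PSeries. rewrite Series_incr_1 by (apply ex_pl_quot; auto; apply harm_bound).
  rewrite <- Rmult_plus_distr_l. unfold pl_quot, PSeries.
  rewrite <- Series_plus by (apply ex_pl_quot; auto; [apply harm_bound || apply one_bound]).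
  rewrite <- Series_scal_l. unfold pl_coef at 1. simpl (harm 1 0). unfold Rdiv at 1.
  rewrite !Rmult_0_l, Rplus_0_l. apply Series_ext. intros n.
  unfold pl_coef, one. rewrite harm_1_S, !pow_O, pow_1. pose proof (INR_Sn_pos n).
  change (x ^ S n) with (x * x ^ n). field. lra. }
rewrite pl_one_1 in E by auto. apply Rabs_def2 in Hx.
apply Rmult_eq_reg_r with (1 - x); [|lra].
replace (- ln (1 - x) / (1 - x) * (1 - x)) with (- ln (1 - x)) by (field; lra). lra.
Qed.

Lemma pl_harm_1 x : Rabs x < 1 -> pl (harm 1) 1 x = ln (1 - x) ^ 2 / 2.
Proof.
intros Hx. apply Rabs_def2 in Hx.
assert (E : pl (harm 1) 1 x - ln (1 - x) ^ 2 / 2 = pl (harm 1) 1 0 - ln (1 - 0) ^ 2 / 2).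
{ apply (zero_derive_const (fun t => pl (harm 1) 1 t - ln (1 - t) ^ 2 / 2)
    (fun t => pl_quot (harm 1) 0 t - - ln (1 - t) / (1 - t)) (-1) 1); try lra.
  - intros t Ht. apply (is_derive_minus (pl (harm 1) 1)).
    + apply pl_derive; [apply harm_bound|]. apply Rabs_def1; lra.
    + auto_derive; [lra|]. unfold Rminus. field. lra.
  - intros t Ht. rewrite pl_quot_harm_0 by (apply Rabs_def1; lra). ring. }
rewrite pl_0, Rminus_0_r, ln_1 in E. lra.
Qed.

(** Besides Li_2, Li_3 and Li_4, these are the Nielsen polylogarithms S_{1,2} ([pl_harm2]) and
    S_{2,2} ([pl_harm3]). As separate names they are atoms for [auto_derive], whose side conditions
    and [Derive] terms the next section discharges. *)
Definition Li2f := pl one 2.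
Definition Li3f := pl one 3.
Definition Li4f := pl one 4.
Definition pl_harm2 := pl (harm 1) 2.
Definition pl_harm3 := pl (harm 1) 3.

Section Derivatives.
Variable x : R.
Hypotheses (Hx : Rabs x < 1) (H0 : x <> 0).

Lemma Li2f_derive : is_derive Li2f x (- ln (1 - x) / x).
Proof. apply pl_derive'; auto using one_bound, pl_one_1. Qed.
Lemma Li3f_derive : is_derive Li3f x (Li2f x / x).
Proof. apply pl_derive'; auto using one_bound. Qed.
Lemma Li4f_derive : is_derive Li4f x (Li3f x / x).
Proof. apply pl_derive'; auto using one_bound. Qed.
Lemma pl_harm2_derive : is_derive pl_harm2 x (ln (1 - x) ^ 2 / 2 / x).
Proof. apply pl_derive'; auto using harm_bound, pl_harm_1. Qed.
Lemma pl_harm3_derive : is_derive pl_harm3 x (pl_harm2 x / x).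
Proof. apply pl_derive'; auto using harm_bound. Qed.

Lemma Li2f_ex : ex_derive Li2f x. Proof. eexists; apply Li2f_derive. Qed.
Lemma Li3f_ex : ex_derive Li3f x. Proof. eexists; apply Li3f_derive. Qed.
Lemma Li4f_ex : ex_derive Li4f x. Proof. eexists; apply Li4f_derive. Qed.
Lemma pl_harm2_ex : ex_derive pl_harm2 x. Proof. eexists; apply pl_harm2_derive. Qed.
Lemma pl_harm3_ex : ex_derive pl_harm3 x. Proof. eexists; apply pl_harm3_derive. Qed.

Lemma Li2f_D : Derive Li2f x = - ln (1 - x) / x.
Proof. apply is_derive_unique, Li2f_derive. Qed.
Lemma Li3f_D : Derive Li3f x = Li2f x / x.
Proof. apply is_derive_unique, Li3f_derive. Qed.
Lemma Li4f_D : Derive Li4f x = Li3f x / x.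
Proof. apply is_derive_unique, Li4f_derive. Qed.
Lemma pl_harm2_D : Derive pl_harm2 x = ln (1 - x) ^ 2 / 2 / x.
Proof. apply is_derive_unique, pl_harm2_derive. Qed.
Lemma pl_harm3_D : Derive pl_harm3 x = pl_harm2 x / x.
Proof. apply is_derive_unique, pl_harm3_derive. Qed.
End Derivatives.

Lemma ex_pl_coef_one s : ex_series (half_pow s) -> ex_series (fun n => Rabs (pl_coef one s n)).
Proof.
intros H. apply (ex_series_ext (shift_pow 1 s)); [|apply ex_shift_pow; [lra|exact H]].
intros n. unfold pl_coef, one. rewrite shift_pow_one. unfold Rdiv. rewrite Rmult_1_l, Rabs_pos_eq; auto.
apply Rlt_le, Rinv_0_lt_compat, pow_lt, INR_Sn_pos.
Qed.

Lemma pl_coef_harm_abs s n : Rabs (pl_coef (harm 1) s n) = harm 1 n * shift_pow 1 s n.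
Proof.
unfold pl_coef. rewrite shift_pow_one. rewrite Rabs_pos_eq; [reflexivity|].
apply Rmult_le_pos; [apply harm_pos|]. apply Rlt_le, Rinv_0_lt_compat, pow_lt, INR_Sn_pos.
Qed.

Lemma ex_pl_coef_harm3 : ex_series (fun n => Rabs (pl_coef (harm 1) 3 n)).
Proof.
apply (ex_series_ext (fun l => harm 1 l * shift_pow 1 3 l)); [|eexists; apply zeta31].
intros n. rewrite pl_coef_harm_abs. reflexivity.
Qed.

Lemma ex_pl_coef_harm2 : ex_series (fun n => Rabs (pl_coef (harm 1) 2 n)).
Proof.
apply (ex_series_squeeze _ (fun m => (2 + 2 * rsum (half_pow 1) m) ^ 2 * half_pow 2 m)); [|apply ex_rsum_sq].
intros n. rewrite pl_coef_harm_abs. pose proof (harm_pos 1 n). pose proof (harm_le_half n).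
pose proof (shift_pow_pos 1 2 n ltac:(lra)). split; [nra|].
apply Rmult_le_compat; try lra; [nra|].
unfold shift_pow, half_pow, half_odd. pose proof (pos_INR n). apply Rinv_le_contravar; [apply pow_lt; lra|].
apply pow_incr; lra.
Qed.

(** * Limits at the ends of (0,1), and constancy of functions with zero derivative *)

Definition null_seq (n : nat) : R := / (INR n + 2).

Lemma null_seq_bounds n : 0 < null_seq n <= 1/2.
Proof.
unfold null_seq. pose proof (pos_INR n). split; [apply Rinv_0_lt_compat; lra|].
replace (1/2) with (/2) by lra. apply Rinv_le_contravar; lra.
Qed.

Lemma null_seq_lim : is_lim_seq null_seq 0.
Proof.
apply (is_lim_seq_inv _ p_infty); [|discriminate].
apply (is_lim_seq_plus _ _ p_infty 2 p_infty);
 [apply is_lim_seq_INR|apply is_lim_seq_const|reflexivity].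
Qed.

Lemma one_minus_null_seq_lim : is_lim_seq (fun n => 1 - null_seq n) 1.
Proof.
replace (Finite 1) with (Finite (1 - 0)) by (f_equal; ring).
apply is_lim_seq_minus'; [apply is_lim_seq_const|apply null_seq_lim].
Qed.

Lemma lim_abs_squeeze (u v : nat -> R) :
  (forall n, Rabs (u n) <= v n) -> is_lim_seq v 0 -> is_lim_seq u 0.
Proof.
intros H Hv. apply is_lim_seq_abs_0.
apply (is_lim_seq_le_le (fun _ => 0) _ v); auto using is_lim_seq_const.
intros n; split; auto using Rabs_pos.
Qed.

(** ln y <= y - 1 is applied at y = 1 / sqrt x. *)
Lemma x_ln_x_bound x : 0 < x <= 1 -> Rabs (x * ln x) <= 2 * sqrt x.
Proof.
intros Hx. assert (Hs : 0 < sqrt x) by (apply sqrt_lt_R0; lra).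
assert (E : sqrt x * sqrt x = x) by (apply sqrt_sqrt; lra).
assert (L : ln x = 2 * ln (sqrt x)).
{ rewrite <- E at 1. rewrite ln_mult by auto. ring. }
assert (B : - ln (sqrt x) <= / sqrt x).
{ rewrite <- ln_Rinv by auto. pose proof (ln_le_sub1 (/ sqrt x) ltac:(apply Rinv_0_lt_compat; auto)). lra. }
assert (N : ln x <= 0) by (rewrite <- ln_1; apply ln_le; lra).
rewrite Rabs_mult, (Rabs_pos_eq x), Rabs_left1 by lra.
apply Rle_trans with (x * (2 * / sqrt x)).
- apply Rmult_le_compat_l; lra.
- right. rewrite <- E at 1. field. lra.
Qed.

Lemma null_seq_ln_lim : is_lim_seq (fun n => null_seq n * ln (null_seq n)) 0.
Proof.
apply (lim_abs_squeeze _ (fun n => 2 * sqrt (null_seq n))).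
- intros n. apply x_ln_x_bound. pose proof (null_seq_bounds n); lra.
- replace 0 with (2 * 0) by ring. apply (is_lim_seq_scal_l _ 2 0).
  rewrite <- sqrt_0. apply is_lim_seq_continuous; [apply continuity_pt_filterlim, continuous_sqrt|apply null_seq_lim].
Qed.

Lemma ln_continuity y : 0 < y -> continuity_pt ln y.
Proof. intros Hy. apply derivable_continuous_pt. exists (/ y). apply derivable_pt_lim_ln. auto. Qed.

Lemma ln_lim (u : nat -> R) (y : R) : 0 < y -> is_lim_seq u y -> is_lim_seq (fun n => ln (u n)) (ln y).
Proof. intros Hy Hu. apply is_lim_seq_continuous; auto using ln_continuity. Qed.

Lemma ln1p_abs x : 0 < x <= 1/2 -> Rabs (ln (1 + x)) <= 2 * x.
Proof.
intros Hx. pose proof (ln_le_sub1 (1 + x)).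
assert (0 <= ln (1 + x)) by (rewrite <- ln_1; apply ln_le; lra).
rewrite Rabs_pos_eq; lra.
Qed.

Lemma ln1m_abs x : 0 < x <= 1/2 -> Rabs (ln (1 - x)) <= 2 * x.
Proof.
intros Hx. pose proof (ln_step (1 - x) ltac:(lra)) as [_ B].
replace (1 - x + 1) with (2 - x) in B by ring.
assert (B2 : - ln (1 - x) <= 2 * x).
{ rewrite <- ln_Rinv by lra. eapply Rle_trans; [apply ln_le_sub1, Rinv_0_lt_compat; lra|].
  apply Rmult_le_reg_r with (1 - x); [lra|].
  replace ((/ (1 - x) - 1) * (1 - x)) with x by (field; lra). nra. }
assert (ln (1 - x) <= 0) by (rewrite <- ln_1; apply ln_le; lra).
rewrite Rabs_left1; lra.
Qed.

Lemma small_ln_lim (f : R -> R) : (forall x, 0 < x <= 1/2 -> Rabs (f x) <= 2 * x) ->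
  is_lim_seq (fun n => f (null_seq n)) 0 /\ is_lim_seq (fun n => f (null_seq n) * ln (null_seq n)) 0.
Proof.
intros H. split.
- apply (lim_abs_squeeze _ (fun n => 2 * null_seq n)).
  + intros n. apply H, null_seq_bounds.
  + replace 0 with (2 * 0) by ring. apply (is_lim_seq_scal_l _ 2 0), null_seq_lim.
- apply (lim_abs_squeeze _ (fun n => 2 * Rabs (null_seq n * ln (null_seq n)))).
  + intros n. pose proof (null_seq_bounds n) as Hx. rewrite !Rabs_mult, (Rabs_pos_eq (null_seq n)) by lra.
    rewrite <- Rmult_assoc. apply Rmult_le_compat_r; [apply Rabs_pos|apply H; lra].
  + replace 0 with (2 * 0) by ring. apply (is_lim_seq_scal_l _ 2 0).
    rewrite <- Rabs_R0. apply (is_lim_seq_abs _ 0), null_seq_ln_lim.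
Qed.

(** A functional equation on (0,1) is proved by a vanishing derivative, with its constant read off
    at 0; [const_right] then evaluates it at 1. *)
Lemma const_left (G D : R -> R) (l x : R) :
  (forall x, 0 < x < 1 -> is_derive G x (D x)) -> (forall x, 0 < x < 1 -> D x = 0) ->
  is_lim_seq (fun n => G (null_seq n)) l -> 0 < x < 1 -> G x = l.
Proof.
intros HG HD HL Hx.
apply (is_lim_seq_ext _ (fun _ => G x)) in HL.
- apply is_lim_seq_unique in HL. rewrite Lim_seq_const in HL. injection HL; auto.
- intros n. pose proof (null_seq_bounds n). apply (zero_derive_const G D 0 1); auto; lra.
Qed.

Lemma const_right (G : R -> R) (l l' : R) :
  (forall x, 0 < x < 1 -> G x = l) -> is_lim_seq (fun n => G (1 - null_seq n)) l' -> l = l'.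
Proof.
intros HG HL. apply (is_lim_seq_ext _ (fun _ => l)) in HL.
- apply is_lim_seq_unique in HL. rewrite Lim_seq_const in HL. injection HL; auto.
- intros n. pose proof (null_seq_bounds n). apply HG; lra.
Qed.

Lemma Li2f_1 : Li2f 1 = zeta 2.
Proof.
unfold Li2f, pl, pl_quot. rewrite PSeries_1, Rmult_1_l. apply Series_ext. intros n.
unfold pl_coef, one, Rdiv. ring.
Qed.

Lemma Li3f_1 : Li3f 1 = zeta 3.
Proof.
unfold Li3f, pl, pl_quot. rewrite PSeries_1, Rmult_1_l. apply Series_ext. intros n.
unfold pl_coef, one, Rdiv. ring.
Qed.

Lemma Li4f_1 : Li4f 1 = zeta 4.
Proof.
unfold Li4f, pl, pl_quot. rewrite PSeries_1, Rmult_1_l. apply Series_ext. intros n.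
unfold pl_coef, one, Rdiv. ring.
Qed.

Lemma pl_harm3_at_1 : pl_harm3 1 = zeta 4 / 4.
Proof.
unfold pl_harm3, pl, pl_quot. rewrite PSeries_1, Rmult_1_l. rewrite <- (is_series_unique _ _ zeta31).
apply Series_ext. intros n. unfold pl_coef. rewrite shift_pow_one. reflexivity.
Qed.

Lemma null_seq_abs n : Rabs (null_seq n) <= 1.
Proof. pose proof (null_seq_bounds n). apply Rabs_le; lra. Qed.
Lemma null_seq_abs_opp n : Rabs (- null_seq n) <= 1.
Proof. pose proof (null_seq_bounds n). apply Rabs_le; lra. Qed.
Lemma null_seq_abs_1m n : Rabs (1 - null_seq n) <= 1.
Proof. pose proof (null_seq_bounds n). apply Rabs_le; lra. Qed.
Lemma null_seq_abs_opp_1m n : Rabs (- (1 - null_seq n)) <= 1.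
Proof. pose proof (null_seq_bounds n). apply Rabs_le; lra. Qed.

Lemma lim_opp_0 (u : nat -> R) : is_lim_seq u 0 -> is_lim_seq (fun n => - u n) 0.
Proof. intros H. rewrite <- Ropp_0. apply (is_lim_seq_opp u 0), H. Qed.

(** * Functional equations of polylogarithms and values at 1/2 and -1 *)

Lemma Li2_reflection x : 0 < x < 1 -> Li2f x + Li2f (1 - x) + ln x * ln (1 - x) = zeta 2.
Proof.
intros Hx.
apply (const_left (fun x => Li2f x + Li2f (1 - x) + ln x * ln (1 - x))
 (fun x => - ln (1 - x) / x - (- ln x / (1 - x)) + (ln (1 - x) / x - ln x / (1 - x)))); auto.
- intros t Ht. auto_derive.
  + repeat split; try lra; apply Li2f_ex; try (apply Rabs_def1; lra); lra.
  + change (Derive (fun x => Li2f x)) with (Derive Li2f).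
    rewrite !Li2f_D by (try (apply Rabs_def1; lra); lra).
    replace (1 - (1 + - t)) with t by ring. unfold Rminus. field. lra.
- intros t Ht. unfold Rdiv. ring.
- replace (zeta 2) with (pl one 2 0 + pl one 2 1 + 0).
  2: { change (pl one 2 1) with (Li2f 1). rewrite pl_0, Li2f_1. ring. }
  apply (is_lim_seq_plus' _ _ (pl one 2 0 + pl one 2 1) 0).
  + apply is_lim_seq_plus'; apply pl_lim; auto using null_seq_abs, null_seq_abs_1m, null_seq_lim, one_minus_null_seq_lim;
    apply ex_pl_coef_one, descent_one.
  + eapply is_lim_seq_ext; [intros; apply Rmult_comm|].
    apply (small_ln_lim (fun x => ln (1 - x)) ln1m_abs).
Qed.

Lemma Li2_landen x : 0 < x < 1 -> Li2f (- x) = - Li2f (x / (1 + x)) - ln (1 + x) ^ 2 / 2.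
Proof.
intros Hx.
enough (E : Li2f (- x) + Li2f (x / (1 + x)) + ln (1 + x) ^ 2 / 2 = 0) by lra.
apply (const_left (fun x => Li2f (- x) + Li2f (x / (1 + x)) + ln (1 + x) ^ 2 / 2)
 (fun x => - ln (1 + x) / x + ln (1 + x) / (x * (1 + x)) + ln (1 + x) / (1 + x))); auto.
- intros t Ht.
  assert (Q : 0 < t * / (1 + t) < 1).
  { split; [apply Rdiv_lt_0_compat; lra|]. apply Rmult_lt_reg_r with (1 + t); [lra|].
    rewrite Rmult_assoc, Rinv_l; lra. }
  auto_derive.
  + repeat split; try lra; apply Li2f_ex; try (apply Rabs_def1; lra); lra.
  + change (Derive (fun x => Li2f x)) with (Derive Li2f).
    rewrite !Li2f_D by (try (apply Rabs_def1; lra); lra).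
    replace (1 - - t) with (1 + t) by ring.
    replace (1 - t * / (1 + t)) with (/ (1 + t)) by (field; lra).
    rewrite ln_Rinv by lra. field. lra.
- intros t Ht. field. lra.
- replace 0 with (pl one 2 (- 0) + pl one 2 (0 / (1 + 0)) + ln (1 + 0) ^ 2 / 2).
  2: { replace (0 / (1 + 0)) with 0 by field. replace (1 + 0) with 1 by ring.
       rewrite Ropp_0, pl_0, ln_1. field. }
  assert (L1 : is_lim_seq (fun n => 1 + null_seq n) (1 + 0)) by (apply is_lim_seq_plus'; [apply is_lim_seq_const|apply null_seq_lim]).
  apply (is_lim_seq_plus' _ _ (pl one 2 (- 0) + pl one 2 (0 / (1 + 0)))).
  + apply is_lim_seq_plus'; apply pl_lim; try (apply ex_pl_coef_one, descent_one); auto using null_seq_abs_opp.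
    * rewrite Ropp_0. apply lim_opp_0, null_seq_lim.
    * intros n. pose proof (null_seq_bounds n). apply Rabs_le.
      assert (0 < null_seq n / (1 + null_seq n)) by (apply Rdiv_lt_0_compat; lra).
      split; [lra|]. apply Rmult_le_reg_r with (1 + null_seq n); [lra|].
      unfold Rdiv. rewrite Rmult_assoc, Rinv_l; lra.
    * apply is_lim_seq_div'; [apply null_seq_lim|exact L1|lra].
  + apply is_lim_seq_div'; [|apply is_lim_seq_const|lra].
    simpl pow. apply is_lim_seq_mult'; [|apply is_lim_seq_mult'; [|apply is_lim_seq_const]];
    apply ln_lim; auto; lra.
Qed.

(** Recursion on the shape of the limit value, which must therefore be written with the same
    operations as the sequence. Products with [ln (null_seq _)] are passed whole to [tac], since
    that logarithm has no finite limit. *)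
Ltac lims tac := lazymatch goal with
  | |- is_lim_seq (fun _ => ?c) _ => apply is_lim_seq_const
  | |- is_lim_seq (fun n => @?f n + @?h n) (Finite (?a + ?b)) =>
      apply (is_lim_seq_plus' f h a b); lims tac
  | |- is_lim_seq (fun n => @?f n - @?h n) (Finite (?a - ?b)) =>
      apply (is_lim_seq_minus' f h a b); lims tac
  | |- is_lim_seq (fun n => ln _ * ln (null_seq _)) _ => tac
  | |- is_lim_seq (fun n => null_seq _ * ln (null_seq _)) _ => tac
  | |- is_lim_seq (fun n => @?f n * @?h n) (Finite (?a * ?b)) =>
      apply (is_lim_seq_mult' f h a b); lims tac
  | |- is_lim_seq (fun n => @?f n / ?c) (Finite (?a / ?c)) =>
      apply (is_lim_seq_div' f (fun _ => c) a c); [lims tac|apply is_lim_seq_const|lra]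
  | _ => tac
  end.

Lemma inv_1p_bounds u : 0 < u < 1 -> 0 < / (1 + u) < 1.
Proof.
intros Hu. split; [apply Rinv_0_lt_compat; lra|].
rewrite <- Rinv_1. apply Rinv_lt_contravar; lra.
Qed.

Lemma frac_1p_bounds u : 0 < u < 1 -> 0 < u / (1 + u) < 1.
Proof.
intros Hu. replace (u / (1 + u)) with (1 - / (1 + u)) by (field; lra).
pose proof (inv_1p_bounds u Hu). lra.
Qed.

(** The derivative contains only dilogarithms and logarithms; it vanishes by [Li2_landen] at x and
    [Li2_reflection] at 1/(1+x). *)
Lemma Li3_landen x : 0 < x < 1 ->
  Li3f (/ (1 + x)) + Li3f (x / (1 + x)) + Li3f (- x) + ln (1 + x) ^ 3 / 6
  + zeta 2 * ln (1 + x) + ln (1 + x) ^ 2 * (ln x - ln (1 + x)) / 2 = zeta 3.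
Proof.
intros Hx.
apply (const_left (fun x => Li3f (/ (1 + x)) + Li3f (x / (1 + x)) + Li3f (- x) + ln (1 + x) ^ 3 / 6
  + zeta 2 * ln (1 + x) + ln (1 + x) ^ 2 * (ln x - ln (1 + x)) / 2)
 (fun x => - Li2f (/ (1 + x)) / (1 + x) + Li2f (x / (1 + x)) / (x * (1 + x)) + Li2f (- x) / x
   + ln (1 + x) ^ 2 / 2 / (1 + x) + zeta 2 / (1 + x) + ln (1 + x) * (ln x - ln (1 + x)) / (1 + x)
   + ln (1 + x) ^ 2 / 2 * (/ x - / (1 + x)))); auto.
- intros t Ht. pose proof (inv_1p_bounds t Ht). pose proof (frac_1p_bounds t Ht) as Q. unfold Rdiv in Q.
  auto_derive.
  + repeat split; try lra; apply Li3f_ex; try (apply Rabs_def1; lra); lra.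
  + change (Derive (fun x => Li3f x)) with (Derive Li3f).
    rewrite !Li3f_D by (try (apply Rabs_def1; lra); lra). unfold Rdiv. field. lra.
- intros t Ht. pose proof (inv_1p_bounds t Ht) as Y.
  rewrite Li2_landen by auto.
  pose proof (Li2_reflection _ Y) as R.
  replace (1 - / (1 + t)) with (t / (1 + t)) in R by (field; lra).
  rewrite ln_Rinv, ln_div in R by lra.
  replace (zeta 2) with (Li2f (/ (1 + t)) + Li2f (t / (1 + t)) + - ln (1 + t) * (ln t - ln (1 + t))) by lra.
  field. lra.
- assert (L1 : is_lim_seq (fun n => 1 + null_seq n) 1).
  { replace (Finite 1) with (Finite (1 + 0)) by (f_equal; ring).
    apply is_lim_seq_plus'; [apply is_lim_seq_const|apply null_seq_lim]. }
  destruct (small_ln_lim (fun x => ln (1 + x)) ln1p_abs) as [S1 S2].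
  pose proof ex_pl_coef_one 3 (proj1 descent_harm1) as E3.
  (* The vanishing terms are spelled out so that [lims] can match the sequence below, in which every
     divergent ln x is paired with a factor ln (1 + x). *)
  replace (zeta 3) with (Li3f (/ 1) + Li3f (0 / 1) + Li3f (- 0) + 0 * (0 * 0) / 6
     + zeta 2 * 0 + 0 * (0 - 0 * 0) / 2).
  2: { replace (0 / 1) with 0 by field. rewrite Rinv_1, Li3f_1, Ropp_0. unfold Li3f; rewrite pl_0. field. }
  apply (is_lim_seq_ext (fun n => Li3f (/ (1 + null_seq n)) + Li3f (null_seq n / (1 + null_seq n)) + Li3f (- null_seq n)
    + ln (1 + null_seq n) * (ln (1 + null_seq n) * ln (1 + null_seq n)) / 6 + zeta 2 * ln (1 + null_seq n)
    + ln (1 + null_seq n) * (ln (1 + null_seq n) * ln (null_seq n) - ln (1 + null_seq n) * ln (1 + null_seq n)) / 2)).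
  { intros n. unfold Rdiv. ring. }
  assert (Ly : is_lim_seq (fun n => / (1 + null_seq n)) (/ 1)).
  { apply (is_lim_seq_inv _ 1); [exact L1|]. intros E; injection E; lra. }
  assert (Lq : is_lim_seq (fun n => null_seq n / (1 + null_seq n)) (0 / 1)).
  { apply is_lim_seq_div'; [apply null_seq_lim|exact L1|lra]. }
  assert (By : forall n, Rabs (/ (1 + null_seq n)) <= 1).
  { intros n. pose proof (null_seq_bounds n). pose proof (inv_1p_bounds (null_seq n) ltac:(lra)). apply Rabs_le; lra. }
  assert (Bq : forall n, Rabs (null_seq n / (1 + null_seq n)) <= 1).
  { intros n. pose proof (null_seq_bounds n). pose proof (frac_1p_bounds (null_seq n) ltac:(lra)). apply Rabs_le; lra. }
  assert (Lm : is_lim_seq (fun n => - null_seq n) (- 0)) by (rewrite Ropp_0; apply lim_opp_0, null_seq_lim).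
  lims ltac:(first [ exact S2 | exact S1 | apply pl_lim; solve [auto using null_seq_abs_opp] ]).
Qed.

Lemma Li2_half : Li2f (1/2) = zeta 2 / 2 - ln 2 ^ 2 / 2.
Proof.
pose proof (Li2_reflection (1/2) ltac:(lra)) as H.
replace (1 - 1/2) with (1/2) in H by lra.
replace (ln (1/2)) with (- ln 2) in H by (rewrite <- ln_Rinv by lra; f_equal; lra). lra.
Qed.

Lemma Li3_m1 : Li3f (-1) = -3/4 * zeta 3.
Proof.
assert (E : zeta 3 = / 8 * half_zeta 3 + / 8 * zeta 3) by (rewrite half_zeta_zeta by apply descent_harm1; field).
unfold Li3f, pl, pl_quot, PSeries.
replace (-3/4 * zeta 3) with (-1 * (/ 8 * half_zeta 3 + - / 8 * zeta 3)) by lra.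
f_equal. pose proof (zeta_series 3 (proj1 descent_harm1)) as Z.
apply Series_even_odd.
- apply (ex_series_dom _ (shift_pow 1 3)); [|eexists; exact Z].
  intros n. unfold pl_coef, one. rewrite Rabs_mult, pow_m1_abs, Rmult_1_r, shift_pow_one.
  unfold Rdiv. rewrite Rmult_1_l, Rabs_pos_eq; [lra|].
  apply Rlt_le, Rinv_0_lt_compat, pow_lt, INR_Sn_pos.
- eapply is_series_ext_R; [|apply is_series_scalR, half_zeta3_series].
  intros n; cbv beta. rewrite pow_m1_even. unfold pl_coef, one, half_pow, half_odd.
  rewrite S_INR, mult_INR. simpl (INR 2). pose proof (pos_INR n). field. lra.
- eapply is_series_ext_R; [|apply is_series_scalR, Z].
  intros n; cbv beta. rewrite pow_m1_odd. unfold pl_coef, one, shift_pow.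
  rewrite S_INR, plus_INR, mult_INR. simpl (INR 2). simpl (INR 1). pose proof (pos_INR n). field. lra.
Qed.

Lemma opp_1m_lim : is_lim_seq (fun n => - (1 - null_seq n)) (-1).
Proof. replace (-1) with (- (1)) by ring. apply (is_lim_seq_opp _ 1), one_minus_null_seq_lim. Qed.

Lemma one_p_1m_lim : is_lim_seq (fun n => 1 + (1 - null_seq n)) 2.
Proof.
replace (Finite 2) with (Finite (1 + 1)) by (f_equal; ring).
apply is_lim_seq_plus'; [apply is_lim_seq_const|apply one_minus_null_seq_lim].
Qed.

Lemma inv_1p_1m_lim : is_lim_seq (fun n => / (1 + (1 - null_seq n))) (1/2).
Proof.
replace (Finite (1/2)) with (Rbar_inv 2) by (simpl; f_equal; lra).
apply (is_lim_seq_inv _ 2); [apply one_p_1m_lim|]. intros E; injection E; lra.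
Qed.

Lemma inv_1p_1m_abs n : Rabs (/ (1 + (1 - null_seq n))) <= 1.
Proof.
pose proof (null_seq_bounds n). pose proof (inv_1p_bounds (1 - null_seq n) ltac:(lra)). apply Rabs_le; lra.
Qed.

(** As x tends to 1, both 1/(1+x) and x/(1+x) tend to 1/2, so [Li3_landen] becomes a linear equation
    for this value. *)
Lemma Li3_half : Li3f (1/2) = 7/8 * zeta 3 - zeta 2 * ln 2 / 2 + ln 2 ^ 3 / 6.
Proof.
pose proof ex_pl_coef_one 3 (proj1 descent_harm1) as E3.
assert (E : zeta 3 = Li3f (1/2) + Li3f (1/2) + Li3f (-1) + ln 2 * (ln 2 * ln 2) / 6 + zeta 2 * ln 2
   + ln 2 * ln 2 * (ln 1 - ln 2) / 2).
{ apply (const_right _ _ _ Li3_landen).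
  apply (is_lim_seq_ext (fun n => Li3f (/ (1 + (1 - null_seq n))) + Li3f ((1 - null_seq n) / (1 + (1 - null_seq n))) + Li3f (- (1 - null_seq n))
    + ln (1 + (1 - null_seq n)) * (ln (1 + (1 - null_seq n)) * ln (1 + (1 - null_seq n))) / 6 + zeta 2 * ln (1 + (1 - null_seq n))
    + ln (1 + (1 - null_seq n)) * ln (1 + (1 - null_seq n)) * (ln (1 - null_seq n) - ln (1 + (1 - null_seq n))) / 2)).
  { intros n. unfold Rdiv. ring. }
  assert (L2 : is_lim_seq (fun n => ln (1 + (1 - null_seq n))) (ln 2)) by (apply ln_lim; [lra|apply one_p_1m_lim]).
  assert (L3 : is_lim_seq (fun n => ln (1 - null_seq n)) (ln 1)) by (apply ln_lim; [lra|apply one_minus_null_seq_lim]).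
  assert (Lq : is_lim_seq (fun n => (1 - null_seq n) / (1 + (1 - null_seq n))) (1 / 2)).
  { apply is_lim_seq_div'; [apply one_minus_null_seq_lim|apply one_p_1m_lim|lra]. }
  assert (Bq : forall n, Rabs ((1 - null_seq n) / (1 + (1 - null_seq n))) <= 1).
  { intros n. pose proof (null_seq_bounds n). pose proof (frac_1p_bounds (1 - null_seq n) ltac:(lra)). apply Rabs_le; lra. }
  lims ltac:(first [ exact L2 | exact L3
   | apply pl_lim; solve [auto using null_seq_abs_opp_1m, opp_1m_lim, inv_1p_1m_abs, inv_1p_1m_lim] ]). }
rewrite Li3_m1, ln_1 in E. lra.
Qed.

(** 2 ln x S_{1,2}(x) - 2 S_{2,2}(x) is an antiderivative of ln x ln(1-x)^2 / x. Adding its mirror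
    image under x -> 1 - x gives the derivative of ln(x)^2 ln(1-x)^2 / 2. The constant is -2
    S_{2,2}(1). *)
Lemma pl_harm_reflection x : 0 < x < 1 ->
  (2 * ln x * pl_harm2 x - 2 * pl_harm3 x) + (2 * ln (1 - x) * pl_harm2 (1 - x) - 2 * pl_harm3 (1 - x))
  - ln x ^ 2 * ln (1 - x) ^ 2 / 2 = - zeta 4 / 2.
Proof.
intros Hx.
apply (const_left (fun x => (2 * ln x * pl_harm2 x - 2 * pl_harm3 x) + (2 * ln (1 - x) * pl_harm2 (1 - x) - 2 * pl_harm3 (1 - x))
  - ln x ^ 2 * ln (1 - x) ^ 2 / 2) (fun _ => 0)); auto.
- intros t Ht. auto_derive.
  + repeat split; try lra; first [apply pl_harm2_ex|apply pl_harm3_ex]; try (apply Rabs_def1; lra); lra.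
  + change (Derive (fun x => pl_harm2 x)) with (Derive pl_harm2). change (Derive (fun x => pl_harm3 x)) with (Derive pl_harm3).
    rewrite !pl_harm2_D, !pl_harm3_D by (try (apply Rabs_def1; lra); lra).
    replace (1 - (1 + - t)) with t by ring. unfold Rminus. field. lra.
- destruct (small_ln_lim (fun x => ln (1 - x)) ln1m_abs) as [S1 S2].
  pose proof ex_pl_coef_harm3 as EX. pose proof ex_pl_coef_harm2 as ES.
  replace (- zeta 4 / 2) with (2 * (0 * pl_quot (harm 1) 2 0) - 2 * pl_harm3 0 + (2 * (0 * pl_harm2 1) - 2 * pl_harm3 1)
    - 0 * 0 / 2).
  2: { rewrite pl_harm3_at_1. unfold pl_harm3 at 1. rewrite pl_0. field. }
  apply (is_lim_seq_ext (fun n => 2 * (null_seq n * ln (null_seq n) * pl_quot (harm 1) 2 (null_seq n)) - 2 * pl_harm3 (null_seq n)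
    + (2 * (ln (1 - null_seq n) * pl_harm2 (1 - null_seq n)) - 2 * pl_harm3 (1 - null_seq n))
    - (ln (1 - null_seq n) * ln (null_seq n)) * (ln (1 - null_seq n) * ln (null_seq n)) / 2)).
  { intros n. unfold pl_harm2 at 2. unfold pl. unfold Rdiv. ring. }
  apply is_lim_seq_minus'; [apply is_lim_seq_plus'; apply is_lim_seq_minus'|].
  + apply is_lim_seq_mult'; [apply is_lim_seq_const|]. apply is_lim_seq_mult'; [apply null_seq_ln_lim|].
    apply pl_quot_lim; auto using null_seq_abs, null_seq_lim.
  + apply is_lim_seq_mult'; [apply is_lim_seq_const|]. apply pl_lim; auto using null_seq_abs, null_seq_lim.
  + apply is_lim_seq_mult'; [apply is_lim_seq_const|]. apply is_lim_seq_mult'; auto.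
    apply pl_lim; auto using null_seq_abs_1m, one_minus_null_seq_lim.
  + apply is_lim_seq_mult'; [apply is_lim_seq_const|]. apply pl_lim; auto using null_seq_abs_1m, one_minus_null_seq_lim.
  + apply is_lim_seq_div'; [|apply is_lim_seq_const|lra]. apply is_lim_seq_mult'; auto.
Qed.

(** The symmetric point of the reflection. Exactly this combination of the two values enters
    [pl_harm_landen] at x = 1. *)
Lemma pl_harm_half : - 2 * ln 2 * pl_harm2 (1/2) - 2 * pl_harm3 (1/2) = ln 2 ^ 4 / 4 - zeta 4 / 4.
Proof.
pose proof (pl_harm_reflection (1/2) ltac:(lra)) as H.
replace (1 - 1/2) with (1/2) in H by lra.
replace (ln (1/2)) with (- ln 2) in H by (rewrite <- ln_Rinv by lra; f_equal; lra). lra.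
Qed.

(** The first two terms are an antiderivative of ln x ln(1+x)^2 / x. Substituting y = 1/(1+x), with
    ln x = ln(1-y) - ln y and dx/x = -dy/(y(1-y)), and integrating by parts gives the others. The
    constant is 4 Li_4(1) - 2 S_{2,2}(1) = 4 zeta(4) - zeta(4)/2. *)
Lemma pl_harm_landen x : 0 < x < 1 ->
  2 * (ln x * pl_harm2 (- x)) - 2 * pl_harm3 (- x)
  + 2 * (ln (1 + x) ^ 2 * Li2f (/ (1 + x)) + 2 * ln (1 + x) * Li3f (/ (1 + x)) + 2 * Li4f (/ (1 + x)))
  - (ln x - ln (1 + x)) ^ 2 * ln (1 + x) ^ 2 / 2
  - 2 * ln (1 + x) * pl_harm2 (/ (1 + x)) - 2 * pl_harm3 (/ (1 + x))
  - ln (1 + x) ^ 4 / 4 - (ln x - ln (1 + x)) * ln (1 + x) ^ 3 = 7/2 * zeta 4.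
Proof.
intros Hx.
apply (const_left (fun x => 2 * (ln x * pl_harm2 (- x)) - 2 * pl_harm3 (- x)
  + 2 * (ln (1 + x) ^ 2 * Li2f (/ (1 + x)) + 2 * ln (1 + x) * Li3f (/ (1 + x)) + 2 * Li4f (/ (1 + x)))
  - (ln x - ln (1 + x)) ^ 2 * ln (1 + x) ^ 2 / 2
  - 2 * ln (1 + x) * pl_harm2 (/ (1 + x)) - 2 * pl_harm3 (/ (1 + x))
  - ln (1 + x) ^ 4 / 4 - (ln x - ln (1 + x)) * ln (1 + x) ^ 3) (fun _ => 0)); auto.
- intros t Ht. pose proof (inv_1p_bounds t Ht) as Y.
  auto_derive.
  + repeat split; try lra;
    first [apply pl_harm2_ex|apply pl_harm3_ex|apply Li2f_ex|apply Li3f_ex|apply Li4f_ex]; try (apply Rabs_def1; lra); lra.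
  + change (Derive (fun x => pl_harm2 x)) with (Derive pl_harm2). change (Derive (fun x => pl_harm3 x)) with (Derive pl_harm3).
    change (Derive (fun x => Li2f x)) with (Derive Li2f).
    change (Derive (fun x => Li3f x)) with (Derive Li3f).
    change (Derive (fun x => Li4f x)) with (Derive Li4f).
    rewrite !pl_harm2_D, !pl_harm3_D, !Li2f_D, !Li3f_D, !Li4f_D by (try (apply Rabs_def1; lra); lra).
    replace (1 - - t) with (1 + t) by ring.
    replace (1 - / (1 + t)) with (t / (1 + t)) by (field; lra).
    rewrite ln_div by lra. field. lra.
- assert (L1 : is_lim_seq (fun n => 1 + null_seq n) 1).
  { replace (Finite 1) with (Finite (1 + 0)) by (f_equal; ring).
    apply is_lim_seq_plus'; [apply is_lim_seq_const|apply null_seq_lim]. }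
  assert (Ly : is_lim_seq (fun n => / (1 + null_seq n)) (/ 1)).
  { apply (is_lim_seq_inv _ 1); [exact L1|]. intros E; injection E; lra. }
  assert (By : forall n, Rabs (/ (1 + null_seq n)) <= 1).
  { intros n. pose proof (null_seq_bounds n). pose proof (inv_1p_bounds (null_seq n) ltac:(lra)). apply Rabs_le; lra. }
  destruct (small_ln_lim (fun x => ln (1 + x)) ln1p_abs) as [S1 S2].
  pose proof ex_pl_coef_harm3 as EX. pose proof ex_pl_coef_harm2 as ES.
  replace (7/2 * zeta 4) with (-2 * (0 * pl_quot (harm 1) 2 (- 0)) - 2 * pl_harm3 (- 0)
   + 2 * (0 * (0 * Li2f (/1)) + 2 * (0 * Li3f (/ 1)) + 2 * Li4f (/ 1))
   - (0 - 0 * 0) * (0 - 0 * 0) / 2 - 2 * (0 * pl_harm2 (/ 1)) - 2 * pl_harm3 (/ 1)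
   - 0 * 0 * (0 * 0) / 4 - (0 - 0 * 0) * (0 * 0)).
  2: { rewrite Rinv_1, pl_harm3_at_1, Li4f_1, Ropp_0. unfold pl_harm3. rewrite pl_0. field. }
  apply (is_lim_seq_ext (fun n => -2 * (null_seq n * ln (null_seq n) * pl_quot (harm 1) 2 (- null_seq n)) - 2 * pl_harm3 (- null_seq n)
   + 2 * (ln (1 + null_seq n) * (ln (1 + null_seq n) * Li2f (/ (1 + null_seq n))) + 2 * (ln (1 + null_seq n) * Li3f (/ (1 + null_seq n)))
       + 2 * Li4f (/ (1 + null_seq n)))
   - (ln (1 + null_seq n) * ln (null_seq n) - ln (1 + null_seq n) * ln (1 + null_seq n)) *
     (ln (1 + null_seq n) * ln (null_seq n) - ln (1 + null_seq n) * ln (1 + null_seq n)) / 2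
   - 2 * (ln (1 + null_seq n) * pl_harm2 (/ (1 + null_seq n))) - 2 * pl_harm3 (/ (1 + null_seq n))
   - ln (1 + null_seq n) * ln (1 + null_seq n) * (ln (1 + null_seq n) * ln (1 + null_seq n)) / 4
   - (ln (1 + null_seq n) * ln (null_seq n) - ln (1 + null_seq n) * ln (1 + null_seq n)) * (ln (1 + null_seq n) * ln (1 + null_seq n)))).
  { intros n. unfold pl_harm2 at 2. unfold pl. unfold Rdiv. ring. }
  assert (Lm : is_lim_seq (fun n => - null_seq n) (- 0)) by (rewrite Ropp_0; apply lim_opp_0, null_seq_lim).
  pose proof (ex_pl_coef_one 2 (proj1 descent_one)). pose proof (ex_pl_coef_one 3 (proj1 descent_harm1)). pose proof (ex_pl_coef_one 4 (proj1 descent_e2)).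
  lims ltac:(first [ exact S2 | exact S1 | exact null_seq_ln_lim
   | apply pl_lim; solve [auto using null_seq_abs_opp]
   | apply pl_quot_lim; solve [auto using null_seq_abs_opp] ]).
Qed.

Lemma Li4f_half : Li4f (1/2) = Li4 (1/2).
Proof.
unfold Li4f, pl, pl_quot, PSeries, Li4. rewrite <- Series_scal_l. apply Series_ext. intros n.
unfold pl_coef, one. change ((1/2) ^ S n) with (1/2 * (1/2) ^ n). unfold Rdiv. ring.
Qed.

(** The limit x -> 1 of [pl_harm_landen]: the factor ln x removes S_{1,2}(-1), and all other
    arguments become 1/2 or -1. *)
Lemma pl_harm3_at_m1 : pl_harm3 (-1) = 15/8 * - zeta 4 + 2 * Li4 (1/2) - zeta 2 * ln 2 ^ 2 / 2
  + 7/4 * ln 2 * zeta 3 + ln 2 ^ 4 / 12.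
Proof.
pose proof ex_pl_coef_harm3 as EX. pose proof ex_pl_coef_harm2 as ES.
pose proof (ex_pl_coef_one 2 (proj1 descent_one)). pose proof (ex_pl_coef_one 3 (proj1 descent_harm1)). pose proof (ex_pl_coef_one 4 (proj1 descent_e2)).
assert (E : 7/2 * zeta 4 = 2 * (ln 1 * pl_harm2 (-1)) - 2 * pl_harm3 (-1)
  + 2 * (ln 2 * ln 2 * Li2f (1/2) + 2 * ln 2 * Li3f (1/2) + 2 * Li4f (1/2))
  - (ln 1 - ln 2) * (ln 1 - ln 2) * (ln 2 * ln 2) / 2
  - 2 * ln 2 * pl_harm2 (1/2) - 2 * pl_harm3 (1/2)
  - ln 2 * ln 2 * (ln 2 * ln 2) / 4 - (ln 1 - ln 2) * (ln 2 * (ln 2 * ln 2))).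
{ apply (const_right _ _ _ pl_harm_landen).
  set (l := fun n => ln (1 + (1 - null_seq n))). set (y := fun n => / (1 + (1 - null_seq n))).
  apply (is_lim_seq_ext (fun n => 2 * (ln (1 - null_seq n) * pl_harm2 (- (1 - null_seq n))) - 2 * pl_harm3 (- (1 - null_seq n))
  + 2 * (l n * l n * Li2f (y n) + 2 * l n * Li3f (y n) + 2 * Li4f (y n))
  - (ln (1 - null_seq n) - l n) * (ln (1 - null_seq n) - l n) * (l n * l n) / 2
  - 2 * l n * pl_harm2 (y n) - 2 * pl_harm3 (y n)
  - l n * l n * (l n * l n) / 4 - (ln (1 - null_seq n) - l n) * (l n * (l n * l n)))).
  { intros n. unfold l, y. unfold Rdiv. ring. }
  assert (L2 : is_lim_seq l (ln 2)) by (apply ln_lim; [lra|apply one_p_1m_lim]).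
  assert (L3 : is_lim_seq (fun n => ln (1 - null_seq n)) (ln 1)) by (apply ln_lim; [lra|apply one_minus_null_seq_lim]).
  assert (By : forall n, Rabs (y n) <= 1) by apply inv_1p_1m_abs.
  assert (Ly : is_lim_seq y (1/2)) by apply inv_1p_1m_lim.
  lims ltac:(first [ exact L2 | exact L3
   | apply pl_lim; solve [auto using null_seq_abs_opp_1m, opp_1m_lim] ]). }
rewrite ln_1, Li2_half, Li3_half, Li4f_half in E. pose proof pl_harm_half as Q.
lra.
Qed.

Lemma alternating_harm_cube : is_series (fun n => (-1) ^ n * (harm 1 n * shift_pow 1 3 n)) (- pl_harm3 (-1)).
Proof.
replace (- pl_harm3 (-1)) with (Series (fun n => pl_coef (harm 1) 3 n * (-1) ^ n)).
- eapply is_series_ext_R; [|apply Series_correct].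
  + intros n; cbv beta. unfold pl_coef. rewrite shift_pow_one. unfold Rdiv. ring.
  + apply (ex_series_dom _ (fun n => Rabs (pl_coef (harm 1) 3 n))); [|apply ex_pl_coef_harm3].
    intros n. rewrite Rabs_mult, pow_m1_abs. lra.
- unfold pl_harm3, pl, pl_quot, PSeries. ring.
Qed.

Lemma half_zeta31_value : half_zeta31 = 23/4 * zeta 4 - 16 * Li4 (1/2) + 4 * ln 2 ^ 2 * zeta 2 - 2/3 * ln 2 ^ 4.
Proof. rewrite (half_zeta31_alternating _ alternating_harm_cube), pl_harm3_at_m1. field. Qed.

(** * The central binomial coefficient and the final combination *)

Lemma central_binomial_S k :
  Binomial.C (2 * S k) (S k) = Binomial.C (2 * k) k * (2 * (INR k + 1/2) * 2 / (INR k + 1)).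
Proof.
unfold Binomial.C.
replace (2 * S k - S k)%nat with (S k) by lia. replace (2 * k - k)%nat with k by lia.
replace (2 * S k)%nat with (S (S (2 * k))) by lia.
change (Factorial.fact (S (S (2 * k)))) with (S (S (2 * k)) * (S (2 * k) * Factorial.fact (2 * k)))%nat.
change (Factorial.fact (S k)) with (S k * Factorial.fact k)%nat.
rewrite !mult_INR, !S_INR, mult_INR. change (INR 2) with 2.
pose proof (INR_fact_neq_0 k). pose proof (pos_INR k). field. lra.
Qed.

Lemma g_central_binomial k :
  0 < Binomial.C (2 * k) k /\ conn (-1/2) k * Binomial.C (2 * k) k = 4 ^ k.
Proof.
induction k as [|k [P E]].
- unfold Binomial.C. simpl. split; lra.
- rewrite central_binomial_S, conn_S. pose proof (pos_INR k). rewrite S_INR. split.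
  + apply Rmult_lt_0_compat; auto. apply Rdiv_lt_0_compat; nra.
  + change (4 ^ S k) with (4 * 4 ^ k). rewrite <- E. field. lra.
Qed.

Lemma cbterm_central_binomial n :
  cbterm 0 n = 4 ^ S n / (INR (S n) ^ 2 * Binomial.C (2 * S n) (S n)).
Proof.
destruct (g_central_binomial (S n)) as [P E].
unfold cbterm. rewrite half_odd_0, <- E. pose proof (INR_Sn_pos n). field. lra.
Qed.

Theorem theorem1 :
  is_series
    (fun n : nat => let k := S n in
       4 ^ k * harm 2 (2 * k) / (INR k ^ 2 * Binomial.C (2 * k) k))
    (- 8 * catalan ^ 2 + 11 * zeta 4 + 2 * Li4 (1 / 2)
     + ln 2 ^ 2 * zeta 2 + 1 / 12 * ln 2 ^ 4)
  /\
  is_series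
    (fun n : nat => let k := S n in
       4 ^ k * (harm 1 (2 * k)) ^ 2 / (INR k ^ 2 * Binomial.C (2 * k) k))
    (8 * catalan ^ 2 + 103 / 2 * zeta 4 - 22 * Li4 (1 / 2)
     + 7 * ln 2 ^ 2 * zeta 2 - 11 / 12 * ln 2 ^ 4).
Proof.
(* Four times H_{2k}^(2) is H_{k-1}^(2) + 1/k^2 plus the sum of [half_pow 2] over the first k
   indices, and the three sums are known. *)
pose proof (is_series_lin 1 1 _ _ _ _ (proj1 cbterm_harm2) (proj1 cbterm_div2)) as D1.
pose proof (is_series_lin (/4) (/4) _ _ _ _ D1 cbterm_odd_square) as S1.
(* Sum (ii) is the combined sum minus sum (i). *)
pose proof (is_series_lin 1 (-1) _ _ _ _ sum_squares S1) as S2.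
assert (Z2 : half_zeta 2 = 3 * zeta 2) by (rewrite half_zeta_zeta by apply descent_one; ring).
assert (Z4 : half_zeta 4 = 15 * zeta 4) by (rewrite half_zeta_zeta by apply descent_e2; ring).
assert (EA : half_zeta22 = 15/4 * zeta 4).
{ unfold half_zeta22. rewrite Z2, Z4. replace ((3 * zeta 2) ^ 2) with (9 * zeta 2 ^ 2) by ring.
  rewrite zeta2_sq. field. }
assert (E2 : half_zeta 2 ^ 2 = 45/2 * zeta 4).
{ rewrite Z2. replace ((3 * zeta 2) ^ 2) with (9 * zeta 2 ^ 2) by ring. rewrite zeta2_sq. field. }
rewrite half_zeta211_value, EA, E2, half_zeta31_value, Z2, Z4 in S1, S2.
assert (H2 : forall n, /4 * (1 * (harm 2 n * cbterm 0 n) + 1 * (/ INR (S n) ^ 2 * cbterm 0 n))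
    + /4 * (cbterm 0 n * rsum (half_pow 2) (S n)) = harm 2 (2 * S n) * cbterm 0 n).
{ intros n. rewrite harm_double, harm_S. field. pose proof (INR_Sn_pos n). lra. }
split.
- eapply is_series_eq; [exact S1| |field].
  intros n; cbv beta zeta. rewrite H2, cbterm_central_binomial. unfold Rdiv. ring.
- eapply is_series_eq; [exact S2| |field].
  intros n; cbv beta zeta. rewrite H2, cbterm_central_binomial. unfold Rdiv. ring.
Qed.
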